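(* Let $A$ be a linear operator on a Banach space $X$ with $\sigma(A)\subset\overline{\mathbb C}_+$ such that \[\sup_{\alpha>0}(\alpha+1)\int_{\mathbb R}\big|\langle(\alpha+i\beta+A)^{-2}x,x^*\rangle\big|\,d\beta<\infty\quad\text{for all }x\in X,\ x^*\in X^*.\] Then $\lim_{t\to\infty}\|f(tA)\|=0$ for every $f\in\mathcal B_0$. Consequently there exist constants $M$ and $\omega>0$ such that $\|e^{-tA}\|\le Me^{-\omega t}$ for all $t\ge0$.
   Context: $\mathbb C_+=\{z:\Re z>0\}$. $\mathcal B$ is the Banach algebra of holomorphic $f$ on $\mathbb C_+$ with $\|f\|_{\mathcal B_0}:=\int_0^\infty\sup_{\beta\in\mathbb R}|f'(\alpha+i\beta)|\,d\alpha<\infty$, norm $\|f\|_{\mathcal B}=\sup|f|+\|f\|_{\mathcal B_0}$; $f(\infty):=\lim_{\Re z\to\infty}f(z)$ and $\mathcal B_0=\{f\in\mathcal B:f(\infty)=0\}$. The hypothesis implies (known result) that $A$ is densely defined... more precisely, for $A$ densely defined satisfying the hypothesis, the formula $\langle f(A)x,x^*\rangle=f(\infty)\langle x,x^*\rangle-\frac2\pi\int_0^\infty\alpha\int_{\mathbb R}\langle(\alpha-i\beta+A)^{-2}x,x^*\rangle f'(\alpha+i\beta)\,d\beta\,d\alpha$ defines a bounded algebra homomorphism $f\mapsto f(A)$ from $\mathcal B$ into $L(X)$, $-A$ generates a bounded $C_0$-semigroup $(e^{-tA})_{t\ge0}$ with $e^{-tA}=e_t(A)$ for $e_t(z)=e^{-tz}$,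 and $f(tA):=f_t(A)$ with $f_t(z)=f(tz)$. ($A$ is assumed densely defined, as a standing assumption.) *)

(* Defs.v *)
From HB Require Import structures.
From mathcomp Require Import all_boot all_order all_algebra.
From mathcomp Require Import all_classical all_reals all_analysis.
From mathcomp Require Export complex.
Export Order.TTheory GRing.Theory Num.Theory.
Export numFieldNormedType.Exports.

Set Implicit Arguments.
Unset Strict Implicit.
Unset Printing Implicit Defensive.

Local Open Scope ring_scope.
Local Open Scope classical_set_scope.

Section Defs.
Variable R : realType.

(* the real-valued norm (the norm of a normed R[i]-module is R[i]-valued,
   with values in the nonnegative reals) *)
Definition rnorm (V : normedModType R[i]) (v : V) : R := complex.Re `|v|.

Definition cabs (z : R[i]) : R := complex.Re `|z|.

Variable X : completeNormedModType R[i].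

Definition dual_elt (phi : X -> R[i]) : Prop :=
  (forall (a : R[i]) (x y : X), phi (a *: x + y) = a * phi x + phi y) /\
  exists c : R, forall x : X, cabs (phi x) <= c * rnorm x.

Definition bounded_op (T : X -> X) : Prop :=
  (forall (a : R[i]) (x y : X), T (a *: x + y) = a *: T x + T y) /\
  exists c : R, forall x : X, rnorm (T x) <= c * rnorm x.

Definition dd_linear_op (D : set X) (A : X -> X) : Prop :=
  D 0 /\
  (forall (a : R[i]) (x y : X), D x -> D y -> D (a *: x + y)) /\
  (forall (a : R[i]) (x y : X), D x -> D y -> A (a *: x + y) = a *: A x + A y) /\
  closure D = setT.

(* [Rz] is the bounded inverse of [z + A] : D -> X, i.e. -z lies in the
   resolvent set of A and Rz = (z + A)^{-1}. *)
Definition is_inverse_shift (D : set X) (A : X -> X) (z : R[i]) (Rz : X -> X)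
  : Prop :=
  bounded_op Rz /\
  (forall x : X, D (Rz x) /\ z *: Rz x + A (Rz x) = x) /\
  (forall y : X, D y -> Rz (z *: y + A y) = y).

(* sigma(A) is contained in the closed right half-plane: every lambda with
   Re lambda < 0 is in the resolvent set.  We package a choice of the
   resolvents: [Res z = (z + A)^{-1}] for Re z > 0 (i.e. lambda = -z). *)
Definition resolvent_right (D : set X) (A : X -> X) (Res : R[i] -> X -> X)
  : Prop :=
  forall z : R[i], 0 < complex.Re z -> is_inverse_shift D A z (Res z).

Definition Rint (S : set R) (g : R -> R) : R :=
  Rintegral (@lebesgue_measure R) S g.

Definition Cint (S : set R) (g : R -> R[i]) : R[i] :=
  (Rint S (fun t => complex.Re (g t)))%:C%C +
  'i%C * (Rint S (fun t => complex.Im (g t)))%:C%C.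

Definition cderiv (f : R[i] -> R[i]) (z : R[i]) : R[i] :=
  derive (f : R[i]^o -> R[i]^o) z 1.

Definition holo_Cplus (f : R[i] -> R[i]) : Prop :=
  forall z : R[i], 0 < complex.Re z -> derivable (f : R[i]^o -> R[i]^o) z 1.

Definition B0_seminorm (f : R[i] -> R[i]) : \bar R :=
  (\int[@lebesgue_measure R]_(a in `]0%R, +oo[%classic)
     ereal_sup [set (cabs (cderiv f (a +i* b)%C))%:E | b in [set: R]])%E.

Definition classB (f : R[i] -> R[i]) : Prop :=
  holo_Cplus f /\
  (exists c : R, forall z, 0 < complex.Re z -> cabs (f z) <= c) /\
  (B0_seminorm f < +oo)%E.

Definition lim_Re_infty (f : R[i] -> R[i]) (L : R[i]) : Prop :=
  forall eps : R, 0 < eps -> exists a : R, forall z : R[i],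
    a < complex.Re z -> cabs (f z - L) < eps.

Definition classB0 (f : R[i] -> R[i]) : Prop := classB f /\ lim_Re_infty f 0.

(* [T] represents f(A) through the formula of the B-calculus:
   <f(A)x, x*> = f(oo)<x,x*>
      - 2/pi int_0^oo alpha int_R <(alpha - i beta + A)^{-2} x, x*>
                                   f'(alpha + i beta) dbeta dalpha *)
Definition Bcalc_rep (Res : R[i] -> X -> X) (f : R[i] -> R[i]) (T : X -> X)
  : Prop :=
  exists L : R[i], lim_Re_infty f L /\
  forall (x : X) (phi : X -> R[i]), dual_elt phi ->
    phi (T x) =
      L * phi x
      - (2 / pi)%:C%C *
        Cint `]0%R, +oo[%classic (fun a =>
          a%:C%C * Cint [set: R] (fun b =>
            phi (Res (a -i* b)%C (Res (a -i* b)%C x)) *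
            cderiv f (a +i* b)%C)).

Definition dilate (t : R) (f : R[i] -> R[i]) : R[i] -> R[i] :=
  fun z => f (t%:C%C * z).

Definition cexp_neg (t : R) : R[i] -> R[i] :=
  fun z => (expR (- t * complex.Re z))%:C%C *
           ((cos (t * complex.Im z))%:C%C - 'i%C * (sin (t * complex.Im z))%:C%C).

End Defs.

(* Main.v *)
Require Import Defs.
From HB Require Import structures.
From mathcomp Require Import all_boot all_order all_algebra.
From mathcomp Require Import all_classical all_reals all_analysis.
From mathcomp Require Import complex.
From mathcomp Require Import measurable_realfun ring lra.
Import Order.TTheory GRing.Theory Num.Theory.
Import numFieldNormedType.Exports.

Set Implicit Arguments.
Unset Strict Implicit.
Unset Printing Implicit Defensive.

Local Open Scope ring_scope.
Local Open Scope classical_set_scope.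

(* Write [R(z) = (z + A)^-1]. By the uniform boundedness principle the hypothesis
   holds with a constant [K |x| |x*|]. Hence |f(tA)| is at most a multiple of
   the integral of sup_b |f'(s + ib)| s / (s + t) ds, which tends to 0 by
   dominated convergence.

   For the exponential bound, f = e_t turns the area integral into the inverse
   Laplace integral 2 pi t <e^{-tA} x, x*> = int e^{tz} <R(z)^2 x, x*> db on any
   line Re z = a > 0, because this integral does not depend on a. Taking a = 1/t
   gives |e^{-tA}| <= C / (1 + t). On the range of R(1)^4 the expansion
   R(z)y = y/z - R(z)Ay/z yields the derivative of e^{-tA}y with a quadratic
   error term, so e^{-(T-r)A} e^{-rA} y is constant in r: the semigroup law.
   Decay at one time and the semigroup law give exponential decay. The contour
   shift and the derivatives under the integral only use uniform quadratic
   Taylor estimates and the translation invariance of Lebesgue measure. *)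

(** The operators [T t] and [S t] are known only through the weak formula [Bcalc_rep], so everything
    about them is read off from scalar integrals, one functional at a time, and Hahn-Banach returns
    to norms. Two obstacles shape the estimates. Neither [sup_b |f'(a + ib)|] nor the inner integral
    of the formula is visibly measurable in [a]: the former is replaced by a countable supremum, the
    latter is only bounded through a dominating function. And the integrals of [e^{tz} <R(z)x, x*>]
    need not converge absolutely: on the range of [R(1)] one has [R(z)y = O(1/|z|)], and each
    further factor [R(1)] allows one more expansion in powers of [1/z]. This rests on a bound of
    [R(z)] uniform in [Re z > 0], obtained by integrating [d/db R(a + ib) = -i R(a + ib)^2] along a
    vertical line. The power [R(1)^4] is dictated by the Taylor remainder of [e^{hz}], which costs
    [|z|^2] and must leave an integrable [|z|^-2]. The constant [2 pi] is that of the integral of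
    [e^{tz}/z^2], traced back to the integral of [1/(1 + b^2)]. *)

Section complex_norms.
Variable R : realType.
Implicit Types z w : R[i].

Lemma normC_cabs z : `|z| = (cabs z)%:C%C.
Proof. by rewrite /cabs normc_def. Qed.

Lemma cabsE z : cabs z = Num.sqrt (complex.Re z ^+ 2 + complex.Im z ^+ 2).
Proof. by rewrite /cabs normc_def. Qed.

Lemma cabs_ge0 z : 0 <= cabs z.
Proof. by rewrite cabsE sqrtr_ge0. Qed.

Lemma cabsM z w : cabs (z * w) = cabs z * cabs w.
Proof. by apply/(@complexI R); rewrite rmorphM/= -!normC_cabs normrM. Qed.

Lemma cabsD z w : cabs (z + w) <= cabs z + cabs w.
Proof. by rewrite -lecR rmorphD/= -!normC_cabs ler_normD. Qed.

Lemma cabsN z : cabs (- z) = cabs z.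
Proof. by rewrite /cabs normrN. Qed.

Lemma cabsB z w : cabs (z - w) = cabs (w - z).
Proof. by rewrite /cabs distrC. Qed.

Lemma cabsDB z w u : cabs (z - w) <= cabs (z - u) + cabs (u - w).
Proof. by rewrite (_ : z - w = (z - u) + (u - w)); [exact: cabsD | ring]. Qed.

Lemma cabs0 : cabs (0 : R[i]) = 0.
Proof. by rewrite /cabs normr0. Qed.

Lemma cabs1 : cabs (1 : R[i]) = 1.
Proof. by rewrite /cabs normr1. Qed.

Lemma cabs0_eq0 z : cabs z <= 0 -> z = 0.
Proof.
move=> z0; apply/normr0_eq0; rewrite normC_cabs.
by rewrite (_ : cabs z = 0)//; apply/eqP; rewrite eq_le z0 cabs_ge0.
Qed.

Lemma cabs_real (r : R) : cabs r%:C%C = `|r|.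
Proof. by rewrite cabsE/= expr0n addr0 sqrtr_sqr. Qed.

Lemma cabs_i : cabs 'i%C = 1 :> R.
Proof. by rewrite cabsE/= expr0n expr1n add0r sqrtr1. Qed.

Lemma cabsV z : cabs z^-1 = (cabs z)^-1.
Proof. by apply/(@complexI R); rewrite fmorphV/= -!normC_cabs normfV. Qed.

Lemma cabsX z n : cabs (z ^+ n) = cabs z ^+ n.
Proof. by elim: n => [|n ih]; rewrite ?expr0 ?cabs1// !exprS cabsM ih. Qed.

Lemma cabs_Re z : `|complex.Re z| <= cabs z.
Proof. by rewrite cabsE -sqrtr_sqr ler_wsqrtr// lerDl sqr_ge0. Qed.

Lemma cabs_Im z : `|complex.Im z| <= cabs z.
Proof. by rewrite cabsE -sqrtr_sqr ler_wsqrtr// lerDr sqr_ge0. Qed.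

Lemma cabs_le_ReIm z : cabs z <= `|complex.Re z| + `|complex.Im z|.
Proof.
have -> : z = (complex.Re z)%:C%C + 'i%C * (complex.Im z)%:C%C by exact: complexE.
apply: le_trans (cabsD _ _) _; rewrite cabsM cabs_i mul1r !cabs_real/=.
by rewrite !(mul0r,mul1r,mulr0,addr0,add0r,subr0).
Qed.

Lemma cabs_sqr z : cabs z ^+ 2 = complex.Re z ^+ 2 + complex.Im z ^+ 2.
Proof. by rewrite cabsE sqr_sqrtr// addr_ge0 ?sqr_ge0. Qed.

Lemma ReD z w : complex.Re (z + w) = complex.Re z + complex.Re w.
Proof. by case: z w => [? ?] [? ?]. Qed.
Lemma ImD z w : complex.Im (z + w) = complex.Im z + complex.Im w.
Proof. by case: z w => [? ?] [? ?]. Qed.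
Lemma ReM z w : complex.Re (z * w) =
  complex.Re z * complex.Re w - complex.Im z * complex.Im w.
Proof. by case: z w => [? ?] [? ?]. Qed.
Lemma ImM z w : complex.Im (z * w) =
  complex.Re z * complex.Im w + complex.Im z * complex.Re w.
Proof. by case: z w => [? ?] [? ?]. Qed.
Lemma ReN z : complex.Re (- z) = - complex.Re z.
Proof. by case: z. Qed.
Lemma ImN z : complex.Im (- z) = - complex.Im z.
Proof. by case: z. Qed.
Lemma ReCM (r : R) z : complex.Re (r%:C%C * z) = r * complex.Re z.
Proof. by rewrite ReM/= mul0r subr0. Qed.
Lemma ImCM (r : R) z : complex.Im (r%:C%C * z) = r * complex.Im z.
Proof. by rewrite ImM/= mul0r addr0. Qed.

Lemma complex_eq z w : complex.Re z = complex.Re w ->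
  complex.Im z = complex.Im w -> z = w.
Proof. by case: z w => [? ?] [? ?] /= -> ->. Qed.

Lemma cabs_exists_phase z : exists2 u : R[i], cabs u = 1 & u * z = (cabs z)%:C%C.
Proof.
have [->|z0] := eqVneq z 0; first by exists 1; rewrite ?cabs1// mulr0 cabs0.
have cz0 : cabs z != 0 by apply: contra_neq z0 => h; apply/cabs0_eq0; rewrite h.
exists ((cabs z)%:C%C / z); last by rewrite mulfVK.
by rewrite cabsM cabsV cabs_real (ger0_norm (cabs_ge0 _)) divff.
Qed.

Section rnorm.
Variable V : normedModType R[i].
Implicit Types x y : V.

Lemma norm_rnorm x : `|x| = (rnorm x)%:C%C.
Proof. by rewrite /rnorm RRe_real// ger0_real. Qed.

Lemma rnorm_ge0 x : 0 <= rnorm x.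
Proof. by rewrite -ler0c -norm_rnorm. Qed.

Lemma rnormD x y : rnorm (x + y) <= rnorm x + rnorm y.
Proof. by rewrite -lecR rmorphD/= -!norm_rnorm ler_normD. Qed.

Lemma rnormZ a x : rnorm (a *: x) = cabs a * rnorm x.
Proof. by apply/(@complexI R); rewrite rmorphM/= -!norm_rnorm -normC_cabs normrZ. Qed.

Lemma rnormN x : rnorm (- x) = rnorm x.
Proof. by rewrite /rnorm normrN. Qed.

Lemma rnormB x y : rnorm (x - y) = rnorm (y - x).
Proof. by rewrite /rnorm distrC. Qed.

Lemma rnorm0 : rnorm (0 : V) = 0.
Proof. by rewrite /rnorm normr0. Qed.

Lemma rnorm0_eq0 x : rnorm x <= 0 -> x = 0.
Proof.
move=> x0; apply/normr0_eq0; rewrite norm_rnorm.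
by rewrite (_ : rnorm x = 0)//; apply/eqP; rewrite eq_le x0 rnorm_ge0.
Qed.

End rnorm.

End complex_norms.

Lemma le_eps (R : realType) (x y : R) : (forall e : R, 0 < e -> x <= y + e) -> x <= y.
Proof. by move=> h; apply/ler_addgt0Pr => e e0; exact: h. Qed.

Lemma eq_ler (R : realType) (x y : R) : x = y -> x <= y.
Proof. by move=> ->. Qed.

(** * The Hahn-Banach theorem, real and then complex *)

Section hahn_banach.
Variables (R : realType) (X : normedModType R[i]).
Implicit Types (x y : X) (r s t : R).

(* Graph of a real-linear functional dominated by the norm on a real subspace
   containing [x0]; the empty graph is admitted for the sake of Zorn's lemma. *)
Let dominated_graph (x0 : X) (G : set (X * R)) :=
  [/\ G !=set0 -> forall t, G (t%:C%C *: x0, t * rnorm x0),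
      forall x r y s t, G (x, r) -> G (y, s) -> G (t%:C%C *: x + y, t * r + s) &
      forall x r, G (x, r) -> r <= rnorm x].

(** A maximal dominated graph exists by Zorn's lemma. It is total, since a missing vector could be
    adjoined with a suitable value, and functional, since the difference of two values at one point
    is a value at 0, hence at most 0. *)
Lemma real_hahn_banach (x0 : X) : exists u : X -> R,
  [/\ forall t x y, u (t%:C%C *: x + y) = t * u x + u y,
      forall x, u x <= rnorm x & u x0 = rnorm x0].
Proof.
have [A [PA maxA]] : exists A, dominated_graph x0 A /\
    forall B, A `<` B -> ~ dominated_graph x0 B.
  apply: Zorn_bigcup => F FP totF; split.
  - move=> [z [G FG Gz]] t; exists G => //.
    by have [+ _ _] := FP _ FG; apply; exists z.
  - move=> x r y s t [G FG Gx] [H FH Hy].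
    have [GH|HG] := totF _ _ FG FH.
    + by exists H => //; have [_ + _] := FP _ FH; apply => //; exact: GH.
    + by exists G => //; have [_ + _] := FP _ FG; apply => //; exact: HG.
  - by move=> x r [G FG Gx]; have [_ _] := FP _ FG; apply.
have A0 : A !=set0.
  (* The empty graph is not maximal: the graph of [t x0 -> t |x0|] on the real line through [x0]
     extends it. *)
  apply/set0P/eqP => A0.
  pose B := [set p : X * R | exists t, p = (t%:C%C *: x0, t * rnorm x0)].
  apply: (maxA B).
    rewrite A0; split; first exact: sub0set.
    by move=> /(_ (0%:C%C *: x0, 0 * rnorm x0)); apply; exists 0.
  split => [_ t|x r y s t|x r]; first by exists t.
  - move=> [a [-> ->]] [b [-> ->]]; exists (t * a + b).
    by rewrite rmorphD rmorphM/= scalerDl scalerA mulrDl mulrA.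
  - move=> [t [-> ->]]; rewrite rnormZ cabs_real ler_wpM2r ?rnorm_ge0//.
    exact: ler_norm.
have [/(_ A0) base lin dom] := PA.
have A00 : A (0, 0) by have := base 0; rewrite mul0r scale0r.
have scale t x r : A (x, r) -> A (t%:C%C *: x, t * r).
  by move=> Ax; have := lin _ _ _ _ t Ax A00; rewrite !addr0.
have total y : exists r, A (y, r).
  apply: contrapT => noy.
  pose E := [set e | exists x r, A (x, r) /\ e = r - rnorm (x - y)].
  have ub x r : A (x, r) -> ubound E (rnorm (x + y) - r).
    move=> Ax _ [x' [r' [Ax' ->]]].
    have := lin _ _ _ _ 1 Ax Ax'; rewrite scale1r mul1r => /dom.
    have := rnormD (x + y) (x' - y).
    by rewrite addrACA subrr addr0; lra.
  have E0 : E !=set0 by exists (0 - rnorm (0 - y)), 0, 0.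
  (* A value [c] at [y] keeps the extension dominated as soon as [r - |x - y| <= c <= |x + y| - r]
     for all [(x, r)] in the graph. The triangle inequality puts every lower bound below every upper
     bound, so the supremum of the lower ones serves. *)
  pose c := sup E.
  have c1 x r : A (x, r) -> r + c <= rnorm (x + y).
    by move=> /ub /(ge_sup E0); rewrite -/c; lra.
  have c2 x r : A (x, r) -> r - c <= rnorm (x - y).
    move=> Ax; suff: r - rnorm (x - y) <= c by lra.
    apply: ub_le_sup; last by exists x, r.
    by exists (rnorm (0 + y) - 0); exact: ub.
  pose B := [set p : X * R | exists x r t,
    A (x, r) /\ p = (x + t%:C%C *: y, r + t * c)].
  apply: (maxA B).
    split.
      move=> [x r] Ax; exists x, r, 0; split => //.
      by rewrite scale0r mul0r !addr0.
    move=> /(_ (y, c)) BA; apply: noy; exists c; apply: BA.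
    by exists 0, 0, 1; split => //; rewrite scale1r mul1r !add0r.
  split.
  - move=> _ t; exists (t%:C%C *: x0), (t * rnorm x0), 0; split; first exact: base.
    by rewrite scale0r mul0r !addr0.
  - move=> x r x' r' t [a [b [d [Aab [-> ->]]]]] [a' [b' [d' [Aab' [-> ->]]]]].
    exists (t%:C%C *: a + a'), (t * b + b'), (t * d + d'); split; first exact: lin.
    congr pair; last by ring.
    rewrite rmorphD rmorphM/= scalerDl scalerDr -scalerA.
    by rewrite -!addrA; congr (_ + _); rewrite addrCA.
  - move=> _ _ [x [r [t [Ax [-> ->]]]]].
    (* Division by [|t|] reduces negative [t] to [c2] and positive [t] to [c1]. *)
    have [t0|t0|->] := ltgtP t 0; last by rewrite scale0r mul0r !addr0; exact: dom.
    + have := scale (- t)^-1 _ _ Ax => /c2 h.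
      have e : x + t%:C%C *: y = (- t)%:C%C *: ((- t)^-1%:C%C *: x - y).
        rewrite scalerBr scalerA -rmorphM/= divff ?scale1r; last by lra.
        by rewrite rmorphN/= scaleNr opprK.
      rewrite e rnormZ cabs_real ger0_norm; last by lra.
      have -> : r + t * c = - t * ((- t)^-1 * r - c) by field; lra.
      by rewrite ler_wpM2l//; lra.
    + have := scale t^-1 _ _ Ax => /c1 h.
      have e : x + t%:C%C *: y = t%:C%C *: (t^-1%:C%C *: x + y).
        by rewrite scalerDr scalerA -rmorphM/= divff ?scale1r//; lra.
      rewrite e rnormZ cabs_real ger0_norm; last by lra.
      have -> : r + t * c = t * (t^-1 * r + c) by field; lra.
      by rewrite ler_wpM2l//; lra.
have [u Au] := choice total.
have uniq x r s : A (x, r) -> A (x, s) -> r = s.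
  have le a b : A (x, a) -> A (x, b) -> a <= b.
    move=> Aa Ab; have := lin _ _ _ _ (-1) Ab Aa => /dom.
    by rewrite rmorphN rmorph1 scaleN1r addNr rnorm0; lra.
  by move=> Ar As; apply/eqP; rewrite eq_le !le.
exists u; split => [t x y|x|].
- by apply: uniq (Au _) _; exact: lin.
- exact: dom (Au x).
- by apply: uniq (Au _) _; have := base 1; rewrite scale1r mul1r.
Qed.

End hahn_banach.

Section norming_functional.
Variables (R : realType) (X : completeNormedModType R[i]).

(** A complex-linear functional is determined by its real part [u] as [u x - i u(ix)]. Rotating [x]
    by a phase that makes [phi x] real transfers the bound from [u] to [phi]. *)
Lemma hahn_banach (x0 : X) : exists phi : X -> R[i],
  [/\ dual_elt phi, forall x, cabs (phi x) <= rnorm x & phi x0 = (rnorm x0)%:C%C].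
Proof.
have [u [lin dom ux0]] := real_hahn_banach x0.
have uD x y : u (x + y) = u x + u y.
  by have := lin 1 x y; rewrite scale1r mul1r.
have u0 : u 0 = 0 by have := uD 0 0; rewrite addr0; lra.
have uZ t x : u (t%:C%C *: x) = t * u x.
  by have := lin t x 0; rewrite !addr0 u0 addr0.
pose phi x := (u x -i* u ('i%C *: x))%C.
have phiD x y : phi (x + y) = phi x + phi y.
  rewrite /phi scalerDr !uD; apply: complex_eq => /=; first by [].
  by rewrite opprD.
have phiR (t : R) x : phi (t%:C%C *: x) = t%:C%C * phi x.
  rewrite /phi scalerA mulrC -scalerA !uZ; apply: complex_eq => /=; ring.
have phiI x : phi ('i%C *: x) = 'i%C * phi x.
  rewrite /phi scalerA -expr2 sqr_i; have := uZ (-1) x; rewrite rmorphN rmorph1 => ->.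
  by apply: complex_eq => /=; ring.
have phiZ a x : phi (a *: x) = a * phi x.
  rewrite [in LHS](complexE a) scalerDl -scalerA phiD phiI !phiR.
  by rewrite [in RHS](complexE a); ring.
have philin a x y : phi (a *: x + y) = a * phi x + phi y by rewrite phiD phiZ.
have phidom x : cabs (phi x) <= rnorm x.
  have [e e1 ez] := cabs_exists_phase (phi x).
  have : u (e *: x) <= rnorm x by apply: le_trans (dom _) _; rewrite rnormZ e1 mul1r.
  by rewrite -[u _]/(complex.Re (phi (e *: x))) phiZ ez.
exists phi; split => //.
  by split=> //; exists 1 => x; rewrite mul1r.
(* The real part of [phi x0] already equals [|x0|], so the bound leaves no room for an imaginary
   part. *)
have := phidom x0; rewrite cabsE => h.
have {h} : complex.Re (phi x0) ^+ 2 + complex.Im (phi x0) ^+ 2 <= rnorm x0 ^+ 2.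
  rewrite -(@sqr_sqrtr _ (_ + _)) ?addr_ge0 ?sqr_ge0//.
  by rewrite lerXn2r// nnegrE ?sqrtr_ge0 ?rnorm_ge0.
rewrite {1}/phi /= ux0 gerDl => h; apply: complex_eq; first by rewrite /= ux0.
apply/eqP; rewrite -sqrf_eq0 eq_le sqr_ge0 andbT.
by rewrite /phi /= in h *.
Qed.

Lemma rnorm_le_dual (x : X) (C : R) :
  (forall phi, dual_elt phi -> (forall y, cabs (phi y) <= rnorm y) ->
    cabs (phi x) <= C) -> rnorm x <= C.
Proof.
have [phi [dphi phi1 phix]] := hahn_banach x; move=> /(_ _ dphi phi1).
by rewrite phix cabs_real ger0_norm// rnorm_ge0.
Qed.

Lemma dual_eq (x y : X) : (forall phi, dual_elt phi -> phi x = phi y) -> x = y.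
Proof.
move=> h; apply/eqP; rewrite -subr_eq0; apply/eqP/rnorm0_eq0/rnorm_le_dual.
move=> phi dphi _; have [lin _] := dphi.
have := lin (-1) y x; rewrite scaleN1r addrC => ->.
by rewrite mulN1r (h _ dphi) addNr cabs0.
Qed.

End norming_functional.

(** * Uniform boundedness for an abstract norm, covering a space and its dual alike *)

Section uniform_boundedness.
Variables (R : realType) (V : lmodType R[i]) (B : V -> R -> Prop).
(* [B v c] stands for "v has norm at most c" *)
Hypothesis B_zero : B 0 0.
Hypothesis B_le : forall v c d, B v c -> c <= d -> B v d.
Hypothesis B_ge0 : forall v c, B v c -> 0 <= c.
Hypothesis B_add : forall v w c d, B v c -> B w d -> B (v + w) (c + d).
Hypothesis B_opp : forall v c, B v c -> B (- v) c.
Hypothesis B_scale : forall (r : R) v c, 0 <= r -> B v c -> B (r%:C%C *: v) (r * c).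
Hypothesis B_complete : forall u : nat -> V, B (u 0) 0 ->
  (forall n, B (u n.+1 - u n) (3^-1 ^+ n)) ->
  exists v, forall n, B (v - u n) (3 / 2 * 3^-1 ^+ n).

Variables (I : Type) (p : I -> V -> R).
Hypothesis p_add : forall i v w c d, B v c -> B w d -> p i (v + w) <= p i v + p i w.
Hypothesis p_opp : forall i v c, B v c -> p i (- v) = p i v.
Hypothesis p_scale : forall i (r : R) v c, 0 <= r -> B v c -> p i (r%:C%C *: v) = r * p i v.
Hypothesis p_bounded : forall i, exists K, forall v c, B v c -> p i v <= K * c.
Hypothesis p_pointwise : forall v c, B v c -> exists C, forall i, p i v <= C.

(** The operator norm of the seminorm [p i], finite by [p_bounded]. *)
Let N i := sup [set p i v | v in [set v | B v 1]].

Let N_has_sup i : has_sup [set p i v | v in [set v | B v 1]].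
Proof.
split; first by exists (p i 0), 0 => //; apply: B_le B_zero _.
by have [K pK] := p_bounded i; exists (K * 1) => _ [v Bv <-]; exact: pK.
Qed.

Let p_le_N i v c : 0 < c -> B v c -> p i v <= c * N i.
Proof.
move=> c0 Bv; have Bv1 : B (c^-1%:C%C *: v) 1.
  by rewrite -(mulVf (lt0r_neq0 c0)); apply: B_scale => //; rewrite invr_ge0 ltW.
have -> : v = c%:C%C *: (c^-1%:C%C *: v).
  by rewrite scalerA -rmorphM/= divff ?scale1r// lt0r_neq0.
rewrite (@p_scale _ _ _ 1)// ?(ltW c0)// ler_wpM2l// ?(ltW c0)//.
by apply: ub_le_sup; [case: (N_has_sup i)|exists (c^-1%:C%C *: v)].
Qed.

(* Sokal's gliding hump: x_(n+1) = x_n +- 3^-n v_n, with v_n almost realizing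
   the norm of p_(i_n) and the sign chosen so that p_(i_n) does not decrease. *)
Lemma uniform_boundedness : exists K, forall i v c, B v c -> p i v <= K * c.
Proof.
apply: contrapT => nK.
have large K : 0 <= K -> exists i, K < N i.
  move=> K0; apply: contrapT => h; apply: nK; exists K => i v c Bv.
  have := B_ge0 Bv; rewrite le_eqVlt => /predU1P[c0|c0].
    by have [K' pK'] := p_bounded i; have := pK' _ _ Bv; rewrite -c0 !mulr0.
  apply: le_trans (p_le_N i c0 Bv) _; rewrite mulrC ler_wpM2r// ?(ltW c0)//.
  by rewrite leNgt; apply/negP => ?; apply: h; exists i.
(* The threshold anticipates the final balance: [p (i n) y] keeps [2/3 - 1/2 = 1/6] of
   [3^-n N (i n)], and this has to exceed [n]. *)
have /choice[i iP] : forall n : nat, exists i, 6 * 3 ^+ n * n%:R < N i.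
  by move=> n; apply: large; rewrite !mulr_ge0// exprn_ge0.
have N0 n : 0 < N (i n).
  by apply: le_lt_trans (iP n); rewrite !mulr_ge0// exprn_ge0.
have /choice[v vP] : forall n : nat, exists v, B v 1 /\ 2 / 3 * N (i n) < p (i n) v.
  move=> n; have [|_ [v Bv <-] vN] := @sup_adherent _ _ (3^-1 * N (i n)) _ (N_has_sup (i n)).
    by rewrite mulr_gt0//; lra.
  by exists v; split => //; move: vN; rewrite -/(N (i n)); lra.
pose w n := (3^-1 ^+ n)%:C%C *: v n.
have e0 n : 0 <= 3^-1 ^+ n :> R by rewrite exprn_ge0//; lra.
have Bw n : B (w n) (3^-1 ^+ n).
  by rewrite -[X in B _ X]mulr1; apply: B_scale => //; have [] := vP n.
pose fix x n := if n is m.+1 then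
  (if p (i m) (w m) <= p (i m) (x m + w m) then x m + w m else x m - w m) else 0.
have xS n : B (x n.+1 - x n) (3^-1 ^+ n).
  rewrite /=; case: ifP => _; first by rewrite addrC addKr.
  by rewrite addrC addKr; exact: B_opp.
have Bx n : exists c, B (x n) c.
  elim: n => [|n [c Bc]]; first by exists 0.
  by exists (3^-1 ^+ n + c); rewrite -(subrK (x n) (x n.+1)); exact: B_add.
have px n : p (i n) (w n) <= p (i n) (x n.+1).
  rewrite /=; case: ifPn => // /negP/negP; rewrite -ltNge => lt1.
  have [c Bc] := Bx n.
  (* Since [2 p(w) <= p(x + w) + p(x - w)], when the plus sign falls below [p(w)] the minus sign
     lies above it. *)
  have h : p (i n) (2%:C%C *: w n) <= p (i n) (x n + w n) + p (i n) (x n - w n).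
    rewrite -(@p_opp _ (x n - w n) (c + 3^-1 ^+ n)); last exact/B_add/B_opp.
    apply: le_trans (p_add (i n) (B_add Bc (Bw n)) (B_opp (B_add Bc (B_opp (Bw n))))).
    rewrite opprB addrCA (addrAC (x n)) subrr add0r.
    by have -> : 2%:C%C *: w n = w n + w n by rewrite rmorph_nat scaler_nat mulr2n.
  move: h; rewrite (@p_scale _ _ _ (3^-1 ^+ n))//; lra.
have [y yP] := B_complete (u := x) B_zero xS.
have [c By] : exists c, B y c by exists (3 / 2 * 3^-1 ^+ 0); have := yP 0%N; rewrite subr0.
have [C pC] := p_pointwise By.
have key n : n%:R <= C.
  apply: le_trans (pC (i n)).
  have h1 : p (i n) (y - x n.+1) <= (2^-1 * 3^-1 ^+ n) * N (i n).
    apply: p_le_N; first by rewrite mulr_gt0// ?exprn_gt0//; lra.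
    by apply: B_le (yP n.+1) _; rewrite exprS; lra.
  have h2 : p (i n) (x n.+1) <= p (i n) y + p (i n) (y - x n.+1).
    have [d Bd] := Bx n.+1.
    rewrite -(@p_opp _ (y - x n.+1) (c + d)); last exact/B_add/B_opp.
    apply: le_trans (p_add (i n) By (B_opp (B_add By (B_opp Bd)))).
    by rewrite opprB addrC subrK.
  have h3 : 3^-1 ^+ n * (2 / 3 * N (i n)) <= p (i n) (w n).
    rewrite (@p_scale _ _ _ 1)//; last by case: (vP n).
    by rewrite ler_wpM2l//; have [_ /ltW] := vP n.
  have h4 : n%:R <= 6^-1 * (3^-1 ^+ n * N (i n)).
    have := ltW (iP n) => /(ler_wpM2l (e0 n)).
    have e1 : 3^-1 ^+ n * 3 ^+ n = 1 :> R by rewrite -exprMn mulVf ?expr1n.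
    rewrite (_ : _ * (6 * 3 ^+ n * n%:R) = 6 * (3^-1 ^+ n * 3 ^+ n) * n%:R); last by ring.
    by rewrite e1; lra.
  by have := px n; lra.
have := key (Num.trunc C).+1; have := truncnS_gt C; lra.
Qed.

End uniform_boundedness.

(** * Convergence of sequences with geometric increments *)

Section completeness.
Variable R : realType.

Lemma geometric_tail (V : normedModType R[i]) (u : nat -> V) (C : R) :
  (forall n, rnorm (u n.+1 - u n) <= C * 3^-1 ^+ n) ->
  forall n k, rnorm (u (n + k)%N - u n) <= C * (3 / 2 * 3^-1 ^+ n).
Proof.
move=> uC; have C0 : 0 <= C.
  by have := uC 0%N; rewrite expr0 mulr1; apply: le_trans; exact: rnorm_ge0.
(* Subtracting the tail beyond [n + k] makes the induction telescope. *)
move=> n k; suff : rnorm (u (n + k)%N - u n) <=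
    C * (3 / 2 * 3^-1 ^+ n) - C * (3 / 2 * 3^-1 ^+ (n + k)).
  by move=> /le_trans; apply; rewrite gerBl !mulr_ge0// exprn_ge0//; lra.
elim: k => [|k ih]; first by rewrite addn0 !subrr rnorm0.
have := rnormD (u (n + k).+1 - u (n + k)%N) (u (n + k)%N - u n).
rewrite addrA subrK addnS => /le_trans; apply.
by have := uC (n + k)%N; rewrite exprS; move: ih; lra.
Qed.

Lemma expr3V_lt (e : R) : 0 < e -> exists n, 3^-1 ^+ n < e.
Proof.
move=> e0; have /cvgrPdist_lt /(_ _ e0) [n _ h] : (3^-1 : R) ^+ n @[n --> \oo] --> (0 : R).
  by apply: cvg_expr; rewrite ger0_norm; lra.
by exists n; have := h n (leqnn n); rewrite sub0r normrN ger0_norm// exprn_ge0//; lra.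
Qed.

Lemma geometric_limit (V : normedModType R[i]) (u : nat -> V) (C : R) (v : V) :
  (forall n, rnorm (u n.+1 - u n) <= C * 3^-1 ^+ n) ->
  (forall e, 0 < e -> exists m0, forall m, (m0 <= m)%N -> rnorm (v - u m) <= e) ->
  forall n, rnorm (v - u n) <= C * (3 / 2 * 3^-1 ^+ n).
Proof.
move=> uC uv n; apply: le_eps => e /uv[m0] /(_ (n + m0)%N (leq_addl _ _)) h.
have := rnormD (v - u (n + m0)%N) (u (n + m0)%N - u n).
by rewrite addrA subrK => /le_trans; apply; have := geometric_tail uC n m0; lra.
Qed.

Lemma geometric_cvg (X : completeNormedModType R[i]) (u : nat -> X) (C : R) :
  (forall n, rnorm (u n.+1 - u n) <= C * 3^-1 ^+ n) ->
  exists v, forall n, rnorm (v - u n) <= C * (3 / 2 * 3^-1 ^+ n).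
Proof.
move=> uC; have C0 : 0 <= C.
  by have := uC 0%N; rewrite expr0 mulr1; apply: le_trans; exact: rnorm_ge0.
have : cvg (u @ \oo).
  apply: cauchy_cvg; apply: cauchy_exP => e e0.
  have [r r0 er] : exists2 r : R, 0 < r & e = r%:C%C.
    by exists (complex.Re e); move: e0; rewrite ltcE/= => /andP[/eqP ie re] //;
      apply: complex_eq.
  have [N hN] := @expr3V_lt (r / (C + 1) / 2) ltac:(by rewrite !divr_gt0//; lra).
  exists (u N); exists N => // n /= Nn.
  rewrite -ball_normE/= er -opprB normrN norm_rnorm ltcR -(subnKC Nn).
  apply: le_lt_trans (geometric_tail uC _ _) _.
  move: hN; rewrite ltr_pdivlMr// ltr_pdivlMr; last by lra.
  have : 0 < 3^-1 ^+ N :> R by rewrite exprn_gt0//; lra.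
  nra.
move=> /cvg_ex[v uv]; exists v; apply: geometric_limit => // e e0.
have e0' : 0 < e%:C%C :> R[i] by rewrite ltcR.
have /cvgrPdist_lt/(_ _ e0')[N _ h] := uv; exists N => m /h.
by rewrite norm_rnorm ltcR => /ltW.
Qed.

Lemma rnorm_cabs (z : R[i]) : rnorm (z : R[i]^o) = cabs z.
Proof. by []. Qed.

Lemma real_geometric_cvg (u : nat -> R) (C : R) :
  (forall n, `|u n.+1 - u n| <= C * 3^-1 ^+ n) ->
  exists v, forall n, `|v - u n| <= C * (3 / 2 * 3^-1 ^+ n).
Proof.
move=> uC; have C0 : 0 <= C.
  by have := uC 0%N; rewrite expr0 mulr1; apply: le_trans; exact: normr_ge0.
have tail n k : `|u (n + k)%N - u n| <= C * (3 / 2 * 3^-1 ^+ n).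
  have := @geometric_tail R[i]^o (fun n => (u n)%:C%C) C.
  move=> /(_ _ n k); rewrite rnorm_cabs -rmorphB/= cabs_real; apply => m.
  by rewrite rnorm_cabs -rmorphB/= cabs_real.
have : cvg (u @ \oo).
  apply: cauchy_cvg; apply: cauchy_exP => r r0.
  have [N hN] := @expr3V_lt (r / (C + 1) / 2) ltac:(by rewrite !divr_gt0//; lra).
  exists (u N); exists N => // n /= Nn.
  rewrite -ball_normE/= distrC -(subnKC Nn).
  apply: le_lt_trans (tail _ _) _.
  move: hN; rewrite ltr_pdivlMr// ltr_pdivlMr; last by lra.
  have : 0 < 3^-1 ^+ N :> R by rewrite exprn_gt0//; lra.
  nra.
move=> /cvg_ex[v uv]; exists v => n; apply: le_eps => e e0.
have /cvgrPdist_lt/(_ _ e0)[N _ h] := uv.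
have := ltW (h (n + N)%N (leq_addl _ _)); have := tail n N.
have := ler_distD (u (n + N)%N) v (u n); lra.
Qed.

(** The limit is built coordinatewise; its convergence is then fed to [geometric_limit], which
    restores the constant [C] that the splitting into coordinates would double. *)
Lemma complex_geometric_cvg (u : nat -> R[i]) (C : R) :
  (forall n, cabs (u n.+1 - u n) <= C * 3^-1 ^+ n) ->
  exists v, forall n, cabs (v - u n) <= C * (3 / 2 * 3^-1 ^+ n).
Proof.
move=> uC; have C0 : 0 <= C.
  by have := uC 0%N; rewrite expr0 mulr1; apply: le_trans; exact: cabs_ge0.
have [a ha] : exists v, forall n, `|v - complex.Re (u n)| <= C * (3 / 2 * 3^-1 ^+ n).
  apply: real_geometric_cvg => n; apply: le_trans (uC n).
  by apply: le_trans (cabs_Re _); rewrite ReD ReN.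
have [b hb] : exists v, forall n, `|v - complex.Im (u n)| <= C * (3 / 2 * 3^-1 ^+ n).
  apply: real_geometric_cvg => n; apply: le_trans (uC n).
  by apply: le_trans (cabs_Im _); rewrite ImD ImN.
exists (a +i* b)%C; apply: (@geometric_limit R[i]^o) => // e e0.
have [N hN] := @expr3V_lt (e / (C + 1) / 3) ltac:(by rewrite !divr_gt0//; lra).
exists N => m Nm; rewrite rnorm_cabs; apply: le_trans (cabs_le_ReIm _) _.
rewrite ReD ReN ImD ImN /=; have := ha m; have := hb m.
have h : 3^-1 ^+ m <= 3^-1 ^+ N :> R by apply: ler_wiXn2l => //; lra.
move: hN; rewrite ltr_pdivlMr// ltr_pdivlMr; last by lra.
have : 0 < 3^-1 ^+ m :> R by rewrite exprn_gt0//; lra.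
nra.
Qed.

End completeness.

(** * Uniform boundedness on a Banach space and on its dual *)

Section uniform_boundedness_spaces.
Variables (R : realType) (X : completeNormedModType R[i]).

(** The clause [0 <= c] is explicit because the norm estimate would not force it on the zero space,
    while an abstract norm bound must be nonnegative. *)
Definition dual_bound (phi : X -> R[i]) (c : R) : Prop :=
  [/\ 0 <= c, forall (a : R[i]) (x y : X), phi (a *: x + y) = a * phi x + phi y &
      forall x, cabs (phi x) <= c * rnorm x].

Lemma dual_elt_bound phi : dual_elt phi -> exists2 c, 0 <= c & dual_bound phi c.
Proof.
move=> [lin [c cP]]; exists `|c| => //; split => // x; apply: le_trans (cP x) _.
by rewrite ler_wpM2r ?rnorm_ge0// ler_norm.
Qed.

Lemma dual_bound_elt phi c : dual_bound phi c -> dual_elt phi.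
Proof. by move=> [_ lin b]; split => //; exists c. Qed.

Lemma uniform_boundedness_space (I : Type) (p : I -> X -> R) :
  (forall i x y, p i (x + y) <= p i x + p i y) ->
  (forall i x, p i (- x) = p i x) ->
  (forall i (r : R) x, 0 <= r -> p i (r%:C%C *: x) = r * p i x) ->
  (forall i, exists K, forall x, p i x <= K * rnorm x) ->
  (forall x, exists C, forall i, p i x <= C) ->
  exists2 K, 0 <= K & forall i x, p i x <= K * rnorm x.
Proof.
move=> pD pN pZ pb pw.
have [||||||||||||K h] := @uniform_boundedness R X (fun x c => rnorm x <= c) _ _ _ _ _ _ _ I p.
- by rewrite rnorm0.
- by move=> v c d; exact: le_trans.
- by move=> v c; apply: le_trans; exact: rnorm_ge0.
- by move=> v w c d vc wd; apply: le_trans (rnormD _ _) _; exact: lerD.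
- by move=> v c; rewrite rnormN.
- by move=> r v c r0 vc; rewrite rnormZ cabs_real ger0_norm// ler_wpM2l.
- move=> u _ uS; have [|v hv] := @geometric_cvg R X u 1; first by move=> n; rewrite mul1r; exact: uS.
  by exists v => n; have := hv n; rewrite mul1r.
- by move=> i v w c d _ _; exact: pD.
- by move=> i v c _; exact: pN.
- by move=> i r v c r0 _; exact: pZ.
- move=> i; have [K hK] := pb i; exists `|K| => v c vc; apply: le_trans (hK v) _.
  apply: (@le_trans _ _ (`|K| * rnorm v)); last by rewrite ler_wpM2l.
  by rewrite ler_wpM2r ?rnorm_ge0// ler_norm.
- by move=> v c _; exact: pw.
exists `|K| => // i x; apply: le_trans (h i x _ (lexx _)) _.
by rewrite ler_wpM2r ?rnorm_ge0// ler_norm.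
Qed.

(** The increments at [x] are geometric with constant [|x|], so pointwise limits exist with a tail
    linear in [|x|], which is a tail in the dual norm. Linearity passes to the limit from the
    [u n]. *)
Lemma dual_complete (u : nat -> X -> R[i]) : dual_bound (u 0%N) 0 ->
  (forall n, dual_bound (u n.+1 - u n) (3^-1 ^+ n)) ->
  exists v, forall n, dual_bound (v - u n) (3 / 2 * 3^-1 ^+ n).
Proof.
move=> u0 uS.
have lin n : forall (a : R[i]) (x y : X), u n (a *: x + y) = a * u n x + u n y.
  elim: n => [|n ih]; first by have [] := u0.
  move=> a x y; have [_ l _] := uS n; have := l a x y.
  rewrite [in X in X -> _]fctE/= => e.
  have {e} := e; rewrite !fctE => e.
  by apply: (addIr (- u n (a *: x + y))); rewrite e ih; ring.
have /choice[v vP] : forall x, exists l, forall n,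
    cabs (l - u n x) <= rnorm x * (3 / 2 * 3^-1 ^+ n).
  move=> x; apply: complex_geometric_cvg => n.
  by have [_ _ /(_ x)] := uS n; rewrite mulrC.
have vlin (a : R[i]) x y : v (a *: x + y) = a * v x + v y.
  apply/eqP; rewrite -subr_eq0; apply/eqP/cabs0_eq0/le_eps => e e0.
  rewrite add0r; set K := rnorm (a *: x + y) + cabs a * rnorm x + rnorm y.
  have K0 : 0 <= K by rewrite !addr_ge0 ?mulr_ge0 ?rnorm_ge0 ?cabs_ge0.
  have [n hn] := @expr3V_lt R (e / (K + 1) / 2) ltac:(by rewrite !divr_gt0//; lra).
  have -> : v (a *: x + y) - (a * v x + v y) = (v (a *: x + y) - u n (a *: x + y))
      - (a * (v x - u n x) + (v y - u n y)) by rewrite lin; ring.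
  apply: le_trans (cabsD _ _) _; rewrite cabsN.
  have := cabsD (a * (v x - u n x)) (v y - u n y); rewrite cabsM.
  have := vP (a *: x + y) n; have := vP y n.
  have := ler_wpM2l (cabs_ge0 a) (vP x n).
  move: hn; rewrite ltr_pdivlMr// ltr_pdivlMr; last by lra.
  have : 0 < 3^-1 ^+ n :> R by rewrite exprn_gt0//; lra.
  rewrite /K in K0 *; nra.
exists v => n; split.
- by rewrite mulr_ge0 ?exprn_ge0//; lra.
- by move=> a x y; rewrite !fctE vlin lin; ring.
- by move=> x; rewrite fctE mulrC; exact: vP.
Qed.

Lemma uniform_boundedness_dual (I : Type) (p : I -> (X -> R[i]) -> R) :
  (forall i f g, dual_elt f -> dual_elt g -> p i (f + g) <= p i f + p i g) ->
  (forall i f, dual_elt f -> p i (- f) = p i f) ->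
  (forall i (r : R) f, 0 <= r -> dual_elt f -> p i (r%:C%C *: f) = r * p i f) ->
  (forall i, exists K, forall f c, dual_bound f c -> p i f <= K * c) ->
  (forall f, dual_elt f -> exists C, forall i, p i f <= C) ->
  exists2 K, 0 <= K & forall i f c, dual_bound f c -> p i f <= K * c.
Proof.
move=> pD pN pZ pb pw.
have [||||||||||||K h] := @uniform_boundedness R (X -> R[i]) dual_bound _ _ _ _ _ _ _ I p.
- by split => // *; rewrite ?fctE ?mulr0 ?addr0// cabs0 mul0r.
- move=> v c d [c0 l b] cd; split => //; first exact: le_trans cd.
  by move=> x; apply: le_trans (b x) _; rewrite ler_wpM2r ?rnorm_ge0.
- by move=> v c [].
- move=> v w c d [c0 l b] [d0 l' b']; split; first exact: addr_ge0.
    by move=> *; rewrite !fctE l l'; ring.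
  move=> x; apply: le_trans (cabsD _ _) _; rewrite mulrDl; exact: lerD.
- move=> v c [c0 l b]; split => // *; first by rewrite !fctE l; ring.
  by rewrite fctE cabsN.
- move=> r v c r0 [c0 l b]; split; first exact: mulr_ge0.
    by move=> a x y; rewrite !fctE l /GRing.scale/=; ring.
  move=> x; rewrite fctE /GRing.scale/= cabsM cabs_real ger0_norm// -mulrA.
  by rewrite ler_wpM2l.
- exact: dual_complete.
- by move=> i v w c d /dual_bound_elt ? /dual_bound_elt ?; exact: pD.
- by move=> i v c /dual_bound_elt; exact: pN.
- by move=> i r v c r0 /dual_bound_elt; exact: pZ.
- by move=> i; exact: pb.
- by move=> v c /dual_bound_elt; exact: pw.
exists `|K| => // i f c fc; apply: le_trans (h i f _ fc) _.
by have [c0 _ _] := fc; rewrite ler_wpM2r// ler_norm.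
Qed.

End uniform_boundedness_spaces.

(** * Estimates of integrals by domination alone *)

Section lower_integral.
Context d (T : measurableType d) (R : realType).
Variable mu : {measure set T -> \bar R}.
Local Open Scope ereal_scope.

(* The integral of a nonnegative function is a supremum over simple functions,
   so monotonicity needs no measurability. *)
Lemma ge0_le_lower_integral (D : set T) (f g : T -> \bar R) :
  (forall x, D x -> 0 <= f x) -> (forall x, D x -> f x <= g x) ->
  \int[mu]_(x in D) f x <= \int[mu]_(x in D) g x.
Proof.
move=> f0 fg.
have g0 x : D x -> 0 <= g x by move=> Dx; exact: le_trans (f0 _ Dx) (fg _ Dx).
rewrite !ge0_integralE//; apply: le_ereal_sup => _ [h hf <-].
exists h => // x; apply: le_trans (hf x) _.
rewrite /patch; case: ifPn => // /set_mem; exact: fg.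
Qed.

(** The positive and negative parts both have integral between 0 and [C], so the difference lies in
    [[-C, C]]. *)
Lemma fine_integral_le (D : set T) (g : T -> R) (h : T -> \bar R) (C : R) :
  (forall x, D x -> `|g x|%:E <= h x) -> \int[mu]_(x in D) h x <= C%:E ->
  (`|fine (\int[mu]_(x in D) (g x)%:E)| <= C)%R.
Proof.
move=> gh hC.
have P : \int[mu]_(x in D) ((EFin \o g)^\+ x) <= C%:E.
  apply: le_trans hC; apply: ge0_le_lower_integral => x Dx //.
  apply: le_trans (gh _ Dx); rewrite funeposE ge_max !lee_fin normr_ge0 andbT.
  exact: ler_norm.
have N : \int[mu]_(x in D) ((EFin \o g)^\- x) <= C%:E.
  apply: le_trans hC; apply: ge0_le_lower_integral => x Dx //.
  apply: le_trans (gh _ Dx); rewrite funenegE ge_max !lee_fin normr_ge0 andbT.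
  by rewrite -normrN ler_norm.
rewrite [X in fine X]integralE.
have P0 : 0 <= \int[mu]_(x in D) ((EFin \o g)^\+ x) by apply: integral_ge0.
have N0 : 0 <= \int[mu]_(x in D) ((EFin \o g)^\- x) by apply: integral_ge0.
have key (p n : \bar R) : 0 <= p -> 0 <= n -> p <= C%:E -> n <= C%:E ->
    (`|fine (p - n)| <= C)%R.
  move: p n => [p| |] [n| |]//; rewrite ?lee_fin => *.
  by rewrite -EFinB /= ler_norml; apply/andP; split; lra.
exact: key.
Qed.

End lower_integral.

(** * Affine changes of variable for Lebesgue measure *)

Section affine_substitution.
Variable R : realType.
Local Notation pushforward_measure :=
  measure_function_pushforward__canonical__measure_function_Measure.
Local Notation mu := (@lebesgue_measure R).
Local Open Scope ereal_scope.

Lemma measurable_affine (u v : R) :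
  measurable_fun [set: measurableTypeR R]
    (fun x : measurableTypeR R => (u * x + v)%R : measurableTypeR R).
Proof. by apply: (@measurable_funD _ _ R) => //; exact: measurable_funM. Qed.

(** The right-hand side is a measure in [A] that agrees with Lebesgue measure on half-open
    intervals, so uniqueness of the latter applies. *)
Lemma lebesgue_measure_affine (u v : R) (u0 : (0 < u)%R) (A : set R) :
  measurable A ->
  mu A = u%:E * mu ((fun x : R => u * x + v)%R @^-1` A).
Proof.
move=> mA.
pose f := (fun x : measurableTypeR R => (u * x + v)%R : measurableTypeR R).
pose m := mscale (NngNum (ltW u0)) (pushforward_measure mu (measurable_affine u v)).
rewrite (@lebesgue_measure_unique R m _ A mA)// => _ [[a b] _ <-].
transitivity (u%:E * mu (f @^-1` `]a, b]%classic)); last by [].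
have -> : f @^-1` `]a, b]%classic = `](a - v) / u, (b - v) / u]%classic%R.
  apply/seteqP; split=> x; rewrite /= !in_itv/= /f => /andP[ax xb]; apply/andP; split.
  - by rewrite ltr_pdivrMr//; lra.
  - by rewrite ler_pdivlMr//; lra.
  - by move: ax; rewrite ltr_pdivrMr//; lra.
  - by move: xb; rewrite ler_pdivlMr//; lra.
rewrite !lebesgue_measure_itv/= !lte_fin ltr_pM2r ?invr_gt0// ltrD2r.
case: ifPn => _; last by rewrite mule0.
by rewrite -!EFinB -EFinM; congr EFin; field; lra.
Qed.

Lemma ge0_integral_affine (u v : R) (f : R -> \bar R) : (0 < u)%R ->
  measurable_fun setT f -> (forall x, 0 <= f x) ->
  \int[mu]_x f x = u%:E * \int[mu]_x f (u * x + v)%R.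
Proof.
move=> u0 mf f0.
pose F := (fun x : measurableTypeR R => (u * x + v)%R : measurableTypeR R).
have mF : measurable_fun setT F := measurable_affine u v.
have := @ge0_integral_pushforward _ _ _ _ R F mF mu setT f measurableT mf (fun y _ => f0 y).
rewrite preimage_setT [X in _ = X -> _]/= => <-.
rewrite -(@ge0_integral_mscale _ _ _ (pushforward_measure mu mF) _ measurableT (NngNum (ltW u0)))//.
by apply: eq_measure_integral => A mA _; exact: lebesgue_measure_affine.
Qed.

Lemma integral_translate (v : R) (f : R -> \bar R) : measurable_fun setT f ->
  \int[mu]_x f (x + v)%R = \int[mu]_x f x.
Proof.
move=> mf; rewrite integralE [RHS]integralE; congr (_ - _).
- rewrite [RHS](@ge0_integral_affine 1 v)//; last exact: measurable_funepos.
  by rewrite mul1e; apply: eq_integral => x _; rewrite mul1r !funeposE.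
- rewrite [RHS](@ge0_integral_affine 1 v)//; last exact: measurable_funeneg.
  by rewrite mul1e; apply: eq_integral => x _; rewrite mul1r !funenegE.
Qed.

Lemma ge0_integral_opp (f : R -> \bar R) : measurable_fun setT f ->
  (forall x, 0 <= f x) -> \int[mu]_x f (- x)%R = \int[mu]_x f x.
Proof.
move=> mf f0.
pose F := (-%R : measurableTypeR R -> measurableTypeR R).
have mF : measurable_fun setT F by exact: (@oppr_measurable R).
have := @ge0_integral_pushforward _ _ _ _ R F mF mu setT f measurableT mf (fun y _ => f0 y).
rewrite preimage_setT [X in _ = X -> _]/= => <-.
by apply: eq_measure_integral => A mA _; exact: lebesgue_measureN.
Qed.

Lemma integral_opp (f : R -> \bar R) : measurable_fun setT f ->
  \int[mu]_x f (- x)%R = \int[mu]_x f x.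
Proof.
move=> mf; rewrite integralE [RHS]integralE; congr (_ - _).
- rewrite -[RHS]ge0_integral_opp//; last exact: measurable_funepos.
  by apply: eq_integral => x _; rewrite !funeposE.
- rewrite -[RHS]ge0_integral_opp//; last exact: measurable_funeneg.
  by apply: eq_integral => x _; rewrite !funenegE.
Qed.

End affine_substitution.

(** * Measurability and integration of complex functions on the line *)

Section complex_integral.
Variable R : realType.
Local Notation mu := (@lebesgue_measure R).
Implicit Types g h : R -> R[i].

Definition cmeasurable g :=
  measurable_fun setT (fun b => complex.Re (g b)) /\
  measurable_fun setT (fun b => complex.Im (g b)).

Definition cintegrable (S : set R) g :=
  mu.-integrable S (fun b => (complex.Re (g b))%:E) /\
  mu.-integrable S (fun b => (complex.Im (g b))%:E).

Lemma cmeasurable_cst (z : R[i]) : cmeasurable (fun=> z).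
Proof. by split; exact: measurable_cst. Qed.

Lemma cmeasurableD g h : cmeasurable g -> cmeasurable h ->
  cmeasurable (fun b => g b + h b).
Proof.
by move=> [? ?] [? ?]; split; rewrite [X in measurable_fun _ X](eq_fun (fun b => ReD (g b) (h b)))
  || rewrite [X in measurable_fun _ X](eq_fun (fun b => ImD (g b) (h b)));
  exact: measurable_funD.
Qed.

Lemma cmeasurableM g h : cmeasurable g -> cmeasurable h ->
  cmeasurable (fun b => g b * h b).
Proof.
move=> [? ?] [? ?]; split.
- rewrite [X in measurable_fun _ X](eq_fun (fun b => ReM (g b) (h b))).
  by apply: measurable_funB; exact: measurable_funM.
- rewrite [X in measurable_fun _ X](eq_fun (fun b => ImM (g b) (h b))).
  by apply: measurable_funD; exact: measurable_funM.
Qed.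

Lemma cmeasurableN g : cmeasurable g -> cmeasurable (fun b => - g b).
Proof.
move=> mg; rewrite (_ : (fun b => - g b) = (fun b => -1 * g b)).
  exact: cmeasurableM (cmeasurable_cst _) mg.
by apply/funext => b; rewrite mulN1r.
Qed.

Lemma cmeasurableB g h : cmeasurable g -> cmeasurable h ->
  cmeasurable (fun b => g b - h b).
Proof. by move=> mg mh; exact: cmeasurableD mg (cmeasurableN mh). Qed.

Lemma cmeasurable_comp g (f : R -> R) : cmeasurable g -> measurable_fun setT f ->
  cmeasurable (fun b => g (f b)).
Proof. by move=> [mr mi] mf; split; [exact: (measurableT_comp mr mf)|exact: (measurableT_comp mi mf)]. Qed.

Lemma measurable_cabs g : cmeasurable g -> measurable_fun setT (fun b => cabs (g b)).
Proof.
move=> [mr mi]; rewrite [X in measurable_fun _ X](eq_fun (fun b => cabsE (g b))).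
have ms := continuous_measurable_fun (@sqrt_continuous R).
apply: (measurableT_comp ms).
by apply: measurable_funD; exact: measurable_funX.
Qed.

Definition ccontinuous g := forall b0 e, 0 < e -> exists2 d, 0 < d &
  forall b, `|b - b0| < d -> cabs (g b - g b0) < e.

Lemma ccontinuous_Re_Im g : ccontinuous g ->
  continuous (fun b => complex.Re (g b)) /\ continuous (fun b => complex.Im (g b)).
Proof.
move=> gc; split => b0; apply/cvgrPdist_lt => e e0.
- have [d d0 h] := gc b0 e e0; near=> b.
  rewrite distrC; apply: le_lt_trans (h b _).
    by rewrite -ReN -ReD; exact: cabs_Re.
  by near: b; apply: cvgr_distC_lt => //; exact: cvg_id.
- have [d d0 h] := gc b0 e e0; near=> b.
  rewrite distrC; apply: le_lt_trans (h b _).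
    by rewrite -ImN -ImD; exact: cabs_Im.
  by near: b; apply: cvgr_distC_lt => //; exact: cvg_id.
Unshelve. all: by end_near. Qed.

Lemma ccontinuous_cmeasurable g : ccontinuous g -> cmeasurable g.
Proof. by move=> /ccontinuous_Re_Im[? ?]; split; exact: continuous_measurable_fun. Qed.

(** The factor 2 comes from bounding real and imaginary parts separately. Only a dominating [h] is
    asked for, so the estimate applies to the outer integrand of [Bcalc_rep], whose measurability is
    not established. *)
Lemma Cint_le (S : set R) g (h : R -> \bar R) (C : R) :
  (forall b, S b -> ((cabs (g b))%:E <= h b)%E) ->
  (\int[mu]_(b in S) h b <= C%:E)%E -> cabs (Cint S g) <= 2 * C.
Proof.
move=> gh hC; rewrite /Cint; apply: le_trans (cabsD _ _) _.
rewrite cabsM cabs_i mul1r !cabs_real mulr_natl mulr2n; apply: lerD.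
- apply: fine_integral_le hC => b Sb; apply: le_trans (gh b Sb).
  by rewrite lee_fin cabs_Re.
- apply: fine_integral_le hC => b Sb; apply: le_trans (gh b Sb).
  by rewrite lee_fin cabs_Im.
Qed.

Lemma eq_Cint (S : set R) g h : (forall b, S b -> g b = h b) -> Cint S g = Cint S h.
Proof.
move=> gh; rewrite /Cint /Defs.Rint.
by congr ((_)%:C%C + _ * (_)%:C%C); apply: eq_Rintegral => b /set_mem Sb; rewrite gh.
Qed.

Lemma CintE (S : set R) g : Cint S g =
  (Defs.Rint S (fun b => complex.Re (g b)) +i* Defs.Rint S (fun b => complex.Im (g b)))%C.
Proof. by rewrite /Cint; apply: complex_eq => /=; ring. Qed.

Section linearity.
Variable (S : set R).
Hypothesis mS : measurable S.

Lemma CintD g h : cintegrable S g -> cintegrable S h ->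
  Cint S (fun b => g b + h b) = Cint S g + Cint S h.
Proof.
move=> [? ?] [? ?]; rewrite !CintE; apply: complex_eq => /=.
- rewrite -RintegralD//; apply: eq_Rintegral => b _; exact: ReD.
- rewrite -RintegralD//; apply: eq_Rintegral => b _; exact: ImD.
Qed.

Lemma cintegrableM g (z : R[i]) : cintegrable S g -> cintegrable S (fun b => z * g b).
Proof.
move=> [gr gi]; split.
- rewrite (_ : (fun _ => _) = (fun b => (complex.Re z)%:E * (complex.Re (g b))%:E -
    (complex.Im z)%:E * (complex.Im (g b))%:E)%E); last by apply/funext => b; rewrite ReM.
  by apply: integrableB => //; exact: integrableZl.
- rewrite (_ : (fun _ => _) = (fun b => (complex.Re z)%:E * (complex.Im (g b))%:E +
    (complex.Im z)%:E * (complex.Re (g b))%:E)%E); last by apply/funext => b; rewrite ImM.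
  by apply: integrableD => //; exact: integrableZl.
Qed.

Lemma integrable_scale (f : R -> R) (c : R) :
  mu.-integrable S (fun b => (f b)%:E) -> mu.-integrable S (fun b => (c * f b)%:E).
Proof.
move=> fi; rewrite (_ : (fun _ => _) = (fun b => c%:E * (f b)%:E)%E).
  exact: integrableZl.
by apply/funext => b; rewrite EFinM.
Qed.

Lemma CintM g (z : R[i]) : cintegrable S g -> Cint S (fun b => z * g b) = z * Cint S g.
Proof.
move=> [gr gi]; rewrite !CintE; apply: complex_eq => /=.
- rewrite ReM/= -!RintegralZl// -RintegralB//.
  + by apply: eq_Rintegral => b _; exact: ReM.
  + exact: (integrable_scale _ gr).
  + exact: (integrable_scale _ gi).
- rewrite ImM/= -!RintegralZl// -RintegralD//.
  + by apply: eq_Rintegral => b _; exact: ImM.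
  + exact: (integrable_scale _ gi).
  + exact: (integrable_scale _ gr).
Qed.

Lemma cintegrableD g h : cintegrable S g -> cintegrable S h ->
  cintegrable S (fun b => g b + h b).
Proof.
move=> [? ?] [? ?]; split.
- rewrite (_ : (fun _ => _) = (fun b => (complex.Re (g b))%:E + (complex.Re (h b))%:E)%E);
    last by apply/funext => b; rewrite ReD.
  exact: integrableD.
- rewrite (_ : (fun _ => _) = (fun b => (complex.Im (g b))%:E + (complex.Im (h b))%:E)%E);
    last by apply/funext => b; rewrite ImD.
  exact: integrableD.
Qed.

Lemma cintegrableN g : cintegrable S g -> cintegrable S (fun b => - g b).
Proof.
move=> ig; rewrite (_ : (fun b => - g b) = (fun b => -1 * g b)).
  exact: cintegrableM.
by apply/funext => b; rewrite mulN1r.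
Qed.

Lemma cintegrableB g h : cintegrable S g -> cintegrable S h ->
  cintegrable S (fun b => g b - h b).
Proof. by move=> ig ih; exact: cintegrableD ig (cintegrableN ih). Qed.

Lemma CintB g h : cintegrable S g -> cintegrable S h ->
  Cint S (fun b => g b - h b) = Cint S g - Cint S h.
Proof.
move=> ig ih; rewrite (CintD ig (cintegrableN ih)); congr (_ + _).
have := CintM (-1) ih; rewrite mulN1r => <-.
by apply: eq_Cint => b _; rewrite mulN1r.
Qed.

End linearity.

Lemma CintDT g h : cintegrable setT g -> cintegrable setT h ->
  Cint setT (fun b => g b + h b) = Cint setT g + Cint setT h.
Proof. exact: CintD. Qed.

Lemma CintBT g h : cintegrable setT g -> cintegrable setT h ->
  Cint setT (fun b => g b - h b) = Cint setT g - Cint setT h.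
Proof. exact: CintB. Qed.

Lemma CintMT g (z : R[i]) : cintegrable setT g ->
  Cint setT (fun b => z * g b) = z * Cint setT g.
Proof. exact: CintM. Qed.

Lemma cintegrableDT g h : cintegrable setT g -> cintegrable setT h ->
  cintegrable setT (fun b => g b + h b).
Proof. exact: cintegrableD. Qed.

Lemma cintegrableBT g h : cintegrable setT g -> cintegrable setT h ->
  cintegrable setT (fun b => g b - h b).
Proof. exact: cintegrableB. Qed.

Lemma cintegrableMT g (z : R[i]) : cintegrable setT g -> cintegrable setT (fun b => z * g b).
Proof. exact: cintegrableM. Qed.

Lemma Cint0 (S : set R) : Cint S (fun=> 0) = 0.
Proof. by rewrite CintE; apply: complex_eq; rewrite /= /Defs.Rint /Rintegral integral0. Qed.

Lemma cintegrable_cabs (g : R -> R[i]) (C : R) : cmeasurable g ->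
  (\int[mu]_b (cabs (g b))%:E <= C%:E)%E -> cintegrable setT g.
Proof.
move=> [mr mi] gC; have fin := le_lt_trans gC (ltry C).
split; apply/integrableP; split; try exact/measurable_EFinP;
  apply: le_lt_trans fin; apply: ge0_le_lower_integral => b _ //; rewrite lee_fin.
- exact: cabs_Re.
- exact: cabs_Im.
Qed.

Lemma cmeasurableX (g : R -> R[i]) k : cmeasurable g -> cmeasurable (fun b => g b ^+ k).
Proof.
move=> mg; elim: k => [|k ih].
  by rewrite (_ : (fun b => _) = (fun=> 1)); [exact: cmeasurable_cst|apply/funext => b].
rewrite (_ : (fun b => _) = (fun b => g b * g b ^+ k)); first exact: cmeasurableM.
by apply/funext => b; rewrite exprS.
Qed.

Lemma Cint_translate g (v : R) : cmeasurable g ->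
  Cint setT (fun b => g (b + v)) = Cint setT g.
Proof.
move=> [mr mi]; rewrite !CintE /Defs.Rint /Rintegral; congr (fine _ +i* fine _)%C.
- by rewrite (@integral_translate R v (fun b => (complex.Re (g b))%:E))//; exact/measurable_EFinP.
- by rewrite (@integral_translate R v (fun b => (complex.Im (g b))%:E))//; exact/measurable_EFinP.
Qed.

Lemma Cint_opp g : cmeasurable g -> Cint setT (fun b => g (- b)) = Cint setT g.
Proof.
move=> [mr mi]; rewrite !CintE /Defs.Rint /Rintegral; congr (fine _ +i* fine _)%C.
- by rewrite (@integral_opp R (fun b => (complex.Re (g b))%:E))//; exact/measurable_EFinP.
- by rewrite (@integral_opp R (fun b => (complex.Im (g b))%:E))//; exact/measurable_EFinP.
Qed.

Lemma integral_oneDsqrV : (\int[mu]_b ((oneDsqr b)^-1)%:E = (pi : R)%:E)%E.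
Proof.
rewrite (@ge0_symfun_integralT R (fun b => (oneDsqr b)^-1)).
- rewrite -set_itvcy integral0y_oneDsqr -EFinM; congr EFin; by field.
- by move=> b; rewrite invr_ge0 (le_trans ler01)// oneDsqr_ge1.
- exact: continuous_oneDsqrV.
- by move=> b /=; rewrite /oneDsqr sqrrN.
Qed.

Lemma measurable_oneDsqrV : measurable_fun [set: R] (fun b : R => (oneDsqr b)^-1).
Proof. by apply: continuous_measurable_fun; exact: continuous_oneDsqrV. Qed.

Lemma integralZ_oneDsqrV (C : R) : 0 <= C ->
  (\int[mu]_b (C * (oneDsqr b)^-1)%:E = (C * pi)%:E)%E.
Proof.
move=> C0; under eq_integral do rewrite EFinM.
have mw : measurable_fun [set: R] (fun b : R => ((oneDsqr b)^-1)%:E).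
  by apply/measurable_EFinP; exact: measurable_oneDsqrV.
rewrite ge0_integralZl_EFin//.
by rewrite integral_oneDsqrV EFinM.
Qed.

End complex_integral.

(** * The resolvent, and uniformity of the integral hypothesis *)

Section resolvent.
Variables (R : realType) (X : completeNormedModType R[i]).
Variables (D : set X) (A : X -> X) (Res : R[i] -> X -> X).
Hypothesis resA : resolvent_right D A Res.
Implicit Types (z w : R[i]) (x y : X).

Lemma res_linear z (a : R[i]) x y : 0 < complex.Re z ->
  Res z (a *: x + y) = a *: Res z x + Res z y.
Proof. by move=> /resA[[+ _] _]; apply. Qed.

Lemma res0 z : 0 < complex.Re z -> Res z 0 = 0.
Proof.
move=> z0; have := res_linear 1 0 0 z0; rewrite !scale1r addr0 => /eqP.
by rewrite -subr_eq0 opprD addrA subrr sub0r oppr_eq0 => /eqP.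
Qed.

Lemma resD z x y : 0 < complex.Re z -> Res z (x + y) = Res z x + Res z y.
Proof. by move=> z0; rewrite -{1}(scale1r x) res_linear// scale1r. Qed.

Lemma resZ z (a : R[i]) x : 0 < complex.Re z -> Res z (a *: x) = a *: Res z x.
Proof. by move=> z0; rewrite -{1}(addr0 (a *: x)) res_linear// res0// addr0. Qed.

Lemma resN z x : 0 < complex.Re z -> Res z (- x) = - Res z x.
Proof. by move=> z0; rewrite -scaleN1r resZ// scaleN1r. Qed.

Lemma resB z x y : 0 < complex.Re z -> Res z (x - y) = Res z x - Res z y.
Proof. by move=> z0; rewrite resD// resN. Qed.

Lemma res_bound z : 0 < complex.Re z ->
  exists2 c, 0 < c & forall x, rnorm (Res z x) <= c * rnorm x.
Proof.
move=> /resA[[_ [c cP]] _]; exists (`|c| + 1); first by rewrite ltr_wpDl.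
move=> x; apply: le_trans (cP x) _; rewrite ler_wpM2r ?rnorm_ge0//.
by rewrite (le_trans (ler_norm c))// lerDl.
Qed.

Lemma res_identity z w x : 0 < complex.Re z -> 0 < complex.Re w ->
  Res z x - Res w x = (w - z) *: Res z (Res w x).
Proof.
move=> z0 w0; have [_ [surjw _]] := resA w0; have [_ [_ injz]] := resA z0.
have [Dy ey] := surjw x; have := injz _ Dy.
have -> : z *: Res w x + A (Res w x) = x + (z - w) *: Res w x.
  have -> : A (Res w x) = x - w *: Res w x.
    by apply/eqP; rewrite eq_sym subr_eq addrC ey.
  by rewrite scalerBl addrCA.
rewrite resD// resZ// => e; rewrite -[X in _ - X]e opprD addrA subrr sub0r.
by rewrite -scaleNr opprB.
Qed.

Lemma res_comm z w x : 0 < complex.Re z -> 0 < complex.Re w ->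
  Res z (Res w x) = Res w (Res z x).
Proof.
move=> z0 w0; have [->//|zw] := eqVneq z w.
have e1 := res_identity x z0 w0; have e2 := res_identity x w0 z0.
apply: (scalerI (a := w - z)); first by rewrite subr_eq0 eq_sym.
by rewrite -e1 -opprB e2 -scaleNr opprB.
Qed.

(* Neumann series argument *)
Lemma res_local z0 (c : R) z x : 0 < complex.Re z0 -> 0 < complex.Re z ->
  (forall x, rnorm (Res z0 x) <= c * rnorm x) -> cabs (z - z0) * c <= 2^-1 ->
  rnorm (Res z x) <= 2 * c * rnorm x.
Proof.
move=> h0 hz hc small.
have -> : Res z x = Res z0 x + (z0 - z) *: Res z0 (Res z x).
  by rewrite -[in RHS]res_comm// -res_identity// addrC subrK.
have := rnormD (Res z0 x) ((z0 - z) *: Res z0 (Res z x)).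
rewrite -(res_comm x hz h0) -res_identity// (addrC (Res z0 x)) subrK => h.
have h1 : rnorm (Res z x - Res z0 x) <= 2^-1 * rnorm (Res z x).
  rewrite res_identity// res_comm// rnormZ cabsB.
  have := ler_wpM2l (cabs_ge0 (z - z0)) (hc (Res z x)); rewrite mulrA.
  have := ler_wpM2r (rnorm_ge0 (Res z x)) small; lra.
by have := hc x; lra.
Qed.

(** With [u], [v] the previous iterates, [R(z)u - R(z0)v = R(z)(u - v) + (z0 - z) R(z)R(z0)v], and
    [res_local] bounds [R(z)] near [z0]. The cases [j = 1, 2] make [R(z)x] and [R(z)^2 x]
    continuous, hence weakly measurable, on vertical lines. *)
Lemma iter_res_lipschitz j x z0 : 0 < complex.Re z0 ->
  exists2 d, 0 < d & exists C, forall z, 0 < complex.Re z -> cabs (z - z0) < d ->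
    rnorm (iter j (Res z) x - iter j (Res z0) x) <= C * cabs (z - z0).
Proof.
move=> z00; have [c c0 hc] := res_bound z00.
have near z : cabs (z - z0) < (2 * c)^-1 -> cabs (z - z0) * c <= 2^-1.
  move=> /ltW /(ler_wpM2r (ltW c0)); rewrite (_ : (2 * c)^-1 * c = 2^-1)//.
  by field; lra.
elim: j => [|j [d d0 [C ih]]].
  by exists 1 => //; exists 0 => z _ _; rewrite /= subrr rnorm0 mul0r.
exists (Num.min d (2 * c)^-1).
  by rewrite lt_min d0/= invr_gt0; lra.
exists (2 * c * C + 2 * c * rnorm (Res z0 (iter j (Res z0) x))) => z hz.
rewrite lt_min => /andP[zd zc] /=.
set u := iter j (Res z) x; set v := iter j (Res z0) x.
have -> : Res z u - Res z0 v = Res z (u - v) + (Res z v - Res z0 v).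
  by rewrite resB// addrA subrK.
apply: le_trans (rnormD _ _) _.
have h1 := res_local (u - v) z00 hz hc (near _ zc).
have h2 := res_local (Res z0 v) z00 hz hc (near _ zc).
rewrite res_identity// rnormZ cabsB.
have h3 := ler_wpM2l (cabs_ge0 (z - z0)) h2.
have h4 : 2 * c * rnorm (u - v) <= 2 * c * (C * cabs (z - z0)).
  by rewrite ler_wpM2l ?ih//; lra.
rewrite -/v in h3 *; lra.
Qed.

Lemma dualB phi x y : dual_elt phi -> phi (x - y) = phi x - phi y :> R[i].
Proof.
move=> [lin _]; have := lin (-1) y x; rewrite scaleN1r addrC => ->.
by rewrite mulN1r addrC.
Qed.

Lemma dualD phi x y : dual_elt phi -> phi (x + y) = phi x + phi y :> R[i].
Proof. by move=> [lin _]; have := lin 1 x y; rewrite scale1r mul1r. Qed.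

Lemma dual0 phi : dual_elt phi -> phi (0 : X) = 0 :> R[i].
Proof. by move=> dphi; have := dualB 0 0 dphi; rewrite !subrr. Qed.

Lemma dualZ phi (a : R[i]) x : dual_elt phi -> phi (a *: x) = a * phi x :> R[i].
Proof.
by move=> dphi; have [lin _] := dphi; have := lin a x 0; rewrite !addr0 (dual0 dphi) addr0.
Qed.

Lemma ccontinuous_iter_res j x phi (a : R) : dual_elt phi -> 0 < a ->
  ccontinuous (fun b => phi (iter j (Res (a +i* b)%C) x)).
Proof.
move=> dphi a0 b0 e e0; have [c c0 [_ _ phic]] := dual_elt_bound dphi.
have [d d0 [C hC]] := iter_res_lipschitz j x (z0 := (a +i* b0)%C) a0.
exists (Num.min d (e / (c * `|C| + 1))).
  by rewrite lt_min d0 divr_gt0// ltr_wpDl// mulr_ge0.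
move=> b; rewrite lt_min => /andP[bd be].
have eb : cabs ((a +i* b)%C - (a +i* b0)%C) = `|b - b0|.
  by rewrite cabsE/= subrr expr0n add0r sqrtr_sqr.
have := hC (a +i* b)%C a0; rewrite eb => /(_ bd) h.
rewrite -dualB//; apply: le_lt_trans (phic _) _.
apply: (@le_lt_trans _ _ (c * (`|C| * `|b - b0|))).
  rewrite ler_wpM2l//; apply: le_trans h _.
  by rewrite ler_wpM2r// ler_norm.
have q : 0 < c * `|C| + 1 by rewrite ltr_wpDl// mulr_ge0.
move: be; rewrite ltr_pdivlMr// => be.
apply: le_lt_trans be; rewrite mulrA mulrC ler_wpM2l//; lra.
Qed.

Lemma cmeasurable_iter_res j x phi (a : R) : dual_elt phi -> 0 < a ->
  cmeasurable (fun b => phi (iter j (Res (a +i* b)%C) x)).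
Proof. by move=> dphi a0; exact/ccontinuous_cmeasurable/ccontinuous_iter_res. Qed.

Local Notation mu := (@lebesgue_measure R).

Let sq z x := Res z (Res z x).

(** Truncation sets. On [E a m] the resolvent is bounded by [m] and the measure is at most [2m], so
    the integral over it is a bounded seminorm in [x] and in [phi], as the uniform boundedness
    principle requires. The sets increase to the whole line. *)
Let E (a : R) (m : nat) := [set b : R | `|b| <= m%:R /\
  forall x, rnorm (Res (a +i* b)%C x) <= m%:R * rnorm x].

Let measurableE a m : 0 < a -> measurable (E a m).
Proof.
move=> a0.
have -> : E a m = `[- m%:R, m%:R]%classic `&`
    [set b | forall x, rnorm (Res (a +i* b)%C x) <= m%:R * rnorm x].
  by apply/seteqP; split => b; rewrite /E /= in_itv/= ler_norml.
apply: measurableI; first exact: measurable_itv.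
(* The condition ranges over uncountably many [x], but it is closed in [b]: a strict violation at
   one [x] persists nearby by continuity of [R(a + ib)x]. *)
apply: closed_measurable; rewrite -[X in closed X]setCK; apply: open_closedC.
rewrite openE => b0 /= /existsNP[x] /negP; rewrite -ltNge => lt0.
have [d d0 [C hC]] := iter_res_lipschitz 1 x (z0 := (a +i* b0)%C) a0.
set g := rnorm (Res (a +i* b0)%C x) - m%:R * rnorm x.
have g0 : 0 < g by rewrite /g; lra.
have q : 0 < `|C| + 1 by rewrite ltr_wpDl.
rewrite /interior; near=> b => h.
have bd : `|b - b0| < d by near: b; apply: cvgr_distC_lt => //; exact: cvg_id.
have bg : `|b - b0| < g / (`|C| + 1).
  by near: b; apply: cvgr_distC_lt; [exact: cvg_id|rewrite divr_gt0].
have eb : cabs ((a +i* b)%C - (a +i* b0)%C) = `|b - b0|.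
  by rewrite cabsE/= subrr expr0n add0r sqrtr_sqr.
have := hC (a +i* b)%C a0; rewrite eb => /(_ bd) /= h1.
have h2 := rnormD (Res (a +i* b)%C x) (Res (a +i* b0)%C x - Res (a +i* b)%C x).
rewrite addrC subrK rnormB in h2.
move: bg; rewrite ltr_pdivlMr// => bg.
have : C * `|b - b0| <= `|C| * `|b - b0| by rewrite ler_wpM2r// ler_norm.
have := normr_ge0 (b - b0).
by have := h x; rewrite /g in bg; lra.
Unshelve. all: by end_near. Qed.

Let homoE a : nondecreasing_seq (E a).
Proof.
move=> m n mn; apply/subsetPset => b [bm h]; split.
  by apply: le_trans bm _; rewrite ler_nat.
by move=> x; apply: le_trans (h x) _; rewrite ler_wpM2r ?rnorm_ge0// ler_nat.
Qed.

Let bigcupE a : 0 < a -> \bigcup_m E a m = setT.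
Proof.
move=> a0; apply/seteqP; split => // b _.
have [c c0 hc] := @res_bound (a +i* b)%C a0.
pose m := (Num.trunc (`|b| + c)).+1.
have hm : `|b| + c < m%:R by exact: truncnS_gt.
exists m => //; split; first by lra.
by move=> x; apply: le_trans (hc x) _; rewrite ler_wpM2r ?rnorm_ge0//; have := normr_ge0 b; lra.
Qed.

Let muE a m : 0 < a -> (mu (E a m) <= (2 * m%:R)%:E)%E.
Proof.
move=> a0; apply: (@le_trans _ _ (mu `[- m%:R, m%:R]%classic)).
  apply: le_measure; rewrite ?inE//; first exact: measurableE.
  by move=> b [+ _] /=; rewrite in_itv/= ler_norml.
rewrite lebesgue_measure_itv/=; case: ifPn => _; last by rewrite lee_fin mulr_ge0.
by rewrite -EFinB lee_fin; lra.
Qed.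

Let I (a : R) (m : nat) (phi : X -> R[i]) (x : X) : \bar R :=
  (\int[mu]_(b in E a m) (cabs (phi (sq (a +i* b)%C x)))%:E)%E.

Let measurable_sq a phi x (S : set R) : 0 < a -> dual_elt phi ->
  measurable_fun S (fun b => (cabs (phi (sq (a +i* b)%C x)))%:E).
Proof.
move=> a0 dphi; apply/measurable_EFinP/measurable_funTS.
by apply: measurable_cabs; exact: (cmeasurable_iter_res 2).
Qed.

Let I_ge0 a m phi x : (0 <= I a m phi x)%E.
Proof. by apply: integral_ge0 => b _; rewrite lee_fin cabs_ge0. Qed.

Let I_le a m phi c x : 0 < a -> dual_bound phi c ->
  (I a m phi x <= (2 * m%:R * (m%:R * m%:R) * c * rnorm x)%:E)%E.
Proof.
move=> a0 dc; have [c0 _ hc] := dc.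
set k := m%:R * m%:R * c * rnorm x.
have k0 : 0 <= k by rewrite !mulr_ge0 ?rnorm_ge0.
apply: (@le_trans _ _ (\int[mu]_(b in E a m) k%:E)%E).
  apply: ge0_le_lower_integral => b; first by rewrite lee_fin cabs_ge0.
  move=> [_ h]; rewrite lee_fin; apply: le_trans (hc _) _.
  rewrite (_ : k = c * (m%:R * (m%:R * rnorm x))); last by rewrite /k; ring.
  rewrite ler_wpM2l//; apply: le_trans (h _) _.
  by rewrite ler_wpM2l.
rewrite integral_cst; last exact: measurableE.
apply: (@le_trans _ _ (k%:E * (2 * m%:R)%:E)%E).
  by rewrite lee_wpmul2l ?lee_fin// muE.
by rewrite -EFinM lee_fin; apply: eq_ler; rewrite /k; ring.
Qed.

Let I_fin a m phi x : 0 < a -> dual_elt phi -> I a m phi x \is a fin_num.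
Proof.
move=> a0 /dual_elt_bound[c c0 dc]; rewrite ge0_fin_numE//.
by apply: le_lt_trans (I_le _ _ a0 dc) _; rewrite ltry.
Qed.

(** The functionals and the vectors may both vary, so that subadditivity in [x] and in [phi] are two
    instances. *)
Let I_le_sum a m phi psi chi x y (t : X) : 0 < a ->
  dual_elt phi -> dual_elt psi -> dual_elt chi ->
  (forall b, cabs (chi (sq (a +i* b)%C t)) <=
    cabs (phi (sq (a +i* b)%C x)) + cabs (psi (sq (a +i* b)%C y))) ->
  fine (I a m chi t) <= fine (I a m phi x) + fine (I a m psi y).
Proof.
move=> a0 dphi dpsi dchi h; rewrite -lee_fin EFinD !fineK ?I_fin//.
rewrite /I -ge0_integralD//; last first.
- exact: measurable_sq.
- by move=> b _; rewrite lee_fin cabs_ge0.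
- exact: measurable_sq.
- by move=> b _; rewrite lee_fin cabs_ge0.
- exact: measurableE.
apply: ge0_le_lower_integral => b _; first by rewrite lee_fin cabs_ge0.
by rewrite -EFinD lee_fin.
Qed.

Let I_scale a m phi psi x y (r : R) : 0 < a -> 0 <= r -> dual_elt phi ->
  (forall b, cabs (psi (sq (a +i* b)%C y)) = r * cabs (phi (sq (a +i* b)%C x))) ->
  fine (I a m psi y) = r * fine (I a m phi x).
Proof.
move=> a0 r0 dphi h.
have -> : I a m psi y = (r%:E * I a m phi x)%E.
  rewrite /I -ge0_integralZl_EFin//.
  - by apply: eq_integral => b _; rewrite h EFinM.
  - exact: measurableE.
  - by move=> b _; rewrite lee_fin cabs_ge0.
  - exact: measurable_sq.
by rewrite fineM// I_fin.
Qed.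

Hypothesis hyp : forall (x : X) (phi : X -> R[i]), dual_elt phi ->
  exists C : R, forall a : R, 0 < a ->
    ((a + 1)%:E * \int[mu]_(b in [set: R]) (cabs (phi (sq (a +i* b)%C x)))%:E
      <= C%:E)%E.

Let sqD z x y : 0 < complex.Re z -> sq z (x + y) = sq z x + sq z y.
Proof. by move=> z0; rewrite /sq !resD. Qed.

Let sqZ z (a : R[i]) x : 0 < complex.Re z -> sq z (a *: x) = a *: sq z x.
Proof. by move=> z0; rewrite /sq !resZ. Qed.

Let sqN z x : 0 < complex.Re z -> sq z (- x) = - sq z x.
Proof. by move=> z0; rewrite /sq !resN. Qed.

Let dualN phi x : dual_elt phi -> phi (- x) = - phi x :> R[i].
Proof. by move=> dphi; rewrite -scaleN1r dualZ// mulN1r. Qed.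

Let posR := {a : R | 0 < a}.

Let I_le_hyp phi x : dual_elt phi -> exists C, forall (i : posR * nat),
  (sval i.1 + 1) * fine (I (sval i.1) i.2 phi x) <= C.
Proof.
move=> dphi; have [C hC] := hyp x dphi; exists C => -[[a a0] m] /=.
rewrite -lee_fin EFinM fineK ?I_fin//; apply: le_trans (hC a a0).
rewrite lee_wpmul2l ?lee_fin ?addr_ge0 ?(ltW a0)//.
apply: ge0_subset_integral => //; first exact: measurableE.
- exact: measurable_sq.
- by move=> b _; rewrite lee_fin cabs_ge0.
Qed.

(** Uniform boundedness in [x] for fixed [phi], over the family of all abscissas and all
    truncations. *)
Let step1 phi : dual_elt phi -> exists2 K, 0 <= K & forall (i : posR * nat) x,
  (sval i.1 + 1) * fine (I (sval i.1) i.2 phi x) <= K * rnorm x.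
Proof.
move=> dphi; have [c c0 dc] := dual_elt_bound dphi.
apply: (uniform_boundedness_space (p := fun i x =>
  (sval i.1 + 1) * fine (I (sval i.1) i.2 phi x))).
- move=> [[a a0] m] x y /=; rewrite -mulrDr ler_wpM2l ?addr_ge0 ?(ltW a0)//.
  by apply: I_le_sum => // b; rewrite sqD// dualD//; exact: cabsD.
- move=> [[a a0] m] x /=; congr (_ * _).
  by rewrite -[RHS]mul1r; apply: I_scale => // b; rewrite sqN// dualN// cabsN mul1r.
- move=> [[a a0] m] r x r0 /=; rewrite mulrCA; congr (_ * _).
  by apply: I_scale => // b; rewrite sqZ// dualZ// cabsM cabs_real ger0_norm.
- move=> [[a a0] m] /=; exists ((a + 1) * (2 * m%:R * (m%:R * m%:R) * c)) => x.
  rewrite -mulrA ler_wpM2l ?addr_ge0 ?(ltW a0)//.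
  by rewrite -lee_fin fineK ?I_fin//; exact: I_le.
- by move=> x; exact: I_le_hyp.
Qed.

(** Uniform boundedness in [phi]: the unit ball of [X] joins the index set, and [step1] is the
    pointwise bound. *)
Let step2 : exists2 K, 0 <= K & forall (i : posR * nat * {x : X | rnorm x <= 1}) phi c,
  dual_bound phi c ->
  (sval i.1.1 + 1) * fine (I (sval i.1.1) i.1.2 phi (sval i.2)) <= K * c.
Proof.
apply: (uniform_boundedness_dual (p := fun (i : posR * nat * {x : X | rnorm x <= 1}) phi =>
  (sval i.1.1 + 1) * fine (I (sval i.1.1) i.1.2 phi (sval i.2)))).
- move=> [[[a a0] m] [x x1]] f g df dg /=.
  rewrite -mulrDr ler_wpM2l ?addr_ge0 ?(ltW a0)//.
  apply: I_le_sum => //; last by move=> b; exact: cabsD.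
  have [cf _ hf] := dual_elt_bound df; have [cg _ hg] := dual_elt_bound dg.
  apply: (dual_bound_elt (c := cf + cg)).
  have [? lf bf] := hf; have [? lg bg] := hg; split; first exact: addr_ge0.
    by move=> r u v; rewrite !fctE lf lg; ring.
  by move=> u; apply: le_trans (cabsD _ _) _; rewrite mulrDl lerD.
- move=> [[[a a0] m] [x x1]] f df /=; congr (_ * _).
  by rewrite -[RHS]mul1r; apply: I_scale => // b; rewrite fctE cabsN mul1r.
- move=> [[[a a0] m] [x x1]] r f r0 df /=; rewrite mulrCA; congr (_ * _).
  by apply: I_scale => // b; rewrite fctE [LHS]cabsM cabs_real ger0_norm.
- move=> [[[a a0] m] [x x1]] /=; exists ((a + 1) * (2 * m%:R * (m%:R * m%:R))) => f c fc.
  rewrite -mulrA ler_wpM2l ?addr_ge0 ?(ltW a0)//.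
  rewrite -lee_fin fineK ?I_fin//; last exact: dual_bound_elt fc.
  apply: le_trans (I_le _ _ a0 fc) _; rewrite lee_fin -[leRHS]mulr1.
  by have [c0 _ _] := fc; rewrite ler_wpM2l// !mulr_ge0.
- move=> f df; have [K K0 hK] := step1 df; exists K => -[[i m] [x x1]] /=.
  by apply: le_trans (hK (i, m) x) _; rewrite -[leRHS]mulr1 ler_wpM2l.
Qed.

(** Homogeneity reduces to the unit ball of [step2]; the bound is independent of the truncation, and
    the truncated integrals increase to the full one. Passing to [K + 1] makes the constant
    positive. *)
Lemma integral_res_sqr_le : exists2 K, 0 < K & forall (a : R) phi c x, 0 < a ->
  dual_bound phi c ->
  (\int[mu]_b (cabs (phi (sq (a +i* b)%C x)))%:E <= (K / (a + 1) * c * rnorm x)%:E)%E.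
Proof.
have [K K0 hK] := step2; exists (K + 1); first by rewrite ltr_wpDl.
move=> a phi c x a0 dc; have dphi := dual_bound_elt dc; have [c0 _ _] := dc.
have a1 : 0 < a + 1 by rewrite addr_gt0.
have Em m : (I a m phi x <= ((K + 1) / (a + 1) * c * rnorm x)%:E)%E.
  have [x0|x0] := eqVneq (rnorm x) 0.
    have -> : x = 0 by apply: rnorm0_eq0; rewrite x0.
    by apply: le_trans (I_le _ _ a0 dc) _; rewrite rnorm0 !mulr0.
  have xp : 0 < rnorm x by rewrite lt_neqAle eq_sym x0 rnorm_ge0.
  have y1 : rnorm ((rnorm x)^-1%:C%C *: x) <= 1.
    by rewrite rnormZ cabs_real ger0_norm ?invr_ge0 ?rnorm_ge0// mulVf.
  have := hK (exist _ a a0, m, exist (fun y : X => is_true (rnorm y <= 1)) _ y1) phi c dc; rewrite /=.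
  rewrite (@I_scale _ _ phi phi x _ (rnorm x)^-1) ?invr_ge0 ?rnorm_ge0//; last first.
    by move=> b; rewrite sqZ// dualZ// cabsM cabs_real ger0_norm ?invr_ge0 ?rnorm_ge0.
  move=> h; rewrite -(fineK (I_fin _ _ a0 dphi)) lee_fin.
  have -> : fine (I a m phi x) = (a + 1) * ((rnorm x)^-1 * fine (I a m phi x)) *
      (rnorm x / (a + 1)).
    by field; rewrite x0 lt0r_neq0.
  apply: le_trans (ler_wpM2r _ h) _; first by rewrite divr_ge0 ?rnorm_ge0// ltW.
  rewrite (_ : K * c * (rnorm x / (a + 1)) = K / (a + 1) * c * rnorm x); last first.
    by field; rewrite lt0r_neq0.
  by rewrite !ler_wpM2r ?rnorm_ge0 ?invr_ge0 ?(ltW a1)// lerDl.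
have : (I a m phi x @[m --> \oo] -->
    \int[mu]_(b in \bigcup_m E a m) (cabs (phi (sq (a +i* b)%C x)))%:E)%E.
  apply: ge0_nondecreasing_set_cvg_integral => //.
  - by move=> m; exact: measurableE.
  - by move=> m; exact: measurable_sq.
  - by move=> m b _; rewrite lee_fin cabs_ge0.
rewrite bigcupE// => cvgI; rewrite -(cvg_lim _ cvgI)//.
by apply: lime_le; [apply/cvg_ex; eexists; exact: cvgI|exact: nearW].
Qed.

End resolvent.

(** * Real derivatives from Taylor estimates *)

Section quadratic_derivative.
Variable R : realType.

Lemma littleo_is_derive (F : R -> R) (b v : R) :
  (forall e, 0 < e -> exists2 d, 0 < d & forall h, `|h| < d ->
    `|F (b + h) - F b - h * v| <= e * `|h|) ->
  is_derive b 1 F v.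
Proof.
move=> FC.
have cv : (fun h : R => h^-1 *: ((F \o shift b) (h *: 1) - F b)) @ 0^' --> v.
  apply/cvgrPdist_le => e e0; have [d d0 hd] := FC e e0; near=> h.
  have h0 : h != 0 by near: h; exact: nbhs_dnbhs_neq.
  have {}hd : `|F (b + h) - F b - h * v| <= e * `|h|.
    by apply: hd; near: h; exact: dnbhs0_lt.
  rewrite /= /shift /GRing.scale/= mulr1 (addrC h).
  have -> : v - h^-1 * (F (b + h) - F b) = - (h^-1 * (F (b + h) - F b - h * v)).
    by field.
  rewrite normrN normrM normfV ler_pdivrMl ?normr_gt0//.
  by apply: le_trans hd _; rewrite mulrC.
split; first by apply: cvgP cv.
exact: cvg_lim cv.
Unshelve. all: by end_near. Qed.

Lemma quadratic_is_derive (F : R -> R) (b v C d : R) : 0 < d ->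
  (forall h, `|h| < d -> `|F (b + h) - F b - h * v| <= C * h ^+ 2) ->
  is_derive b 1 F v.
Proof.
move=> d0 FC; apply: littleo_is_derive => e e0.
have q : 0 < `|C| + 1 by rewrite ltr_wpDl.
exists (Num.min d (e / (`|C| + 1))); first by rewrite lt_min d0 divr_gt0.
move=> h; rewrite lt_min => /andP[/FC hd]; rewrite ltr_pdivlMr// => he.
apply: le_trans hd _; rewrite -real_normK ?num_real// expr2 mulrA ler_wpM2r//.
apply: le_trans (ltW he); rewrite mulrC ler_wpM2l//.
by rewrite (le_trans (ler_norm C))// lerDl.
Qed.

End quadratic_derivative.

(** * A bound of the resolvent uniform on the right half-plane *)

Section resolvent_bound.
Variables (R : realType) (X : completeNormedModType R[i]).
Variables (D : set X) (A : X -> X) (Res : R[i] -> X -> X).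
Hypothesis domA : dd_linear_op D A.
Hypothesis resA : resolvent_right D A Res.
Local Notation mu := (@lebesgue_measure R).
Implicit Types (z w : R[i]) (x y : X).

Lemma dense_domain x (e : R) : 0 < e -> exists2 y, D y & rnorm (x - y) < e.
Proof.
move=> e0; have [_ [_ [_ clD]]] := domA.
have : closure D x by rewrite clD.
have e0' : 0 < e%:C%C :> R[i] by rewrite ltcR.
move=> /(_ (ball x e%:C%C) (nbhsx_ballx _ _ e0'))[y [Dy]].
by rewrite -ball_normE/= norm_rnorm ltcR => xy; exists y.
Qed.

(** By the resolvent identity the remainder is [-ih phi((R(z + ih) - R(z)) R(z)x)], and Lipschitz
    continuity of the resolvent supplies the second factor [h]. *)
Lemma res_quadratic_derivative x phi (a b : R) : dual_elt phi -> 0 < a ->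
  exists2 d, 0 < d & exists C, forall h : R, `|h| < d ->
    cabs (phi (Res (a +i* (b + h))%C x) - phi (Res (a +i* b)%C x) +
      'i%C * h%:C%C * phi (Res (a +i* b)%C (Res (a +i* b)%C x))) <= C * h ^+ 2.
Proof.
move=> dphi a0; have [c c0 [_ _ hc]] := dual_elt_bound dphi.
have [d d0 [C hC]] := iter_res_lipschitz resA 1 (Res (a +i* b)%C x)
  (z0 := (a +i* b)%C) a0.
exists d => //; exists (c * C) => h hd.
have eh : (a +i* b)%C - (a +i* (b + h))%C = - ('i%C * h%:C%C).
  by apply: complex_eq => /=; ring.
have -> : phi (Res (a +i* (b + h))%C x) - phi (Res (a +i* b)%C x) +
      'i%C * h%:C%C * phi (Res (a +i* b)%C (Res (a +i* b)%C x)) =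
   - ('i%C * h%:C%C) * phi (Res (a +i* (b + h))%C (Res (a +i* b)%C x)
      - Res (a +i* b)%C (Res (a +i* b)%C x)).
  rewrite -dualB// (res_identity resA)// eh dualZ// dualB//; ring.
rewrite cabsM cabsN cabsM cabs_i mul1r cabs_real.
have eh' : cabs ((a +i* (b + h))%C - (a +i* b)%C) = `|h|.
  by rewrite cabsB eh cabsN cabsM cabs_i mul1r cabs_real.
have := hC (a +i* (b + h))%C a0; rewrite eh' => /(_ hd) /= h1.
have h2 := hc (Res (a +i* (b + h))%C (Res (a +i* b)%C x)
      - Res (a +i* b)%C (Res (a +i* b)%C x)).
rewrite -real_normK ?num_real// expr2.
have h3 := ler_wpM2l (normr_ge0 h) (le_trans h2 (ler_wpM2l c0 h1)).
by apply: le_trans h3 _; apply: eq_ler; ring.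
Qed.

Variable K : R.
Hypothesis K0 : 0 < K.
Hypothesis HK : forall (a : R) phi c x, 0 < a -> dual_bound phi c ->
  (\int[mu]_b (cabs (phi (Res (a +i* b)%C (Res (a +i* b)%C x))))%:E
    <= (K / (a + 1) * c * rnorm x)%:E)%E.

(** The derivative along the line is [-i phi(R(z)^2 x)], whose total integral is controlled by
    [HK]. *)
Lemma res_vertical_diff x phi c (a p q : R) : dual_bound phi c -> 0 < a -> p < q ->
  cabs (phi (Res (a +i* q)%C x) - phi (Res (a +i* p)%C x)) <= 2 * (K * c * rnorm x).
Proof.
move=> dc a0 pq; have dphi := dual_bound_elt dc; have [c0 _ _] := dc.
pose g b := phi (Res (a +i* b)%C x).
pose G b := phi (Res (a +i* b)%C (Res (a +i* b)%C x)).
have [cR cI] := ccontinuous_Re_Im (ccontinuous_iter_res resA 2 x dphi a0).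
have Gle : (\int[mu]_(b in `[p, q]) (cabs (G b))%:E <= (K * c * rnorm x)%:E)%E.
  apply: (@le_trans _ _ (\int[mu]_b (cabs (G b))%:E)%E).
    apply: ge0_subset_integral => //; last by move=> b _; rewrite lee_fin cabs_ge0.
    apply/measurable_EFinP; apply: measurable_cabs.
    exact: (cmeasurable_iter_res resA 2).
  (* Since [a + 1 >= 1], the bound no longer depends on the line. *)
  apply: le_trans (HK x a0 dc) _; rewrite lee_fin !ler_wpM2r ?rnorm_ge0//.
  by rewrite ler_pdivrMr ?addr_gt0// ler_peMr ?(ltW K0)// lerDr ltW.
(* From [g' = -i G]: the derivative of [Re g] is [Im G] and that of [Im g] is [- Re G]. *)
have dR (b : R) : is_derive b 1 (fun b : R => complex.Re (g b) : R) (complex.Im (G b)).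
  have [d d0 [C hC]] := res_quadratic_derivative x b dphi a0.
  apply: (quadratic_is_derive d0) => h /hC; apply: le_trans.
  apply: le_trans (cabs_Re _); rewrite ReD ReD ReN ReM ReM ImM /=.
  by rewrite -/(g _) -/(g _) -/(G _); apply: eq_ler; congr `|_|; ring.
have dI (b : R) : is_derive b 1 (fun b : R => complex.Im (g b) : R) (- complex.Re (G b)).
  have [d d0 [C hC]] := res_quadratic_derivative x b dphi a0.
  apply: (quadratic_is_derive d0) => h /hC; apply: le_trans.
  apply: le_trans (cabs_Im _); rewrite ImD ImD ImN ImM ReM ImM /=.
  by rewrite -/(g _) -/(g _) -/(G _); apply: eq_ler; congr `|_|; ring.
have ftc (F f : R -> R) : (forall b : R, is_derive b 1 F (f b)) -> continuous f ->
    (forall b, `|f b| <= cabs (G b)) -> `|F q - F p| <= K * c * rnorm x.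
  move=> dF cf fG.
  have cF : continuous F.
    move=> b; apply: differentiable_continuous; apply/derivable1_diffP.
    by have [] := dF b.
  have e : (\int[mu]_(b in `[p, q]) (f b)%:E = (F q)%:E - (F p)%:E)%E.
    apply: continuous_FTC2 => //.
    - exact: continuous_subspaceT.
    - split; first by move=> b _; have [] := dF b.
      + by apply: cvg_at_right_filter; exact: cF.
      + by apply: cvg_at_left_filter; exact: cF.
    - by move=> b _; rewrite derive1E; have [_ ->] := dF b.
  have := @fine_integral_le _ _ _ mu `[p, q]%classic f (fun b => (cabs (G b))%:E) _ _ Gle.
  by rewrite e -EFinB /=; apply => b _; rewrite lee_fin.
rewrite mulr_natl mulr2n; apply: le_trans (cabs_le_ReIm _) _.
rewrite ReD ReN ImD ImN; apply: lerD.
- by apply: (ftc _ _ dR) => // b; exact: cabs_Im.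
- apply: (ftc _ _ dI) => [b|b]; last by rewrite normrN; exact: cabs_Re.
  by apply: continuousN; exact: cR.
Qed.

(** For [y] in the domain, [R(w)y] tends weakly to 0 as [w] climbs the vertical line, so the
    oscillation bound [res_vertical_diff] becomes a bound of [R(z)y] itself. Density of the domain
    does the rest. *)
Lemma res_le z x : 0 < complex.Re z -> rnorm (Res z x) <= 2 * K * rnorm x.
Proof.
case: z => a b /= a0.
have onD y : D y -> rnorm (Res (a +i* b)%C y) <= 2 * K * rnorm y.
  move=> Dy; apply: rnorm_le_dual => phi dphi phi1.
  have dc : dual_bound phi 1.
    by split => //; [case: dphi|move=> u; rewrite mul1r].
  (* A bound of [|w phi(R(w)y)|] along the line above 0, from [wR(w)y = y - R(w)Ay], where [R(w)Ay]
     differs boundedly from its value at height 0. The height [q] then makes [B / q <= e]. *)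
  pose B := cabs (phi y) + cabs (phi (Res (a +i* 0)%C (A y))) + 2 * (K * rnorm (A y)).
  have B0 : 0 <= B by rewrite !addr_ge0 ?cabs_ge0// !mulr_ge0 ?rnorm_ge0 ?(ltW K0).
  apply: le_eps => e e0.
  pose q := `|b| + 1 + B / e.
  have Be : 0 <= B / e by rewrite divr_ge0// ltW.
  have bq : b < q by rewrite /q; have := ler_norm b; lra.
  have q0 : 0 < q by rewrite /q; have := normr_ge0 b; lra.
  have h1 := res_vertical_diff y dc a0 bq; rewrite mulr1 in h1.
  have h2 := res_vertical_diff (A y) dc a0 q0; rewrite mulr1 in h2.
  set w := (a +i* q)%C in h1 h2.
  have wq : q <= cabs w by apply: le_trans (cabs_Im w); rewrite /= ger0_norm// ltW.
  have ew : w * phi (Res w y) = phi y - phi (Res w (A y)).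
    have w0 : 0 < complex.Re w by [].
    have [_ [_ /(_ _ Dy)]] := resA w0.
    rewrite (resD resA)// (resZ resA)// => /(congr1 phi).
    by rewrite dualD// dualZ// => <-; ring.
  have h3 : cabs w * cabs (phi (Res w y)) <= B.
    rewrite -cabsM ew; apply: le_trans (cabsD _ _) _; rewrite cabsN /B -addrA lerD2l.
    have := cabsD (phi (Res w (A y)) - phi (Res (a +i* 0)%C (A y)))
      (phi (Res (a +i* 0)%C (A y))).
    by rewrite subrK; lra.
  have h4 : cabs (phi (Res w y)) <= e.
    have : q * cabs (phi (Res w y)) <= B.
      by apply: le_trans h3; rewrite ler_wpM2r ?cabs_ge0.
    rewrite -ler_pdivlMl// => /le_trans; apply.
    rewrite ler_pdivrMl// -ler_pdivrMr// /q; have := normr_ge0 b; lra.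
  have := cabsD (phi (Res w y)) (phi (Res (a +i* b)%C y) - phi (Res w y)).
  rewrite addrC subrK cabsB => h5; rewrite -mulrA; move: h1 h4 h5; lra.
(* The bound [c] depends on [z], but it only decides how closely [y] has to approximate [x]. *)
have [c c0 hc] := res_bound resA (z := (a +i* b)%C) a0.
apply: le_eps => e e0.
have q0 : 0 < c + 2 * K by rewrite addr_gt0 ?mulr_gt0.
have [y Dy xy] := dense_domain x (divr_gt0 e0 q0).
have h1 := hc (x - y); rewrite (resB resA)// in h1.
have h2 := rnormD (Res (a +i* b)%C y) (Res (a +i* b)%C x - Res (a +i* b)%C y).
rewrite addrC subrK in h2.
have h3 := rnormD x (y - x); rewrite addrC subrK rnormB in h3.
move: xy; rewrite ltr_pdivlMr// => xy.
have h4 := onD y Dy.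
have h5 : 2 * K * rnorm y <= 2 * K * (rnorm x + rnorm (x - y)).
  by rewrite ler_wpM2l// mulr_ge0// ltW.
lra.
Qed.

End resolvent_bound.

(** * Complex differentiability in increment form *)

Section complex_derivative.
Variable R : realType.
Implicit Types (f : R[i] -> R[i]) (z v : R[i]).

Lemma gt0_complex (e : R[i]) : 0 < e -> exists2 r : R, 0 < r & e = r%:C%C.
Proof.
rewrite ltcE/= => /andP[/eqP ie re]; exists (complex.Re e) => //.
exact: complex_eq.
Qed.

Definition cdiff f z v := forall e : R, 0 < e -> exists2 d, 0 < d &
  forall h, cabs h < d -> cabs (f (z + h) - f z - h * v) <= e * cabs h.

Lemma derivable_cdiff f z : derivable (f : R[i]^o -> R[i]^o) z 1 ->
  cdiff f z (cderiv f z).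
Proof.
move=> df e e0; have e0' : 0 < e%:C%C :> R[i] by rewrite ltcR.
have /cvgrPdist_le/(_ _ e0') := df.
rewrite near_withinE => /nbhs_ballP[d' d'0 hd].
have [d d0 dd'] := gt0_complex d'0; exists d => // h hh.
have [->|h0] := eqVneq h 0; first by rewrite addr0 subrr mul0r subrr cabs0 mulr0.
have := hd h; rewrite -ball_normE/= sub0r normrN normC_cabs dd' ltcR => /(_ hh h0).
rewrite -/(cderiv f z) normC_cabs lecR /shift /GRing.scale/= mulr1 => h1.
have -> : f (z + h) - f z - h * cderiv f z =
    - h * (cderiv f z - h^-1 * (f (h + z) - f z)) by rewrite (addrC h); field.
by rewrite cabsM cabsN mulrC ler_wpM2r// cabs_ge0.
Qed.

Lemma cdiff_derivable f z v : cdiff f z v ->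
  derivable (f : R[i]^o -> R[i]^o) z 1 /\ cderiv f z = v.
Proof.
move=> fv.
have cv : (fun h : R[i]^o => h^-1 *: (((f : R[i]^o -> R[i]^o) \o shift z) (h *: 1) - f z)) @ 0^'
    --> (v : R[i]^o).
  apply/cvgrPdist_le => e' e'0; have [e e0 ee'] := gt0_complex e'0.
  have [d d0 hd] := fv e e0; near=> h.
  have h0 : h != 0 by near: h; exact: nbhs_dnbhs_neq.
  have {}hd : cabs (f (z + h) - f z - h * v) <= e * cabs h.
    apply: hd; rewrite -ltcR -normC_cabs; near: h; apply: dnbhs0_lt.
    by rewrite ltcR.
  rewrite normC_cabs ee' lecR /= /shift /GRing.scale/= mulr1 (addrC h).
  have -> : v - h^-1 * (f (z + h) - f z) = - (h^-1 * (f (z + h) - f z - h * v)).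
    by field.
  have ch0 : 0 < cabs h.
    rewrite lt_neqAle cabs_ge0 andbT eq_sym.
    by apply: contra_neq h0 => h1; apply: cabs0_eq0; rewrite h1.
  rewrite cabsN cabsM cabsV ler_pdivrMl//.
  by apply: le_trans hd _; rewrite mulrC.
split; first exact: cvgP cv.
exact: cvg_lim cv.
Unshelve. all: by end_near. Qed.

Lemma cdiff_continuous f z v : cdiff f z v -> forall e : R, 0 < e ->
  exists2 d, 0 < d & forall h, cabs h < d -> cabs (f (z + h) - f z) < e.
Proof.
move=> fv e e0; have [d d0 hd] := fv 1 ltr01.
have q : 0 < cabs v + 1 by rewrite ltr_wpDl// cabs_ge0.
exists (Num.min d (e / (cabs v + 1))); first by rewrite lt_min d0 divr_gt0.
move=> h; rewrite lt_min => /andP[/hd h1]; rewrite ltr_pdivlMr// => h2.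
have := cabsD (f (z + h) - f z - h * v) (h * v); rewrite subrK cabsM.
by move: h1 h2; rewrite mul1r; lra.
Qed.

Lemma cdiff_dilate f (t : R) z v : 0 < t -> cdiff f (t%:C%C * z) v ->
  cdiff (dilate t f) z (t%:C%C * v).
Proof.
move=> t0 fv e e0; have [d d0 hd] := fv (e / t) (divr_gt0 e0 t0).
exists (d / t); first exact: divr_gt0.
move=> h; rewrite ltr_pdivlMr// => hh.
have ch : cabs (t%:C%C * h) = t * cabs h by rewrite cabsM cabs_real ger0_norm// ltW.
have := hd (t%:C%C * h); rewrite ch mulrC => /(_ hh).
rewrite /dilate mulrDr (_ : h * (t%:C%C * v) = t%:C%C * h * v); last by ring.
move=> /le_trans; apply.
by apply: eq_ler; field; lra.
Qed.

(** A phase [u] makes the increment of [u f] real and nonnegative, which reduces to the real mean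
    value theorem for [Re (u f)]. *)
Lemma vertical_mean_value f (a p q M : R) : p < q ->
  (forall b, cdiff f (a +i* b)%C (cderiv f (a +i* b)%C)) ->
  (forall b, cabs (cderiv f (a +i* b)%C) <= M) ->
  cabs (f (a +i* q)%C - f (a +i* p)%C) <= M * (q - p).
Proof.
move=> pq df fM.
have [u u1 ue] := cabs_exists_phase (f (a +i* q)%C - f (a +i* p)%C).
pose F (b : R) : R := complex.Re (u * f (a +i* b)%C).
pose dF (b : R) : R := complex.Re (u * ('i%C * cderiv f (a +i* b)%C)).
have FdF (b : R) : is_derive b 1 F (dF b).
  apply: littleo_is_derive => e e0; have [d d0 hd] := df b e e0.
  exists d => // h hh.
  have ch : cabs ('i%C * h%:C%C) = `|h| by rewrite cabsM cabs_i mul1r cabs_real.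
  have := hd ('i%C * h%:C%C); rewrite ch => /(_ hh); apply: le_trans.
  have -> : (a +i* b)%C + 'i%C * h%:C%C = (a +i* (b + h))%C.
    by apply: complex_eq => /=; ring.
  have um w : cabs (u * w) = cabs w by rewrite cabsM u1 mul1r.
  rewrite -um; apply: le_trans (cabs_Re _).
  rewrite /F /dF -ReCM -!ReN -!ReD; apply: eq_ler; congr `|complex.Re _|; ring.
have [|c _ e] := MVT pq (fun x _ => FdF x).
  apply: continuous_subspaceT => b.
  apply: differentiable_continuous; apply/derivable1_diffP.
  by have [] := FdF b.
have -> : cabs (f (a +i* q)%C - f (a +i* p)%C) = F q - F p.
  by rewrite /F -ReN -ReD -mulrBr ue.
rewrite e ler_wpM2r//; first by rewrite subr_ge0 ltW.
apply: le_trans (ler_norm _) _; apply: le_trans (cabs_Re _) _.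
by rewrite cabsM cabsM u1 cabs_i !mul1r.
Qed.

(** Identifies the existential [L] of [Bcalc_rep] with the known limit of the function. *)
Lemma lim_Re_infty_unique f (L L' : R[i]) :
  lim_Re_infty f L -> lim_Re_infty f L' -> L = L'.
Proof.
move=> fL fL'; apply/eqP; rewrite -subr_eq0; apply/eqP/cabs0_eq0/le_eps => e e0.
have e2 : 0 < e / 2 by rewrite divr_gt0.
have [a ha] := fL _ e2; have [a' ha'] := fL' _ e2.
pose z := (Num.max a a' + 1)%:C%C : R[i].
have := ha z; have := ha' z; rewrite /= !ltr_pwDr// ?le_max ?lexx ?orbT//.
move=> /(_ isT) h1 /(_ isT) h2.
have := cabsDB L L' (f z); rewrite (cabsB L (f z)); lra.
Qed.

End complex_derivative.

(** * A measurable majorant of [|f'|] on vertical lines *)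

Section majorant.
Variables (R : realType) (f : R[i] -> R[i]).
Hypothesis holf : holo_Cplus f.

(* The supremum of |f'| over the vertical line of abscissa [a] is the Lipschitz
   constant of [f] on this line; restricting to rational points makes it a
   countable supremum, hence a measurable function of [a]. *)
Let quotient (n : nat) (a : R) : \bar R :=
  (if unpickle n is Some (p, q) then
    if p == q :> rat then 0 else
    cabs (f (a +i* ratr p)%C - f (a +i* ratr q)%C) / `|ratr p - ratr q|
   else 0)%:E.

Definition line_sup (a : R) : \bar R := esups (quotient^~ a) 0%N.

Let holf_cdiff z : 0 < complex.Re z -> cdiff f z (cderiv f z).
Proof. by move=> z0; apply: derivable_cdiff; exact: holf. Qed.

Let line_supE a : line_sup a = ereal_sup [set quotient n a | n in setT].
Proof. by rewrite /line_sup /esups /sdrop; congr ereal_sup; apply/seteqP; split => _ [n _ <-]; exists n. Qed.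

Let quotient_le n a : (quotient n a <= line_sup a)%E.
Proof. by rewrite line_supE; apply: ereal_sup_ubound; exists n. Qed.

Lemma line_sup_ge0 a : (0 <= line_sup a)%E.
Proof.
by apply: le_trans (quotient_le 0 a).
Qed.

(** Rational points are taken on both sides of [b]: the errors [e |p - b|] and [e |q - b|] then add
    up to exactly [e |q - p|], which costs [e] in the difference quotient. *)
Lemma cderiv_le_line_sup a b : 0 < a -> ((cabs (cderiv f (a +i* b)%C))%:E <= line_sup a)%E.
Proof.
move=> a0; apply/lee_addgt0Pr => e e0.
have [d d0 hd] := holf_cdiff (z := (a +i* b)%C) a0 e0.
have [p] := @rat_in_itvoo R (b - d) b ltac:(lra); rewrite in_itv/= => /andP[p1 p2].
have [q] := @rat_in_itvoo R b (b + d) ltac:(lra); rewrite in_itv/= => /andP[q1 q2].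
have pq : p != q by apply: contraTneq (lt_trans p2 q1) => ->; rewrite ltxx.
apply: le_trans (leeD2r e%:E (quotient_le (pickle (p, q)) a)).
rewrite /quotient pickleK (negbTE pq) -EFinD lee_fin.
set v := cderiv f _; set P := ratr p : R; set Q := ratr q : R.
have est (r : R) : `|r - b| < d ->
    cabs (f (a +i* r)%C - f (a +i* b)%C - ('i%C * (r - b)%:C%C) * v) <= e * `|r - b|.
  move=> rd; have := hd ('i%C * (r - b)%:C%C).
  rewrite cabsM cabs_i mul1r cabs_real => /(_ rd).
  have -> : (a +i* b)%C + 'i%C * (r - b)%:C%C = (a +i* r)%C.
    by apply: complex_eq => /=; ring.
  by [].
have hp := est P; rewrite ltr0_norm in hp; last by rewrite /P; lra.
have hq := est Q; rewrite gtr0_norm in hq; last by rewrite /Q; lra.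
have {}hp := hp ltac:(rewrite /P; lra); have {}hq := hq ltac:(rewrite /Q; lra).
have PQ : 0 < Q - P by rewrite /P /Q; lra.
rewrite ltr0_norm; last by lra.
rewrite -lerBlDr ler_pdivlMr; last by lra.
set up := f (a +i* P)%C - _ - _ in hp; set uq := f (a +i* Q)%C - _ - _ in hq.
have e1 : 'i%C * (Q - P)%:C%C * v = (uq - up) * -1 + (f (a +i* Q)%C - f (a +i* P)%C).
  rewrite /up /uq !rmorphB/=; ring.
have := cabsD ((uq - up) * -1) (f (a +i* Q)%C - f (a +i* P)%C).
rewrite -e1 !cabsM cabs_i mul1r cabs_real gtr0_norm// cabsN cabs1 mulr1 cabsB (cabsB (f _)).
rewrite [cabs (f _ - _)]cabsB.
have := cabsD up (- uq); rewrite cabsN; lra.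
Qed.

(** By the mean value estimate, unless the supremum is infinite. Through this bound [line_sup]
    inherits integrability from the seminorm of [f]. *)
Lemma line_sup_le a : 0 < a ->
  (line_sup a <= ereal_sup [set (cabs (cderiv f (a +i* b)%C))%:E | b in [set: R]])%E.
Proof.
move=> a0; rewrite line_supE; apply: ge_ereal_sup => _ [n _ <-].
set H := ereal_sup _.
have H_ge b : ((cabs (cderiv f (a +i* b)%C))%:E <= H)%E.
  by apply: ereal_sup_ubound; exists b.
have H0 : (0 <= H)%E by apply: le_trans (H_ge 0); rewrite lee_fin cabs_ge0.
rewrite /quotient; case: unpickle => // -[p q]; case: ifPn => // pq.
move: H H_ge H0 => [M| |]// H_ge _; last by rewrite leey.
have {}H_ge b : cabs (cderiv f (a +i* b)%C) <= M by rewrite -lee_fin.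
have df b : cdiff f (a +i* b)%C (cderiv f (a +i* b)%C) by exact: holf_cdiff.
have pqR : ratr p != ratr q :> R by rewrite fmorph_eq.
rewrite lee_fin ler_pdivrMr ?normr_gt0 ?subr_eq0//.
have [lt|gt|e] := ltgtP (ratr p : R) (ratr q).
- rewrite cabsB ltr0_norm ?subr_lt0// opprB; exact: vertical_mean_value.
- rewrite gtr0_norm ?subr_gt0//; exact: vertical_mean_value.
- by rewrite e eqxx in pqR.
Qed.

Lemma measurable_line_sup : measurable_fun (`]0%R, +oo[%classic : set R) line_sup.
Proof.
apply: measurable_fun_esups => n; apply/measurable_EFinP.
case: (unpickle n) => [[p q]|]; last exact: measurable_cst.
case: (p == q); first exact: measurable_cst.
apply: measurable_funM; last exact: measurable_cst.
apply: open_continuous_measurable_fun; first exact: interval_open.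
move=> a; rewrite inE/= in_itv/= andbT => a0.
apply/cvgrPdist_lt => e e0.
have e2 : 0 < e / 2 by rewrite divr_gt0.
have [d1 d10 h1] := cdiff_continuous (holf_cdiff (z := (a +i* ratr p)%C) a0) e2.
have [d2 d20 h2] := cdiff_continuous (holf_cdiff (z := (a +i* ratr q)%C) a0) e2.
near=> b.
have b1 : cabs (b - a)%:C%C < d1.
  by rewrite cabs_real; near: b; apply: cvgr_distC_lt => //; exact: cvg_id.
have b2 : cabs (b - a)%:C%C < d2.
  by rewrite cabs_real; near: b; apply: cvgr_distC_lt => //; exact: cvg_id.
have := h1 _ b1; have := h2 _ b2.
have sh (r : R) : (a +i* r)%C + (b - a)%:C%C = (b +i* r)%C.
  by apply: complex_eq => /=; ring.
rewrite !sh; set u := f (b +i* ratr p)%C; set v := f (b +i* ratr q)%C.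
set u' := f (a +i* ratr p)%C; set v' := f (a +i* ratr q)%C => hv hu.
have tri (x y : R[i]) : `|cabs x - cabs y| <= cabs (x - y).
  have := cabsD (x - y) y; have := cabsD (y - x) x; rewrite !subrK (cabsB y).
  by rewrite ler_norml; lra.
apply: le_lt_trans (tri _ _) _.
have -> : u' - v' - (u - v) = (v - v') - (u - u') by ring.
by apply: le_lt_trans (cabsD _ _) _; rewrite cabsN; lra.
Unshelve. all: by end_near. Qed.

End majorant.

(** * Norm estimate for the functional calculus *)

Section calculus_bound.
Variables (R : realType) (X : completeNormedModType R[i]).
Variables (D : set X) (A : X -> X) (Res : R[i] -> X -> X).
Hypothesis resA : resolvent_right D A Res.
Local Notation mu := (@lebesgue_measure R).
Local Notation halfline := (`]0%R, +oo[%classic : set R).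
Variable K : R.
Hypothesis K0 : 0 < K.
Hypothesis HK : forall (a : R) phi c x, 0 < a -> dual_bound phi c ->
  (\int[mu]_b (cabs (phi (Res (a +i* b)%C (Res (a +i* b)%C x))))%:E
    <= (K / (a + 1) * c * rnorm x)%:E)%E.

Lemma measurable_ratio (t : R) : 0 < t ->
  measurable_fun halfline (fun a : R => (a / (a + t))%:E).
Proof.
move=> t0; apply/measurable_EFinP; apply: open_continuous_measurable_fun.
  exact: interval_open.
move=> a; rewrite inE/= in_itv/= andbT => a0.
apply: cvgM; first exact: cvg_id.
apply: cvgV; first by rewrite lt0r_neq0// addr_gt0.
by apply: cvgD; [exact: cvg_id|exact: cvg_cst].
Qed.

(** The constant is [2/pi] from the formula times one factor 2 for each of the two complex
    integrals. The factor [a] of the formula meets the decay [K / (a + 1)] and leaves the weight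
    [a / (a + 1)]. *)
Lemma Bcalc_le (g : R[i] -> R[i]) (T : X -> X) (H : R -> \bar R) (C : R) (x : X) :
  measurable_fun halfline H -> (forall a, 0 < a -> (0 <= H a)%E) ->
  (forall a b, 0 < a -> ((cabs (cderiv g (a +i* b)%C))%:E <= H a)%E) ->
  (\int[mu]_(a in halfline) ((a / (a + 1))%:E * H a) <= C%:E)%E ->
  Bcalc_rep Res g T -> lim_Re_infty g 0 ->
  rnorm (T x) <= 8 / pi * K * C * rnorm x.
Proof.
move=> mH H0 gH HC [L [gL rep]] g0.
have {gL}L0 : L = 0 by exact: lim_Re_infty_unique gL g0.
have C0 : 0 <= C.
  rewrite -lee_fin; apply: le_trans HC; apply: integral_ge0 => a.
  rewrite /= in_itv/= andbT => a0; rewrite mule_ge0 ?H0// lee_fin.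
  by rewrite divr_ge0 ?addr_ge0 ?ltW.
have pi0 : 0 < pi :> R by exact: pi_gt0.
(* Replacing [|x|] by a strictly larger [n] keeps the dominating function infinite wherever [H] is:
   with [|x| = 0] the convention [0 * oo = 0] would destroy the pointwise domination. *)
suff key n : rnorm x < n -> rnorm (T x) <= 8 / pi * K * C * n.
  have q : 0 <= 8 / pi * K * C.
    by apply: mulr_ge0 => //; apply: mulr_ge0; [rewrite divr_ge0// ltW|exact: ltW].
  apply: le_eps => e e0; set k := 8 / pi * K * C in key q *.
  have k1 : 0 < k + 1 by lra.
  have := key (rnorm x + e / (k + 1)); rewrite ltrDl divr_gt0// => /(_ isT).
  move=> /le_trans; apply; rewrite mulrDr lerD2l mulrCA -[leRHS]mulr1.
  rewrite ler_wpM2l ?(ltW e0)// ler_pdivrMr//; lra.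
move=> xn; have n0 : 0 < n by apply: le_lt_trans xn; exact: rnorm_ge0.
apply: rnorm_le_dual => phi dphi phi1.
have dc : dual_bound phi 1.
  by split => //; [case: dphi|move=> u; rewrite mul1r].
rewrite rep// L0 mul0r sub0r cabsN cabsM cabs_real ger0_norm; last first.
  by rewrite divr_ge0// ltW.
have inner a : 0 < a -> ((cabs (a%:C%C * Cint [set: R] (fun b =>
      phi (Res (a -i* b)%C (Res (a -i* b)%C x)) * cderiv g (a +i* b)%C)))%:E <=
    (2 * K * n)%:E * ((a / (a + 1))%:E * H a))%E.
  move=> a0; have a1 : 0 < a + 1 by lra.
  have := H0 a a0; have := gH a ^~ a0.
  case: (H a) => [r| |]// gr r0; last first.
    rewrite gt0_muley ?lte_fin ?divr_gt0// gt0_muley ?leey//.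
    by rewrite lte_fin !mulr_gt0.
  have mphi : measurable_fun [set: R]
      (fun b : R => (cabs (phi (Res (a +i* b)%C (Res (a +i* b)%C x))))%:E).
    apply/measurable_EFinP; apply: measurable_cabs.
    exact: (cmeasurable_iter_res resA 2).
  have ibound : (\int[mu]_b (r%:E *
      (cabs (phi (Res (a -i* b)%C (Res (a -i* b)%C x))))%:E) <= (r * (K / (a + 1) * n))%:E)%E.
    (* The formula has the resolvent at [a - ib], the hypothesis at [a + ib]; reflection exchanges
       them. *)
    have -> : (\int[mu]_b (r%:E *
        (cabs (phi (Res (a -i* b)%C (Res (a -i* b)%C x))))%:E) =
       \int[mu]_b (r%:E * (cabs (phi (Res (a +i* b)%C (Res (a +i* b)%C x))))%:E))%E.
      apply: (@ge0_integral_opp R (fun b => (r%:E *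
        (cabs (phi (Res (a +i* b)%C (Res (a +i* b)%C x))))%:E)%E)).
        exact: measurable_funeM.
      by move=> b; rewrite mule_ge0// lee_fin cabs_ge0.
    rewrite ge0_integralZl_EFin//; last by move=> b _; rewrite lee_fin cabs_ge0.
    rewrite EFinM lee_wpmul2l//; apply: le_trans (HK x a0 dc) _.
    by rewrite mulr1 lee_fin ler_wpM2l ?ltW// divr_gt0.
  rewrite -!EFinM lee_fin cabsM cabs_real (gtr0_norm a0).
  rewrite (_ : 2 * K * n * (a / (a + 1) * r) = a * (2 * (r * (K / (a + 1) * n)))); last first.
    by field; rewrite lt0r_neq0.
  rewrite ler_wpM2l ?(ltW a0)//.
  apply: (Cint_le _ ibound) => b _; rewrite -EFinM lee_fin cabsM mulrC.
  by rewrite ler_wpM2r ?cabs_ge0// -lee_fin gr.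
apply: (@le_trans _ _ (2 / pi * (2 * (2 * K * n * C)))); last first.
  by apply: eq_ler; ring.
rewrite ler_wpM2l ?divr_ge0 ?(ltW pi0)//.
apply: (@Cint_le R halfline _
  (fun a => ((2 * K * n)%:E * ((a / (a + 1))%:E * H a))%E)).
- by move=> a; rewrite /= in_itv/= andbT; exact: inner.
- rewrite ge0_integralZl_EFin//.
  + by rewrite [leRHS]EFinM lee_wpmul2l// lee_fin !mulr_ge0// ltW.
  + move=> a; rewrite /= in_itv/= andbT => a0; rewrite mule_ge0 ?H0// lee_fin.
    by rewrite divr_ge0 ?addr_ge0 ?ltW.
  + by apply: emeasurable_funM => //; exact: measurable_ratio.
  + by rewrite !mulr_ge0// ltW.
Qed.

End calculus_bound.

(** * Vanishing of the weighted integral of the majorant *)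

Section vanishing.
Variables (R : realType) (H : R -> \bar R).
Local Notation mu := (@lebesgue_measure R).
Local Notation halfline := (`]0%R, +oo[%classic : set R).
Hypothesis mH : measurable_fun halfline H.
Hypothesis H0 : forall a, (0 <= H a)%E.
Hypothesis Hfin : (\int[mu]_(a in halfline) H a < +oo)%E.

Lemma tail_integral (e : R) : 0 < e -> exists2 N : R, 0 < N &
  (\int[mu]_(a in `]N, +oo[) H a <= e%:E)%E.
Proof.
move=> e0; pose F (n : nat) : set R := `]0, n%:R]%classic.
have mF n : measurable_fun (F n) H.
  apply: measurable_funS mH => // a.
  by rewrite /F /= !in_itv/= andbT => /andP[].
have cvgF : (\int[mu]_(a in F n) H a @[n --> \oo] --> \int[mu]_(a in \bigcup_n F n) H a)%E.
  apply: ge0_nondecreasing_set_cvg_integral => //.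
  - move=> m n mn; apply/subsetPset => a; rewrite /F /= !in_itv/= => /andP[-> /=].
    by move=> /le_trans; apply; rewrite ler_nat.
  - by move=> n; exact: measurable_itv.
have UF : \bigcup_n F n = halfline.
  apply/seteqP; split => a.
    by move=> [n _]; rewrite /F /= !in_itv/= andbT => /andP[].
  rewrite /= in_itv/= andbT => a0; exists (Num.trunc a).+1 => //.
  by rewrite /F /= in_itv/= a0 ltW// truncnS_gt.
rewrite UF in cvgF.
have Hf := Hfin; set I := (\int[mu]_(a in halfline) H a)%E in cvgF Hf.
have I0 : (0 <= I)%E by exact: integral_ge0.
have Ifin : I \is a fin_num by rewrite ge0_fin_numE.
have /fine_cvg/cvgrPdist_lt/(_ _ e0)[n0 _ hn] :
    (\int[mu]_(a in F n) H a @[n --> \oo] --> (fine I)%:E)%E by rewrite fineK.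
exists n0.+1%:R => //; have := hn n0.+1 (leqnSn n0); set n := n0.+1 => {}hn.
have split : I = (\int[mu]_(a in F n) H a + \int[mu]_(a in `]n%:R, +oo[) H a)%E.
  have eU : F n `|` `]n%:R, +oo[%classic = halfline.
    apply/seteqP; split => a; rewrite /F /= !in_itv/= !andbT.
      by move=> [/andP[]//|]; apply: le_lt_trans.
    by move=> ->/=; case: (leP a n%:R) => h; [left|right].
  rewrite /I -eU ge0_integral_setU//.
  - exact: measurable_itv.
  - by rewrite eU.
  - apply/disj_setPS => a [] /=; rewrite !in_itv/= andbT => /andP[_ h1] h2.
    by move: (lt_le_trans h2 h1); rewrite ltxx.
have key (i f t : \bar R) : (0 <= f -> 0 <= t -> i \is a fin_num -> i = f + t)%E ->
    (0 <= f)%E -> (0 <= t)%E -> i \is a fin_num -> `|fine i - fine f| < e -> (t <= e%:E)%E.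
  move: i f t => [i| |] [f| |] [t| |]// eq f0 t0 _; have := eq f0 t0 isT; rewrite ?addey ?addye// => -[->].
  rewrite /= lee_fin => h; apply: ltW; apply: le_lt_trans h.
  by rewrite addrAC subrr add0r ler_norm.
by apply: (key I _ _ (fun _ _ _ => split)) => //; exact: integral_ge0.
Qed.

(** Split at an [N] beyond which [H] has integral at most [e/2]: there the ratio is at most 1, and
    below [N] it is at most [N / t], which contributes less than [e/2] once [t >= 2N(I + 1)/e]. *)
Lemma integral_ratio_vanish (e : R) : 0 < e -> exists2 t0 : R, 0 < t0 &
  forall t, t0 <= t ->
    (\int[mu]_(a in halfline) ((a / (a + t))%:E * H a) <= e%:E)%E.
Proof.
move=> e0; have [N N0 hN] := @tail_integral (e / 2) ltac:(by rewrite divr_gt0).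
have Hf := Hfin; set I := (\int[mu]_(a in halfline) H a)%E in Hf.
have I0 : (0 <= I)%E by exact: integral_ge0.
have Ifin : I \is a fin_num by rewrite ge0_fin_numE.
have i0 : 0 <= fine I by exact: fine_ge0.
exists (2 * N * (fine I + 1) / e); first by rewrite !mulr_gt0 ?invr_gt0//; lra.
move=> t tt; have t0 : 0 < t.
  by apply: lt_le_trans tt; rewrite !mulr_gt0 ?invr_gt0//; lra.
pose HN := H \_ (`]N, +oo[%classic : set R).
have mHN : measurable_fun halfline HN.
  apply: (measurable_restrict (D := `]N, +oo[%classic) H _ _).1 => //.
  by apply: measurable_funS mH => //; exact: subIsetl.
have HN0 a : (0 <= HN a)%E by rewrite /HN /patch; case: ifP.
apply: (@le_trans _ _ (\int[mu]_(a in halfline) ((N / t)%:E * H a + HN a))%E).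
  apply: ge0_le_lower_integral => a; rewrite /= in_itv/= andbT => a0.
    by rewrite mule_ge0// lee_fin divr_ge0 ?addr_ge0 ?ltW.
  have [aN|Na] := leP a N.
    apply: (@le_trans _ _ ((N / t)%:E * H a)%E); last by rewrite leeDl.
    rewrite lee_wpmul2r// lee_fin ler_pdivrMr ?addr_gt0// mulrAC ler_pdivlMr//.
    by have := mulr_ge0 (ltW N0) (ltW a0); nra.
  apply: (@le_trans _ _ (HN a)); last first.
    by rewrite leeDr// mule_ge0// lee_fin divr_ge0 ?ltW.
  rewrite /HN /patch mem_set; last by rewrite /= in_itv/= Na.
  rewrite -[leRHS]mul1e lee_wpmul2r// lee_fin ler_pdivrMr ?addr_gt0//; lra.
rewrite ge0_integralD//; last 2 first.
- by move=> a _; rewrite mule_ge0// lee_fin divr_ge0 ?ltW.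
- exact: measurable_funeM.
rewrite ge0_integralZl_EFin//; last by rewrite divr_ge0 ?ltW.
rewrite -integral_mkcondr (_ : halfline `&` _ = `]N, +oo[%classic); last first.
  apply/seteqP; split => a; rewrite /= !in_itv/= !andbT; first by case.
  by move=> Na; split => //; exact: lt_trans Na.
rewrite (_ : e = e / 2 + e / 2); last by field.
rewrite EFinD; apply: leeD => //.
rewrite -/I -(fineK Ifin) -EFinM lee_fin mulrAC ler_pdivrMr//.
move: tt; rewrite ler_pdivrMr// => tt; nra.
Qed.

(** The substitution [s = ta], carried out on the whole line after extension by zero. *)
Lemma integral_ratio_scale (t : R) : 0 < t ->
  (\int[mu]_(a in halfline) ((a / (a + 1))%:E * (t%:E * H (t * a)%R)) =
   \int[mu]_(a in halfline) ((a / (a + t))%:E * H a))%E.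
Proof.
move=> t0; pose k := (fun s => ((s / (s + t))%:E * H s)%E) \_ halfline.
have k0 s : (0 <= k s)%E.
  rewrite /k /patch; case: ifPn => //; rewrite inE/= in_itv/= andbT => s0.
  by rewrite mule_ge0// lee_fin divr_ge0 ?addr_ge0 ?ltW.
have mk : measurable_fun [set: R] k.
  apply/(measurable_restrictT _ _).1; first exact: measurable_itv.
  by apply: emeasurable_funM => //; exact: measurable_ratio.
rewrite [RHS]integral_mkcond -/k (ge0_integral_affine 0 t0 mk k0).
rewrite -ge0_integralZl_EFin//; last 2 first.
- by apply: (measurableT_comp mk); exact: measurable_affine.
- exact: ltW.
rewrite [LHS]integral_mkcond; apply: eq_integral => a _.
rewrite /k /patch addr0.
have -> : (t * a \in halfline) = (a \in halfline).
  by apply/idP/idP; rewrite !inE/= !in_itv/= !andbT pmulr_rgt0.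
case: ifPn; last by rewrite mule0.
rewrite inE/= in_itv/= andbT => a0.
rewrite muleCA; congr (_ * (_%:E * _))%E; field.
by apply/andP; split; rewrite lt0r_neq0 ?addr_gt0 ?mulr_gt0.
Qed.

End vanishing.

(** * Decay of [f(tA)] *)

Section stability.
Variables (R : realType) (X : completeNormedModType R[i]).
Variables (D : set X) (A : X -> X) (Res : R[i] -> X -> X).
Hypothesis resA : resolvent_right D A Res.
Local Notation mu := (@lebesgue_measure R).
Local Notation halfline := (`]0%R, +oo[%classic : set R).
Variable K : R.
Hypothesis K0 : 0 < K.
Hypothesis HK : forall (a : R) phi c x, 0 < a -> dual_bound phi c ->
  (\int[mu]_b (cabs (phi (Res (a +i* b)%C (Res (a +i* b)%C x))))%:E
    <= (K / (a + 1) * c * rnorm x)%:E)%E.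

Lemma lim_Re_infty_dilate f (t : R) : 0 < t -> lim_Re_infty f 0 ->
  lim_Re_infty (dilate t f) (0 : R[i]).
Proof.
move=> t0 f0 e /f0[a ha]; exists (a / t) => z; rewrite ltr_pdivrMr// => az.
by apply: ha; rewrite ReCM mulrC.
Qed.

(** The dilate has derivative [t f'(tz)], so [t H(ta)] is a majorant for it, and rescaling turns the
    weight [a / (a + 1)] into [a / (a + t)]. *)
Lemma Bcalc_vanish f (T : R -> X -> X) : classB0 f ->
  (forall t, 0 < t -> Bcalc_rep Res (dilate t f) (T t)) ->
  forall eps : R, 0 < eps -> exists t0 : R, forall t : R, t0 <= t ->
    forall x : X, rnorm (T t x) <= eps * rnorm x.
Proof.
move=> [[holf [_ Bf]] f0] rep eps eps0.
pose H := line_sup f.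
have mH := measurable_line_sup holf.
have H0 := line_sup_ge0 f.
have Hfin : (\int[mu]_(a in halfline) H a < +oo)%E.
  apply: le_lt_trans Bf; apply: ge0_le_lower_integral => a //.
  by rewrite /= in_itv/= andbT => a0; exact: line_sup_le.
have pi0 : 0 < pi :> R by exact: pi_gt0.
have k0 : 0 < 8 / pi * K by rewrite !mulr_gt0 ?invr_gt0.
have [t0 t00 ht0] := integral_ratio_vanish mH H0 Hfin (divr_gt0 eps0 k0).
exists t0 => t /[dup] tt /ht0 Ht x; have tp : 0 < t by exact: lt_le_trans tt.
have -> : eps = 8 / pi * K * (eps / (8 / pi * K)) by rewrite mulrC divfK// lt0r_neq0.
apply: (Bcalc_le resA K0 HK (g := dilate t f) (H := fun a => (t%:E * H (t * a)%R)%E)).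
- apply: measurable_funeM.
  apply: (@measurable_comp _ _ _ _ _ _ halfline H _ (fun a : R => t * a)) => //.
  + by move=> _ [a a0 <-]; move: a0; rewrite /= !in_itv/= !andbT => a0; rewrite mulr_gt0.
  + exact: measurable_funM.
- by move=> a a0; rewrite mule_ge0// lee_fin ltW.
- move=> a b a0.
  have tz : t%:C%C * (a +i* b)%C = (t * a +i* (t * b))%C by apply: complex_eq => /=; ring.
  have z0 : 0 < complex.Re (t%:C%C * (a +i* b)%C) by rewrite ReCM mulr_gt0.
  have df := derivable_cdiff (holf _ z0).
  have [_ ->] := cdiff_derivable (cdiff_dilate tp df).
  rewrite cabsM cabs_real gtr0_norm// EFinM tz.
  apply: lee_wpmul2l; first by rewrite lee_fin ltW.
  exact: (cderiv_le_line_sup holf (t * b) (mulr_gt0 tp a0)).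
- by rewrite integral_ratio_scale.
- exact: rep.
- exact: lim_Re_infty_dilate.
Qed.

End stability.

(** * The complex exponential and its second-order remainder *)

Section complex_exponential.
Variable R : realType.
Implicit Types (x y t : R) (z w : R[i]).

Definition cexp w : R[i] :=
  (expR (complex.Re w))%:C%C * (cos (complex.Im w) +i* sin (complex.Im w))%C.

Lemma cexpD w z : cexp (w + z) = cexp w * cexp z.
Proof.
rewrite /cexp ReD ImD expRD cosD sinD; apply: complex_eq => /=; ring.
Qed.

Lemma cexp0 : cexp 0 = 1.
Proof. by rewrite /cexp /= expR0 cos0 sin0; apply: complex_eq => /=; ring. Qed.

Lemma cexp_real (r : R) : cexp r%:C%C = (expR r)%:C%C.
Proof. by rewrite /cexp /= cos0 sin0; apply: complex_eq => /=; ring. Qed.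

Lemma cabs_cexp w : cabs (cexp w) = expR (complex.Re w).
Proof.
rewrite cabsM cabs_real ger0_norm ?expR_ge0// cabsE/= cos2Dsin2 sqrtr1.
by rewrite mulr1.
Qed.

Lemma cexp_negE t z : cexp_neg t z = cexp (- t%:C%C * z).
Proof.
rewrite /cexp_neg /cexp.
have -> : complex.Re (- t%:C%C * z) = - t * complex.Re z by rewrite mulNr ReN ReCM mulNr.
have -> : complex.Im (- t%:C%C * z) = - (t * complex.Im z) by rewrite mulNr ImN ImCM.
rewrite cosN sinN.
by apply: complex_eq => /=; ring.
Qed.

Lemma lim_cexp_neg (t : R) : 0 < t -> lim_Re_infty (cexp_neg t) 0.
Proof.
move=> t0 e e0; exists (e^-1 / t) => z; rewrite ltr_pdivrMr// mulrC => hz.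
rewrite subr0 cexp_negE cabs_cexp mulNr ReN ReCM expRN -[ltRHS]invrK.
rewrite ltf_pV2 ?posrE ?invr_gt0 ?expR_gt0//.
by have := expR_ge1Dx (t * complex.Re z); lra.
Qed.

Lemma normr_sin_le x : `|sin x| <= `|x|.
Proof.
wlog x0 : x / 0 <= x.
  move=> h; have [/h//|/ltW x0] := leP 0 x.
  by rewrite -(normrN x) -(normrN (sin x)) -sinN h// oppr_ge0.
have [|c _] := @MVT_segment R sin cos 0 x x0 (fun x _ => is_derive_sin x).
  by apply: continuous_subspaceT; exact: continuous_sin.
rewrite sin0 !subr0 => ->; rewrite normrM -[leRHS]mul1r ler_wpM2r//.
exact: cos_max.
Qed.

(** From [1 - cos x = 2 sin(x/2)^2]. *)
Lemma cos_lower x : 1 - cos x <= x ^+ 2 / 2.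
Proof.
have := cos_mulr2n (x / 2).
rewrite (_ : x / 2 *+ 2 = x); last by rewrite -mulr_natr divfK.
have := sin2cos2 (x / 2); have := normr_sin_le (x / 2).
rewrite -(ler_pXn2r (n := 2))// ?nnegrE// !real_normK ?num_real//.
by rewrite exprMn; lra.
Qed.

Lemma cos_lower1 x : 1 - cos x <= `|x|.
Proof.
have h := cos_lower x; have := cos_geN1 x.
have [x1|x1] := leP `|x| 2; last by lra.
move=> _; apply: le_trans h _; rewrite -real_normK ?num_real//.
by have := normr_ge0 x; nra.
Qed.

Lemma sin_sub_le x : `|sin x - x| <= x ^+ 2.
Proof.
wlog x0 : x / 0 <= x.
  move=> h; have [/h//|/ltW x0] := leP 0 x.
  have -> : sin x - x = - (sin (- x) - - x) by rewrite sinN; ring.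
  by rewrite normrN -(sqrrN x) h// oppr_ge0.
have [|c] := @MVT_segment R (fun x => sin x - x) (fun x => cos x - 1) 0 x x0.
  apply: continuous_subspaceT => y; apply: continuousB => //; exact: continuous_sin.
rewrite in_itv/= sin0 !subr0 => /andP[c0 cx] ->.
rewrite normrM (ger0_norm x0) expr2 ler_wpM2r// distrC ger0_norm.
  by apply: le_trans (cos_lower1 c) _; rewrite ger0_norm.
by rewrite subr_ge0 cos_le1.
Qed.

(** The upper bound comes from [e^x (1 - x) <= e^x e^{-x} = 1]. *)
Lemma expR_quadratic x : `|x| <= 2^-1 -> 0 <= expR x - 1 - x <= 2 * x ^+ 2.
Proof.
rewrite ler_norml => /andP[x1 x2]; have h1 := expR_ge1Dx x.
have h2 := expR_ge1Dx (- x); have e0 := expR_gt0 x.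
have e1 : expR x * expR (- x) = 1 by rewrite -expRD subrr expR0.
apply/andP; split; first by lra.
have : expR x * (1 - x) <= expR x * expR (- x) by rewrite ler_wpM2l ?(ltW e0).
rewrite e1; nra.
Qed.

(** No restriction on [w]: on vertical lines [Im w] is unbounded, while the factor [exp |Re w|]
    stays fixed, so the estimate can be integrated. *)
Lemma cexp_quadratic w :
  cabs (cexp w - 1 - w) <= 10 * expR `|complex.Re w| * cabs w ^+ 2.
Proof.
set x := complex.Re w; set y := complex.Im w.
have e1 : 1 <= expR `|x| by rewrite -expR0 ler_expR.
have s0 := sqr_ge0 (cabs w).
(* Away from the imaginary axis [|w| > 1/2], and the trivial bound [exp |x| + 1 + |w|] is absorbed
   by [|w|^2]. Near it the real expansions of [exp], [cos] and [sin] are combined. *)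
have [x1|x1] := leP `|x| 2^-1; last first.
  have w1 : 2^-1 < cabs w by apply: lt_le_trans (cabs_Re w).
  apply: (@le_trans _ _ (expR `|x| + 1 + cabs w)).
    apply: le_trans (cabsD _ _) _; rewrite cabsN lerD2r.
    apply: le_trans (cabsD _ _) _; rewrite cabsN cabs1 lerD2r cabs_cexp.
    by rewrite ler_expR ler_norm.
  have c1 : 1 <= 4 * cabs w ^+ 2 by nra.
  have c2 : cabs w <= 2 * cabs w ^+ 2 by nra.
  have c3 : expR `|x| * 1 <= expR `|x| * (4 * cabs w ^+ 2) by rewrite ler_wpM2l ?expR_ge0.
  have c4 : 1 * cabs w ^+ 2 <= expR `|x| * cabs w ^+ 2 by rewrite ler_wpM2r.
  lra.
apply: (@le_trans _ _ (10 * cabs w ^+ 2)); last by nra.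
apply: le_trans (cabs_le_ReIm _) _.
rewrite !(ReD, ImD, ReN, ImN, ReM, ImM)/= -/x -/y !mul0r subr0 addr0 cabs_sqr -/x -/y.
have /andP[h1 h2] := expR_quadratic x1.
have h3 := cos_lower y; have h4 := cos_le1 y; have h5 := sin_sub_le y.
have h6 := normr_sin_le y; have ex0 := expR_gt0 x.
move: x1; rewrite ler_norml => /andP[x1 x2].
have ex2 : expR x <= 2 by nra.
have a1 : `|expR x * cos y - 1 - x| <= 2 * x ^+ 2 + y ^+ 2.
  by rewrite ler_norml; apply/andP; split; nra.
have a2 : `|expR x * sin y - 0 - y| <= 2 * x ^+ 2 + 3 * y ^+ 2.
  rewrite (_ : expR x * sin y - 0 - y = (expR x - 1) * sin y + (sin y - y)); last by ring.
  apply: le_trans (ler_normD _ _) _; rewrite normrM.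
  have h7 : `|expR x - 1| <= 2 * `|x|.
    have xx : x ^+ 2 <= `|x| * 2^-1.
      rewrite -real_normK ?num_real// expr2 ler_wpM2l//.
      by rewrite ler_norml; apply/andP.
    by have := ler_norm x; have := ler_norm (- x); rewrite normrN ler_norml; lra.
  have h8 : `|expR x - 1| * `|sin y| <= 2 * `|x| * `|y| by rewrite ler_pM.
  have := sqr_ge0 (`|x| - `|y|); rewrite -(real_normK (num_real x)) -(real_normK (num_real y)).
  move: h5; rewrite -(real_normK (num_real y)); nra.
by nra.
Qed.

Lemma cdiff_cexp_neg t z : cdiff (cexp_neg t) z (- t%:C%C * cexp_neg t z).
Proof.
move=> e e0.
pose M := expR (- t * complex.Re z) * (10 * expR `|t| * t ^+ 2) + 1.
have M0 : 0 < M.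
  apply: ltr_wpDl => //; apply: mulr_ge0; first exact: expR_ge0.
  by apply: mulr_ge0; [apply: mulr_ge0 => //; exact: expR_ge0|exact: sqr_ge0].
exists (Num.min 1 (e / M)); first by rewrite lt_min ltr01 divr_gt0.
move=> h; rewrite lt_min => /andP[h1 he].
rewrite !cexp_negE mulrDr cexpD.
set E := cexp (- t%:C%C * z).
have -> : E * cexp (- t%:C%C * h) - E - h * (- t%:C%C * E) =
  E * (cexp (- t%:C%C * h) - 1 - (- t%:C%C * h)) by ring.
have ct : cabs (- t%:C%C * h) = `|t| * cabs h by rewrite cabsM cabsN cabs_real.
rewrite cabsM cabs_cexp.
have -> : complex.Re (- t%:C%C * z) = - t * complex.Re z.
  by rewrite mulNr ReN ReCM mulNr.
have q := cexp_quadratic (- t%:C%C * h); rewrite ct in q.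
have r : expR `|complex.Re (- t%:C%C * h)| <= expR `|t|.
  rewrite ler_expR; apply: le_trans (cabs_Re _) _; rewrite ct.
  by rewrite -[leRHS]mulr1 ler_wpM2l// ltW.
have h0 := cabs_ge0 h.
have q' : cabs (cexp (- t%:C%C * h) - 1 - - t%:C%C * h) <=
    10 * expR `|t| * t ^+ 2 * cabs h ^+ 2.
  apply: le_trans q _; rewrite exprMn real_normK ?num_real// mulrA ler_wpM2r ?sqr_ge0//.
  by rewrite ler_wpM2r ?sqr_ge0// ler_wpM2l.
apply: le_trans (ler_wpM2l (expR_ge0 _) q') _.
move: he; rewrite ltr_pdivlMr// => he.
apply: (@le_trans _ _ (cabs h * M * cabs h)); last by rewrite ler_wpM2r ?cabs_ge0// ltW.
rewrite (_ : _ * (_ * cabs h ^+ 2) = (M - 1) * (cabs h * cabs h)); last by rewrite /M; ring.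
by have := mulr_ge0 h0 h0; lra.
Qed.

End complex_exponential.

(** * Integrals dominated by [1/(a^2 + b^2)] on a vertical line *)

Section line_integrals.
Variable R : realType.
Local Notation mu := (@lebesgue_measure R).
Implicit Type g : R -> R[i].

Lemma measurable_line_weight (a : R) : 0 < a ->
  measurable_fun [set: R] (fun b : R => (a ^+ 2 + b ^+ 2)^-1).
Proof.
move=> a0; apply: continuous_measurable_fun => b; apply: cvgV.
  by rewrite lt0r_neq0// ltr_pwDl// ?sqr_ge0// exprn_gt0.
by apply: cvgD; [exact: cvg_cst|exact: exprn_continuous].
Qed.

Lemma integral_line_weight (a C : R) : 0 < a -> 0 <= C ->
  (\int[mu]_b (C * (a ^+ 2 + b ^+ 2)^-1)%:E = (C * pi / a)%:E)%E.
Proof.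
move=> a0 C0.
have w0 b : 0 <= (a ^+ 2 + b ^+ 2)^-1 by rewrite invr_ge0 addr_ge0 ?sqr_ge0.
have mf : measurable_fun [set: R] (fun b : R => (C * (a ^+ 2 + b ^+ 2)^-1)%:E).
  by apply/measurable_EFinP; apply: measurable_funM => //; exact: measurable_line_weight.
rewrite (ge0_integral_affine 0 a0 mf); last by move=> b; rewrite lee_fin mulr_ge0.
have -> : (\int[mu]_b (C * (a ^+ 2 + (a * b + 0) ^+ 2)^-1)%:E =
    \int[mu]_b (C / a ^+ 2 * (oneDsqr b)^-1)%:E)%E.
  apply: eq_integral => b _; congr EFin; rewrite /oneDsqr; field.
  apply/and3P; split; rewrite lt0r_neq0// ltr_pwDl ?sqr_ge0//.
  by rewrite exprn_gt0.
rewrite integralZ_oneDsqrV ?divr_ge0 ?sqr_ge0// -EFinM; congr EFin.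
by field; rewrite lt0r_neq0.
Qed.

Lemma line_bound_ge0 g (a C : R) : 0 < a ->
  (forall b, cabs (g b) <= C * (a ^+ 2 + b ^+ 2)^-1) -> 0 <= C.
Proof.
move=> a0 /(_ 0); rewrite expr0n addr0 => /(le_trans (cabs_ge0 _)).
by rewrite pmulr_lge0// invr_gt0 exprn_gt0.
Qed.

Lemma cintegrable_line g (a C : R) : 0 < a -> cmeasurable g ->
  (forall b, cabs (g b) <= C * (a ^+ 2 + b ^+ 2)^-1) -> cintegrable setT g.
Proof.
move=> a0 [mr mi] gC; have C0 := line_bound_ge0 a0 gC.
have w0 b : 0 <= C * (a ^+ 2 + b ^+ 2)^-1.
  by rewrite mulr_ge0// invr_ge0 addr_ge0 ?sqr_ge0.
have iw : mu.-integrable setT (fun b => (C * (a ^+ 2 + b ^+ 2)^-1)%:E).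
  apply/integrableP; split.
    by apply/measurable_EFinP/measurable_funM => //; exact: measurable_line_weight.
  under eq_integral do rewrite gee0_abs ?lee_fin//.
  by rewrite integral_line_weight// ltry.
split; apply: le_integrable iw => //; try exact/measurable_EFinP.
- move=> b _; rewrite !abse_EFin lee_fin (ger0_norm (w0 _)).
  by apply: le_trans (gC b); exact: cabs_Re.
- move=> b _; rewrite !abse_EFin lee_fin (ger0_norm (w0 _)).
  by apply: le_trans (gC b); exact: cabs_Im.
Qed.

(** The factor [1/a] lets an integral that does not depend on the line be shown to vanish by moving
    the line to infinity. *)
Lemma Cint_line_le g (a C : R) : 0 < a ->
  (forall b, cabs (g b) <= C * (a ^+ 2 + b ^+ 2)^-1) ->
  cabs (Cint setT g) <= 2 * (C * pi / a).
Proof.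
move=> a0 gC; have C0 := line_bound_ge0 a0 gC.
apply: (@Cint_le _ _ _ (fun b => (C * (a ^+ 2 + b ^+ 2)^-1)%:E)).
  by move=> b _; rewrite lee_fin.
by rewrite integral_line_weight.
Qed.

Lemma cintegrable_comp g (f : R -> R) : cmeasurable g -> measurable_fun setT f ->
  (forall k : R -> \bar R, measurable_fun setT k ->
    (\int[mu]_b k (f b) = \int[mu]_b k b)%E) ->
  cintegrable setT g -> cintegrable setT (fun b => g (f b)).
Proof.
move=> mg mf inv [/integrableP[mr ir] /integrableP[mi ii]].
have [mr' mi'] := cmeasurable_comp mg mf.
split; apply/integrableP; split; try exact/measurable_EFinP.
- by rewrite (inv (fun b => `|(complex.Re (g b))%:E|%E))//; exact: measurableT_comp.
- by rewrite (inv (fun b => `|(complex.Im (g b))%:E|%E))//; exact: measurableT_comp.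
Qed.

Lemma cintegrable_translate g (v : R) : cmeasurable g -> cintegrable setT g ->
  cintegrable setT (fun b => g (b + v)).
Proof.
move=> mg; apply: cintegrable_comp => //; first exact: measurable_funD.
by move=> k mk; exact: integral_translate.
Qed.

Lemma cintegrable_opp g : cmeasurable g -> cintegrable setT g ->
  cintegrable setT (fun b => g (- b)).
Proof.
move=> mg; apply: cintegrable_comp => //.
by move=> k mk; exact: integral_opp.
Qed.

Lemma Cint_scale g (u : R) : 0 < u -> cintegrable setT g -> cmeasurable g ->
  Cint setT (fun b => g (u * b)) = u^-1%:C%C * Cint setT g.
Proof.
move=> u0 [ir ii] [mr mi].
have sc (f : R -> R) : measurable_fun setT f -> mu.-integrable setT (fun b => (f b)%:E) ->
    Defs.Rint setT (fun b => f (u * b)) = u^-1 * Defs.Rint setT f.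
  move=> mf fi; rewrite /Defs.Rint /Rintegral.
  have mE : measurable_fun [set: R] (EFin \o f) by exact/measurable_EFinP.
  have P := ge0_integral_affine 0 u0 (measurable_funepos mE) (fun x => funepos_ge0 _ x).
  have N := ge0_integral_affine 0 u0 (measurable_funeneg mE) (fun x => funeneg_ge0 _ x).
  have pf := integrable_pos_fin_num measurableT fi.
  have nf := integrable_neg_fin_num measurableT fi.
  rewrite [in LHS]integralE [in RHS]integralE.
  have -> : (\int[mu]_b ((fun b => (f (u * b)%R)%:E)^\+ b) =
      \int[mu]_b ((EFin \o f)^\+ (u * b + 0)%R))%E.
    by apply: eq_integral => b _; rewrite !funeposE addr0.
  have -> : (\int[mu]_b ((fun b => (f (u * b)%R)%:E)^\- b) =
      \int[mu]_b ((EFin \o f)^\- (u * b + 0)%R))%E.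
    by apply: eq_integral => b _; rewrite !funenegE addr0.
  move: P N pf nf; rewrite -[(fun x => (f x)%:E)]/(EFin \o f) => -> ->.
  set p := (\int[mu]_b ((EFin \o f)^\+ (u * b + 0)%R))%E.
  set n := (\int[mu]_b ((EFin \o f)^\- (u * b + 0)%R))%E.
  have p0 : (0 <= p)%E by apply: integral_ge0.
  have n0 : (0 <= n)%E by apply: integral_ge0.
  move: p n p0 n0 => [p| |] [n| |]//; rewrite ?gt0_muley ?lte_fin// => _ _ _ _.
  by rewrite /=; field; rewrite lt0r_neq0.
rewrite !CintE; apply: complex_eq => /=; rewrite mul0r ?subr0 ?addr0.
- exact: (sc (fun b => complex.Re (g b))).
- exact: (sc (fun b => complex.Im (g b))).
Qed.

End line_integrals.

(** * Functions with quadratic increments are constant *)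

Section quadratic_constant.
Variables (R : realType) (V : normedModType R[i]).

(** Over [n] equal steps the increments add up to at most [n |C| (L/n)^2 = |C| L^2 / n]. *)
Lemma quadratic_constant (F : R -> V) (p q C : R) : p <= q ->
  (forall r h, p <= r -> 0 <= h -> h <= 1 -> r + h <= q ->
    rnorm (F (r + h) - F r) <= C * h ^+ 2) -> F q = F p.
Proof.
move=> pq FC; set L := q - p; have L0 : 0 <= L by rewrite /L; lra.
apply/eqP; rewrite -subr_eq0; apply/eqP/rnorm0_eq0/le_eps => e e0; rewrite add0r.
(* Exceeding [L] keeps the steps below 1; exceeding [|C| L^2 / e] brings the total below [e]. *)
pose n := (Num.trunc (L + `|C| * L ^+ 2 / e)).+1.
have nL : L + `|C| * L ^+ 2 / e < n%:R by exact: truncnS_gt.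
have B0 : 0 <= `|C| * L ^+ 2 / e by rewrite divr_ge0 ?mulr_ge0 ?sqr_ge0 ?(ltW e0).
have n0 : 0 < n%:R :> R by rewrite ltr0n.
pose h := L / n%:R.
have h0 : 0 <= h by rewrite divr_ge0// ltW.
have h1 : h <= 1 by rewrite ler_pdivrMr// mul1r; lra.
have nh : n%:R * h = L by rewrite /h mulrC divfK ?lt0r_neq0.
have step k : (k <= n)%N -> rnorm (F (p + k%:R * h) - F p) <= k%:R * (`|C| * h ^+ 2).
  elim: k => [|k ih] kn; first by rewrite !mul0r addr0 subrr rnorm0.
  have kh : k.+1%:R * h <= L by rewrite -nh ler_wpM2r// ler_nat.
  have kh0 : 0 <= k%:R * h by rewrite mulr_ge0.
  have eS : p + k%:R * h + h = p + k.+1%:R * h by rewrite -natr1; ring.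
  have := FC (p + k%:R * h) h; rewrite eS => H.
  have {}H := H ltac:(lra) h0 h1 ltac:(rewrite /L in kh; lra).
  have := rnormD (F (p + k.+1%:R * h) - F (p + k%:R * h)) (F (p + k%:R * h) - F p).
  rewrite addrA subrK => /le_trans; apply.
  have := ih (ltnW kn); have : C * h ^+ 2 <= `|C| * h ^+ 2.
    by rewrite ler_wpM2r ?sqr_ge0// ler_norm.
  have -> : k.+1%:R * (`|C| * h ^+ 2) = k%:R * (`|C| * h ^+ 2) + `|C| * h ^+ 2.
    by rewrite -natr1; ring.
  by move: H; lra.
have := step n (leqnn n); rewrite nh (_ : p + L = q); last by rewrite /L; lra.
move=> /le_trans; apply.
have -> : n%:R * (`|C| * h ^+ 2) = `|C| * L ^+ 2 / n%:R.
  by rewrite /h; field; rewrite lt0r_neq0.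
rewrite ler_pdivrMr// (mulrC e) -ler_pdivrMr//; lra.
Qed.

End quadratic_constant.

(** * Uniform second-order Taylor estimates on strips *)

Section quadratic_differentiability.
Variable R : realType.
Implicit Types (om : R[i] -> R) (H G : R[i] -> R[i]) (z h : R[i]).

(* Quadratic differentiability, uniform on the strip [a0 <= Re z <= a1] with
   respect to the weight [om]: integrating such an estimate along vertical lines
   replaces differentiation under the integral sign. *)
Definition qdiff (a0 a1 : R) om (C : R) H H' :=
  forall z, a0 <= complex.Re z <= a1 ->
    [/\ cabs (H z) <= C * om z, cabs (H' z) <= C * om z &
     forall h, cabs h <= 1 -> a0 <= complex.Re (z + h) <= a1 ->
       cabs (H (z + h) - H z - h * H' z) <= C * om z * cabs h ^+ 2].

Lemma cabsD_le (u v : R[i]) (p q : R) : cabs u <= p -> cabs v <= q -> cabs (u + v) <= p + q.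
Proof. by move=> up vq; apply: le_trans (cabsD _ _) _; exact: lerD. Qed.

Lemma cabsM_le (u v : R[i]) (p q : R) : cabs u <= p -> cabs v <= q -> cabs (u * v) <= p * q.
Proof. by move=> up vq; rewrite cabsM ler_pM ?cabs_ge0. Qed.

(** One constant bounds the function, its derivative and the remainder, so that products stay in the
    class. Expanding the product remainder gives [3 + 2d + d^2] for [d = |h| <= 1], whence the 6. *)
Lemma qdiffM a0 a1 om om' C C' H H' G G' :
  qdiff a0 a1 om C H H' -> qdiff a0 a1 om' C' G G' ->
  qdiff a0 a1 (fun z => om z * om' z) (6 * (C * C')) (fun z => H z * G z)
    (fun z => H' z * G z + H z * G' z).
Proof.
move=> qH qG z az; have [H1 H2 H3] := qH z az; have [G1 G2 G3] := qG z az.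
set X := C * om z in H1 H2 H3; set Y := C' * om' z in G1 G2 G3.
have X0 : 0 <= X by apply: le_trans H1; exact: cabs_ge0.
have Y0 : 0 <= Y by apply: le_trans G1; exact: cabs_ge0.
have XY0 : 0 <= X * Y by exact: mulr_ge0.
have -> : 6 * (C * C') * (om z * om' z) = 6 * (X * Y) by rewrite /X /Y; ring.
split.
- by apply: le_trans (cabsM_le H1 G1) _; lra.
- by apply: le_trans (cabsD_le (cabsM_le H2 G1) (cabsM_le H1 G2)) _; lra.
move=> h h1 ah; have E := H3 h h1 ah; have F := G3 h h1 ah.
set d := cabs h in h1 E F *; have d0 : 0 <= d by exact: cabs_ge0.
have hd : cabs h <= d by [].
set e := H (z + h) - H z - h * H' z in E; set f := G (z + h) - G z - h * G' z in F.
have -> : H (z + h) * G (z + h) - H z * G z - h * (H' z * G z + H z * G' z) =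
  h * h * (H' z * G' z) + H z * f + h * (H' z * f) + e * G z + h * (e * G' z) + e * f.
  by rewrite /e /f; ring.
have := cabsD_le (cabsD_le (cabsD_le (cabsD_le (cabsD_le
  (cabsM_le (cabsM_le hd hd) (cabsM_le H2 G2)) (cabsM_le H1 F))
  (cabsM_le hd (cabsM_le H2 F))) (cabsM_le E G1)) (cabsM_le hd (cabsM_le E G2)))
  (cabsM_le E F).
move=> /le_trans; apply.
rewrite (_ : _ + _ = X * Y * d ^+ 2 * (3 + 2 * d + d ^+ 2)); last by ring.
rewrite [leRHS](_ : _ = X * Y * d ^+ 2 * 6); last by ring.
have P0 : 0 <= X * Y * d ^+ 2 by rewrite mulr_ge0// sqr_ge0.
have d2 : d ^+ 2 <= 1 by rewrite expr_le1.
by rewrite ler_wpM2l//; lra.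
Qed.

Lemma qdiff_cexp (a0 a1 t : R) : 0 <= a0 ->
  qdiff a0 a1 (fun=> 1) (expR (`|t| * a1) * (1 + `|t| + 10 * expR `|t| * t ^+ 2))
    (fun z => cexp (t%:C%C * z)) (fun z => t%:C%C * cexp (t%:C%C * z)).
Proof.
move=> a00 z /andP[az za]; set M := expR (`|t| * a1).
have M0 : 0 <= M by exact: expR_ge0.
have cz : cabs (cexp (t%:C%C * z)) <= M.
  rewrite cabs_cexp ler_expR ReCM; apply: le_trans (ler_norm _) _.
  by rewrite normrM ler_wpM2l// ger0_norm// (le_trans a00).
have q0 : 0 <= 10 * expR `|t| * t ^+ 2.
  by apply: mulr_ge0; [apply: mulr_ge0 => //; exact: expR_ge0|exact: sqr_ge0].
have t0 := normr_ge0 t.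
rewrite mulr1; split.
- by apply: le_trans cz _; rewrite ler_peMr//; lra.
- rewrite cabsM cabs_real mulrC; apply: (@le_trans _ _ (M * `|t|)).
    by rewrite ler_wpM2r.
  by rewrite ler_wpM2l//; lra.
move=> h h1 _; rewrite mulrDr cexpD.
have -> : cexp (t%:C%C * z) * cexp (t%:C%C * h) - cexp (t%:C%C * z) -
    h * (t%:C%C * cexp (t%:C%C * z)) =
  cexp (t%:C%C * z) * (cexp (t%:C%C * h) - 1 - t%:C%C * h) by ring.
have q : cabs (cexp (t%:C%C * h) - 1 - t%:C%C * h) <= 10 * expR `|t| * t ^+ 2 * cabs h ^+ 2.
  apply: le_trans (cexp_quadratic _) _.
  rewrite cabsM cabs_real exprMn real_normK ?num_real// mulrA.
  rewrite ler_wpM2r ?sqr_ge0// ler_wpM2r ?sqr_ge0// ler_wpM2l// ler_expR ReCM.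
  rewrite normrM -[leRHS]mulr1 ler_wpM2l//.
  exact: le_trans (cabs_Re h) h1.
apply: le_trans (cabsM_le cz q) _; rewrite mulrA ler_wpM2r ?sqr_ge0//.
by rewrite ler_wpM2l//; lra.
Qed.

Lemma cabs_ge_Re (a0 : R) z : 0 < a0 -> a0 <= complex.Re z -> a0 <= cabs z.
Proof. by move=> a00 az; apply: le_trans (cabs_Re z); rewrite ger0_norm//; lra. Qed.

Lemma Re_gt0_neq0 z : 0 < complex.Re z -> z != 0.
Proof. by apply: contraTneq => ->; rewrite ltxx. Qed.

Lemma qdiff_inv (a0 a1 : R) : 0 < a0 ->
  qdiff a0 a1 (fun z => (cabs z)^-1) ((1 + a0^-1) ^+ 2) (fun z => z^-1)
    (fun z => - (z^-1 * z^-1)).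
Proof.
move=> a00 z /andP[az _].
have inv w : a0 <= complex.Re w -> (cabs w)^-1 <= a0^-1.
  move=> aw; have cw := cabs_ge_Re a00 aw.
  by rewrite lef_pV2// posrE//; exact: lt_le_trans cw.
have ia0 : 0 < a0^-1 by rewrite invr_gt0.
have iz0 : 0 <= (cabs z)^-1 by rewrite invr_ge0 cabs_ge0.
have C1 : 1 <= (1 + a0^-1) ^+ 2 by nra.
have C2 : a0^-1 <= (1 + a0^-1) ^+ 2 by nra.
have C3 : a0^-1 * a0^-1 <= (1 + a0^-1) ^+ 2 by nra.
split.
- by rewrite cabsV ler_peMl.
- rewrite cabsN cabsM cabsV ler_wpM2r//; exact: le_trans (inv _ az) C2.
move=> h h1 /andP[azh _].
have z0 : z != 0 by apply: Re_gt0_neq0; exact: lt_le_trans az.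
have zh0 : z + h != 0 by apply: Re_gt0_neq0; exact: lt_le_trans azh.
have -> : (z + h)^-1 - z^-1 - h * - (z^-1 * z^-1) = (z + h)^-1 * z^-1 * z^-1 * (h * h).
  by field; rewrite z0 zh0.
rewrite !cabsM !cabsV -expr2 ler_wpM2r ?sqr_ge0// ler_wpM2r//.
apply: le_trans C3; rewrite ler_pM ?invr_ge0 ?cabs_ge0//; exact: inv.
Qed.

(** Meant for [1/(2 - z)], which on [Re z = 1] is the inverse of the conjugate of [z]. *)
Lemma qdiff_reflect (a0 a1 r : R) om C H H' : qdiff a0 a1 om C H H' ->
  qdiff (r - a1) (r - a0) (fun z => om (r%:C%C - z)) C
    (fun z => H (r%:C%C - z)) (fun z => - H' (r%:C%C - z)).
Proof.
move=> q z az; have az' : a0 <= complex.Re (r%:C%C - z) <= a1.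
  by rewrite ReD ReN /=; lra.
have [H1 H2 H3] := q _ az'; split => //; first by rewrite cabsN.
move=> h h1 ah; have := H3 (- h); rewrite cabsN => /(_ h1).
rewrite -addrA -opprD mulNr mulrN opprK => H4; apply: H4.
by move: ah; rewrite !ReD ReN ReD /=; lra.
Qed.

Lemma qdiff_ccontinuous (a0 a1 a : R) om C H H' : a0 <= a <= a1 ->
  qdiff a0 a1 om C H H' -> ccontinuous (fun b => H (a +i* b)%C).
Proof.
move=> aa q b0 e e0; have [H1 H2 H3] := q (a +i* b0)%C aa.
set M := C * om (a +i* b0)%C in H1 H2 H3.
have M0 : 0 <= M by apply: le_trans H1; exact: cabs_ge0.
have q0 : 0 < 2 * M + 1 by lra.
exists (Num.min 1 (e / (2 * M + 1))); first by rewrite lt_min ltr01 divr_gt0.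
move=> b; rewrite lt_min => /andP[b1]; rewrite ltr_pdivlMr// => be.
have ch : cabs ('i%C * (b - b0)%:C%C) = `|b - b0| by rewrite cabsM cabs_i mul1r cabs_real.
have eb : (a +i* b0)%C + 'i%C * (b - b0)%:C%C = (a +i* b)%C.
  by apply: complex_eq => /=; ring.
have := H3 ('i%C * (b - b0)%:C%C); rewrite ch eb => /(_ (ltW b1) aa) h4.
have := cabsD_le h4 (cabsM_le (lexx (cabs ('i%C * (b - b0)%:C%C))) H2).
rewrite subrK ch => /le_lt_trans; apply; apply: le_lt_trans be.
set r := `|b - b0|; have r0 : 0 <= r by exact: normr_ge0.
have r2 : r ^+ 2 <= r by rewrite expr2 ler_piMr// ltW.
have := ler_wpM2l M0 r2; lra.
Qed.

End quadratic_differentiability.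

(** * Independence of a vertical-line integral from the line *)

Section contour_shift.
Variables (R : realType) (a0 a1 C : R) (H H' : R[i] -> R[i]).
Hypothesis a00 : 0 < a0.
Hypothesis qH : qdiff a0 a1 (fun z => (cabs z ^+ 2)^-1) C H H'.
Hypothesis mH' : forall a, a0 <= a <= a1 -> cmeasurable (fun b => H' (a +i* b)%C).

Let weightE (a b : R) : (cabs (a +i* b)%C ^+ 2)^-1 = (a ^+ 2 + b ^+ 2)^-1.
Proof. by rewrite cabs_sqr. Qed.

Let mH a : a0 <= a <= a1 -> cmeasurable (fun b => H (a +i* b)%C).
Proof. by move=> aa; apply: ccontinuous_cmeasurable; exact: qdiff_ccontinuous aa qH. Qed.

Let iH a : a0 <= a <= a1 -> cintegrable setT (fun b => H (a +i* b)%C).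
Proof.
move=> /[dup] aa /andP[h _]; apply: (@cintegrable_line _ _ a C); first exact: lt_le_trans a00 h.
  exact: mH.
by move=> b; have [+ _ _] := qH (z := (a +i* b)%C) aa; rewrite weightE.
Qed.

Let iH' a : a0 <= a <= a1 -> cintegrable setT (fun b => H' (a +i* b)%C).
Proof.
move=> /[dup] aa /andP[h _]; apply: (@cintegrable_line _ _ a C); first exact: lt_le_trans a00 h.
  exact: mH'.
by move=> b; have [_ + _] := qH (z := (a +i* b)%C) aa; rewrite weightE.
Qed.

Let C0 a : a0 <= a <= a1 -> 0 <= C.
Proof.
move=> /[dup] aa /andP[h _]; have a_gt0 : 0 < a by exact: lt_le_trans a00 h.
apply: (@line_bound_ge0 _ (fun b => H (a +i* b)%C) a C a_gt0) => b.
by have [+ _ _] := qH (z := (a +i* b)%C) aa; rewrite weightE.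
Qed.

(* Translation invariance of Lebesgue measure in place of the fundamental
   theorem of calculus. *)
Lemma Cint_deriv_eq0 a : a0 <= a <= a1 -> Cint setT (fun b => H' (a +i* b)%C) = 0.
Proof.
move=> /[dup] aa /andP[h _]; have a_gt0 : 0 < a by exact: lt_le_trans a00 h.
set I := Cint _ _; apply: cabs0_eq0; apply: le_eps => e e0; rewrite add0r.
have pi0 : 0 < pi :> R by exact: pi_gt0.
pose M := 2 * (C * pi / a).
have M0 : 0 <= M by rewrite /M mulr_ge0// divr_ge0 ?(ltW a_gt0)// mulr_ge0 ?(C0 aa)// ltW.
pose k := Num.min 1 (e / (M + 1)).
have k0 : 0 < k by rewrite lt_min ltr01 divr_gt0//; lra.
have k1 : k <= 1 by rewrite ge_min lexx.
have ke : M * k <= e.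
  have : k <= e / (M + 1) by rewrite ge_min lexx orbT.
  by rewrite ler_pdivlMr; lra.
have ck : cabs ('i%C * k%:C%C) = k by rewrite cabsM cabs_i mul1r cabs_real gtr0_norm.
have sh b : (a +i* b)%C + 'i%C * k%:C%C = (a +i* (b + k))%C.
  by apply: complex_eq => /=; ring.
(* The integrals of [H(z + ik)] and [H(z)] cancel by translation, so only [-ik I] is left and
   [k |I| <= M k^2]. *)
have e1 : Cint setT (fun b => H (a +i* (b + k))%C - H (a +i* b)%C -
    'i%C * k%:C%C * H' (a +i* b)%C) = - ('i%C * k%:C%C * I).
  have i1 : cintegrable setT (fun b => H (a +i* (b + k))%C).
    exact: (cintegrable_translate k (mH aa) (iH aa)).
  rewrite CintBT//; last 2 first.
  - exact: cintegrableB i1 (iH aa).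
  - exact: cintegrableM (iH' aa).
  rewrite (CintBT i1 (iH aa)) (CintMT _ (iH' aa)).
  have eT : Cint setT (fun b => H (a +i* (b + k))%C) = Cint setT (fun b => H (a +i* b)%C).
    exact: (Cint_translate k (mH aa)).
  by rewrite eT subrr sub0r.
have := @Cint_line_le R (fun b => H (a +i* (b + k))%C - H (a +i* b)%C -
    'i%C * k%:C%C * H' (a +i* b)%C) a (C * k ^+ 2) a_gt0.
rewrite e1 cabsN cabsM ck => B.
have {}B : k * cabs I <= 2 * (C * k ^+ 2 * pi / a).
  apply: B => b; have [_ _ /(_ ('i%C * k%:C%C))] := qH (z := (a +i* b)%C) aa.
  by rewrite ck sh weightE => /(_ k1 aa) /le_trans; apply; apply: eq_ler; ring.
have {}B : k * cabs I <= k * (M * k).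
  by apply: le_trans B _; apply: eq_ler; rewrite /M; ring.
by move: B; rewrite ler_pM2l// => /le_trans; apply.
Qed.

(** As [H'] integrates to 0 on every line, the integral of [H] changes only quadratically in [a]. *)
Lemma Cint_contour_shift a a' : a0 <= a <= a1 -> a0 <= a' <= a1 ->
  Cint setT (fun b => H (a +i* b)%C) = Cint setT (fun b => H (a' +i* b)%C).
Proof.
wlog aa' : a a' / a <= a'.
  move=> W ha ha'; have [le|/ltW le] := leP a a'; first exact: W.
  by apply/esym; exact: W.
move=> ha ha'.
apply/esym; apply: (@quadratic_constant R R[i]^o (fun a => Cint setT (fun b => H (a +i* b)%C))
  a a' (2 * (C * pi / a0)) aa') => r h ar h0 h1 rh.
have hr : a0 <= r <= a1 by lra.
have hrh : a0 <= r + h <= a1 by lra.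
have r0 : 0 < r by case/andP: hr => + _; exact: lt_le_trans.
rewrite rnorm_cabs.
have -> : Cint setT (fun b => H ((r + h) +i* b)%C) - Cint setT (fun b => H (r +i* b)%C) =
    Cint setT (fun b => H ((r + h) +i* b)%C - H (r +i* b)%C - h%:C%C * H' (r +i* b)%C).
  rewrite CintBT//; last 2 first.
  - exact: cintegrableB (iH hrh) (iH hr).
  - exact: cintegrableM (iH' hr).
  rewrite (CintBT (iH hrh) (iH hr)) (CintMT _ (iH' hr)).
  by rewrite (Cint_deriv_eq0 hr) mulr0 subr0.
have ch : cabs h%:C%C = h by rewrite cabs_real ger0_norm.
have sh b : (r +i* b)%C + h%:C%C = ((r + h) +i* b)%C by apply: complex_eq => /=; ring.
have B : cabs (Cint setT (fun b => H ((r + h) +i* b)%C - H (r +i* b)%C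
    - h%:C%C * H' (r +i* b)%C)) <= 2 * (C * h ^+ 2 * pi / r).
  apply: Cint_line_le => // b; have [_ _ /(_ h%:C%C)] := qH (z := (r +i* b)%C) hr.
  rewrite ch sh weightE => /(_ h1 hrh) /le_trans; apply; apply: eq_ler; ring.
apply: le_trans B _.
rewrite (_ : 2 * (C * pi / a0) * h ^+ 2 = 2 * (C * h ^+ 2 * pi / a0)); last by ring.
rewrite ler_wpM2l// ler_wpM2l//.
  by apply: mulr_ge0; [rewrite mulr_ge0 ?(C0 hr)// sqr_ge0|exact: pi_ge0].
by rewrite lef_pV2 ?posrE//; case/andP: hr.
Qed.

End contour_shift.

(** * The inverse Laplace transform of [1/z^2] *)

Section scalar_kernel.
Variable R : realType.
Implicit Types (a b t : R) (z : R[i]).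

Let kernel t z := cexp (t%:C%C * z) * (z^-1 * z^-1).
Let kernel' t z := t%:C%C * cexp (t%:C%C * z) * (z^-1 * z^-1) +
  cexp (t%:C%C * z) * (- (z^-1 * z^-1) * z^-1 + z^-1 * - (z^-1 * z^-1)).

Lemma cmeasurable_cexp t a : 0 <= a -> cmeasurable (fun b => cexp (t%:C%C * (a +i* b)%C)).
Proof.
move=> a0; apply: ccontinuous_cmeasurable.
have aa : 0 <= a <= a by rewrite a0 lexx.
exact: (qdiff_ccontinuous aa (qdiff_cexp t (lexx 0))).
Qed.

Lemma cmeasurable_inv a : 0 < a -> cmeasurable (fun b => (a +i* b)%C^-1).
Proof.
move=> a0; apply: ccontinuous_cmeasurable.
have aa : a <= a <= a by rewrite lexx.
exact: (qdiff_ccontinuous aa (qdiff_inv a0)).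
Qed.

Lemma qdiff_weight (a0 a1 C : R) (om om' : R[i] -> R) H H' :
  (forall z, a0 <= complex.Re z <= a1 -> om z = om' z) ->
  qdiff a0 a1 om C H H' -> qdiff a0 a1 om' C H H'.
Proof. by move=> e q z az; have := q z az; rewrite e. Qed.

Let qdiff_kernel t a0 a1 : 0 < a0 -> exists C,
  qdiff a0 a1 (fun z => (cabs z ^+ 2)^-1) C (kernel t) (kernel' t).
Proof.
move=> a00.
have qi := qdiff_inv (a1 := a1) a00.
have q := qdiffM (qdiff_cexp t (ltW a00)) (qdiffM qi qi).
eexists; apply: qdiff_weight q.
by move=> z _; rewrite /= mul1r -invfM expr2.
Qed.

Let cmeasurable_kernel' t a : 0 < a -> cmeasurable (fun b => kernel' t (a +i* b)%C).
Proof.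
move=> a0; have mi := cmeasurable_inv a0; have me := cmeasurable_cexp t (ltW a0).
apply: cmeasurableD; apply: cmeasurableM.
- exact: cmeasurableM (cmeasurable_cst _) me.
- exact: (cmeasurableM mi mi).
- exact: me.
- by apply: cmeasurableD; apply: cmeasurableM => //; apply: cmeasurableN;
    exact: cmeasurableM.
Qed.

(** The Bromwich integral of [z^-2]; its value [2 pi t] for [t >= 0] is found in [kernel_intE]. *)
Definition kernel_int t a : R[i] := Cint setT (fun b =>
  cexp (t%:C%C * (a +i* b)%C) * ((a +i* b)%C^-1 * (a +i* b)%C^-1)).

Lemma kernel_int_shift t a a' : 0 < a -> 0 < a' -> kernel_int t a = kernel_int t a'.
Proof.
move=> a0 a'0.
have m0 : 0 < Num.min a a' by rewrite lt_min a0.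
have [C q] := qdiff_kernel t (Num.max a a') m0.
apply: (Cint_contour_shift m0 q).
- move=> r /andP[hr _]; apply: cmeasurable_kernel'; exact: lt_le_trans hr.
- by rewrite ge_min le_max !lexx.
- by rewrite ge_min le_max !lexx !orbT.
Qed.

Lemma kernel_bound t a b : cabs (cexp (t%:C%C * (a +i* b)%C) *
    ((a +i* b)%C^-1 * (a +i* b)%C^-1)) = expR (t * a) * (a ^+ 2 + b ^+ 2)^-1.
Proof.
by rewrite cabsM cabs_cexp cabsM ReCM !cabsV -invfM -expr2 cabs_sqr.
Qed.

Lemma cmeasurable_kernel t a : 0 < a -> cmeasurable (fun b =>
  cexp (t%:C%C * (a +i* b)%C) * ((a +i* b)%C^-1 * (a +i* b)%C^-1)).
Proof.
move=> a0; have mi := cmeasurable_inv a0; have me := cmeasurable_cexp t (ltW a0).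
exact: cmeasurableM me (cmeasurableM mi mi).
Qed.

Lemma cintegrable_kernel t a : 0 < a -> cintegrable setT (fun b =>
  cexp (t%:C%C * (a +i* b)%C) * ((a +i* b)%C^-1 * (a +i* b)%C^-1)).
Proof.
move=> a0; apply: (@cintegrable_line _ _ a (expR (t * a))) => //.
  exact: cmeasurable_kernel.
by move=> b; rewrite kernel_bound.
Qed.

(** For [t <= 0] the exponential is bounded by 1 on the half-plane, so the line can be moved to
    infinity. *)
Lemma kernel_int_le0 t a : 0 < a -> t <= 0 -> kernel_int t a = 0.
Proof.
move=> a0 t0; apply: cabs0_eq0; apply: le_eps => e e0; rewrite add0r.
have pi0 : 0 < pi :> R by exact: pi_gt0.
pose r := 2 * pi / e; have r0 : 0 < r by rewrite divr_gt0// mulr_gt0.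
rewrite (kernel_int_shift t a0 r0).
apply: le_trans (Cint_line_le r0 (fun b => eq_ler (kernel_bound t r b))) _.
apply: (@le_trans _ _ (2 * (1 * pi / r))).
  rewrite ler_wpM2l// ler_wpM2r ?invr_ge0 ?(ltW r0)// ler_wpM2r ?(ltW pi0)//.
  by rewrite -expR0 ler_expR mulr_le0_ge0// ltW.
have re : e * r = 2 * pi by rewrite /r mulrC divfK ?lt0r_neq0.
by rewrite mul1r mulrA ler_pdivrMr// re.
Qed.

Let c : R[i] := kernel_int 1 1.

(** On the line [Re z = 1/t] the product [tz] runs over [Re = 1]: [z^-2] contributes [t^2] and the
    change of variable [1/t]. *)
Lemma kernel_int_linear t a : 0 < a -> 0 < t -> kernel_int t a = t%:C%C * c.
Proof.
move=> a0 t0; have it0 : 0 < t^-1 by rewrite invr_gt0.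
rewrite (kernel_int_shift t a0 it0) /kernel_int.
pose g b := cexp (1%:C%C * (1 +i* b)%C) * ((1 +i* b)%C^-1 * (1 +i* b)%C^-1).
have -> : Cint setT (fun b => cexp (t%:C%C * (t^-1 +i* b)%C) *
    ((t^-1 +i* b)%C^-1 * (t^-1 +i* b)%C^-1)) =
    Cint setT (fun b => (t ^+ 2)%:C%C * g (t * b)).
  apply: eq_Cint => b _; rewrite /g.
  have tz : t%:C%C * (t^-1 +i* b)%C = (1 +i* (t * b))%C.
    by apply: complex_eq; rewrite ?ReCM ?ImCM/= ?divff// lt0r_neq0.
  have tc0 : t%:C%C != 0 :> R[i] by rewrite eq_complex /= eqxx andbT lt0r_neq0.
  have -> : (t^-1 +i* b)%C^-1 = t%:C%C * (1 +i* (t * b))%C^-1.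
    by rewrite -tz invfM mulrA divff// mul1r.
  by rewrite tz mul1r rmorphXn/=; ring.
have ig : cintegrable setT g by exact: (cintegrable_kernel 1 ltr01).
have mg : cmeasurable g by exact: (cmeasurable_kernel 1 ltr01).
have ig2 : cintegrable setT (fun b => g (t * b)).
  have ei b : cabs (g b) = expR 1 * (1 ^+ 2 + b ^+ 2)^-1 by rewrite /g kernel_bound mulr1.
  apply: (@cintegrable_line _ _ t^-1 (expR 1 / t ^+ 2)) => //.
    by apply: (cmeasurable_comp mg); exact: measurable_funM.
  move=> b; rewrite ei; apply: eq_ler; field.
  have b0 := sqr_ge0 b; have t20 : 0 < t ^+ 2 by rewrite exprn_gt0.
  by rewrite lt0r_neq0//= lt0r_neq0// ltr_pwDl// sqr_ge0.
rewrite (CintMT _ ig2) (Cint_scale t0 ig mg) mulrA -rmorphM/=.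
by rewrite (_ : t ^+ 2 / t = t)//; field; rewrite lt0r_neq0.
Qed.

(** On [Re z = 1] the conjugate of [z] equals [2 - z], which is holomorphic, while
    [z (2 - z) = 1 + b^2] leads to a known real integral. This pair determines the constant [c]. *)
Let zz b : R[i] := (1 +i* b)%C.
Let ww b : R[i] := (1 -i* b)%C.

Let zz0 b : zz b != 0.
Proof. by apply: Re_gt0_neq0; exact: ltr01. Qed.

Let ww0 b : ww b != 0.
Proof. by apply: Re_gt0_neq0; exact: ltr01. Qed.

Let zzD b : zz b + ww b = 2.
Proof. by apply: complex_eq => /=; ring. Qed.

Let cabs_zz b : cabs (zz b) ^+ 2 = 1 + b ^+ 2.
Proof. by rewrite cabs_sqr/= expr1n. Qed.

Let cabs_ww b : cabs (ww b) = cabs (zz b).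
Proof. by rewrite !cabsE /= sqrrN. Qed.

Let invM b : (zz b)^-1 * (ww b)^-1 = 2^-1 * ((zz b)^-1 + (ww b)^-1).
Proof.
have e : (zz b)^-1 + (ww b)^-1 = 2 * ((zz b)^-1 * (ww b)^-1).
  by rewrite -(zzD b); field; apply/andP; split.
by rewrite e mulrA mulVf ?mul1r// pnatr_eq0.
Qed.

Let me1 t : cmeasurable (fun b => cexp (t%:C%C * zz b)).
Proof. exact: cmeasurable_cexp. Qed.

Let mz : cmeasurable (fun b => (zz b)^-1).
Proof. exact: cmeasurable_inv. Qed.

Let mw : cmeasurable (fun b => (ww b)^-1).
Proof. by apply: (cmeasurable_comp mz (f := -%R)); exact: oppr_measurable. Qed.

Let intg t (u v : R -> R[i]) : cmeasurable u -> cmeasurable v ->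
  (forall b, cabs (u b) = (cabs (zz b))^-1) -> (forall b, cabs (v b) = (cabs (zz b))^-1) ->
  cintegrable setT (fun b => cexp (t%:C%C * zz b) * (u b * v b)).
Proof.
move=> mu mv hu hv; apply: (@cintegrable_line _ _ 1 (expR t)) => //.
  exact: cmeasurableM (me1 t) (cmeasurableM mu mv).
by move=> b; rewrite cabsM cabs_cexp cabsM hu hv ReCM /= mulr1 -invfM -expr2 cabs_zz expr1n.
Qed.

Let cz b : cabs (zz b)^-1 = (cabs (zz b))^-1. Proof. by rewrite cabsV. Qed.
Let cw b : cabs (ww b)^-1 = (cabs (zz b))^-1. Proof. by rewrite cabsV cabs_ww. Qed.

Let cq b : (cabs (zz b))^-1 * (cabs (zz b))^-1 = (1 + b ^+ 2)^-1.
Proof. by rewrite -invfM -expr2 cabs_zz. Qed.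

Let P t := Cint setT (fun b => cexp (t%:C%C * zz b) * ((zz b)^-1 * (ww b)^-1)).
Let Aw t := Cint setT (fun b => cexp (t%:C%C * zz b) * ((ww b)^-1 * (ww b)^-1)).
(** The value of [P] at 0 is known, but [|exp(tz) - 1|] is only bounded by a multiple of
    [t (1 + b^2)], too much for the weight of [P]. The squared weight makes the passage [t -> 0]
    possible, and partial fractions reduce [Q] to [P] and [kernel_int]. *)
Let Q t := Cint setT (fun b => cexp (t%:C%C * zz b) *
  (((zz b)^-1 * (ww b)^-1) * ((zz b)^-1 * (ww b)^-1))).

(** As [z + w = 2], one has [exp(tz) = exp(2t) exp(-tw)], and reflection in [b] gives the kernel at
    [-t], which vanishes. *)
Let Aw0 t : 0 <= t -> Aw t = 0.
Proof.
move=> t0; have e b : cexp (t%:C%C * zz b) * ((ww b)^-1 * (ww b)^-1) = cexp ((2 * t)%:C%C) *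
    (cexp ((- t)%:C%C * ww b) * ((ww b)^-1 * (ww b)^-1)).
  rewrite mulrA -cexpD; congr (cexp _ * _).
  by apply: complex_eq; rewrite ?ReD ?ImD ?ReCM ?ImCM/=; ring.
have mk := cmeasurable_kernel (- t) ltr01; have ik := cintegrable_kernel (- t) ltr01.
rewrite /Aw (eq_Cint (fun b _ => e b)) (CintMT _ (cintegrable_opp mk ik)) (Cint_opp mk).
have := @kernel_int_le0 (- t) 1 ltr01; rewrite oppr_le0 => /(_ t0).
by rewrite /kernel_int => ->; rewrite mulr0.
Qed.

(** The derivative of [exp(tz) / (z (2 - z))] integrates to 0. Its rational part is
    [(1/w^2 - 1/z^2)/2] because [1/(zw) = (1/z + 1/w)/2], and the term in [1/w^2] drops out by
    [Aw0]. *)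
Let tP t : 0 <= t -> t%:C%C * P t = 2^-1 * kernel_int t 1.
Proof.
move=> t0.
have q1 := qdiff_inv (a1 := 1) (@ltr01 R).
have q2 := qdiff_reflect (r := 2) q1; rewrite (_ : 2 - 1 = 1 :> R) in q2; last by ring.
have q := qdiffM (qdiff_cexp t (@ler01 R)) (qdiffM q1 q2).
have zw b : 2%:C%C - zz b = ww b by rewrite /zz /ww; apply: complex_eq => /=; ring.
have onl (z : R[i]) : 1 <= complex.Re z <= 1 -> z = zz (complex.Im z).
  by case: z => a b /=; rewrite -eq_le => /eqP <-.
have wq (z : R[i]) : 1 <= complex.Re z <= 1 ->
    1 * ((cabs z)^-1 * (cabs (2%:C%C - z))^-1) = (cabs z ^+ 2)^-1.
  by move=> /onl ->; rewrite mul1r zw cabs_ww -invfM -expr2.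
have {}q := qdiff_weight wq q.
have e b : t%:C%C * cexp (t%:C%C * zz b) * ((zz b)^-1 * (2%:C%C - zz b)^-1) +
    cexp (t%:C%C * zz b) * (- ((zz b)^-1 * (zz b)^-1) * (2%:C%C - zz b)^-1 +
     (zz b)^-1 * - - ((2%:C%C - zz b)^-1 * (2%:C%C - zz b)^-1)) =
  t%:C%C * (cexp (t%:C%C * zz b) * ((zz b)^-1 * (ww b)^-1)) +
  2^-1 * (cexp (t%:C%C * zz b) * ((ww b)^-1 * (ww b)^-1) -
    cexp (t%:C%C * zz b) * ((zz b)^-1 * (zz b)^-1)).
  rewrite zw; set E := cexp _; have := invM b; set u := (zz b)^-1; set v := (ww b)^-1 => uv.
  have -> : 2^-1 * (E * (v * v) - E * (u * u)) = E * ((2^-1 * (u + v)) * (v - u)) by ring.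
  by rewrite -uv; ring.
have i1 := intg t mz mw cz cw; have i2 := intg t mw mw cw cw; have i3 := intg t mz mz cz cz.
have {}H : t%:C%C * P t + 2^-1 * (Aw t - kernel_int t 1) = 0.
  have mF : cmeasurable (fun b => t%:C%C * cexp (t%:C%C * zz b) * ((zz b)^-1 * (2%:C%C - zz b)^-1) +
      cexp (t%:C%C * zz b) * (- ((zz b)^-1 * (zz b)^-1) * (2%:C%C - zz b)^-1 +
      (zz b)^-1 * - - ((2%:C%C - zz b)^-1 * (2%:C%C - zz b)^-1))).
    rewrite (_ : (fun b => _) = (fun b =>
      t%:C%C * (cexp (t%:C%C * zz b) * ((zz b)^-1 * (ww b)^-1)) +
      2^-1 * (cexp (t%:C%C * zz b) * ((ww b)^-1 * (ww b)^-1) -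
      cexp (t%:C%C * zz b) * ((zz b)^-1 * (zz b)^-1)))); last exact/funext.
    have m u v : cmeasurable u -> cmeasurable v ->
        cmeasurable (fun b => cexp (t%:C%C * zz b) * (u b * v b)).
      by move=> mu mv; exact: cmeasurableM (me1 t) (cmeasurableM mu mv).
    apply: cmeasurableD; first exact: cmeasurableM (cmeasurable_cst _) (m _ _ mz mw).
    apply: cmeasurableM (cmeasurable_cst _) _.
    exact: cmeasurableB (m _ _ mw mw) (m _ _ mz mz).
  have H := Cint_deriv_eq0 ltr01 q _ (a := 1).
  have {}H := H ltac:(move=> a; rewrite -eq_le => /eqP <-; exact: mF) ltac:(by rewrite lexx).
  rewrite (eq_Cint (fun b _ => e b)) in H.
  by rewrite (CintDT (cintegrableMT _ i1) (cintegrableMT _ (cintegrableBT i2 i3)))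
    (CintMT _ i1) (CintMT _ (cintegrableBT i2 i3)) (CintBT i2 i3) in H.
by move: H; rewrite Aw0// sub0r mulrN => /eqP; rewrite subr_eq0 => /eqP.
Qed.

Let QE t : 0 <= t -> Q t = 4^-1 * (kernel_int t 1 + 2 * P t).
Proof.
move=> t0.
have i1 := intg t mz mw cz cw; have i2 := intg t mw mw cw cw; have i3 := intg t mz mz cz cz.
have e b : cexp (t%:C%C * zz b) * (((zz b)^-1 * (ww b)^-1) * ((zz b)^-1 * (ww b)^-1)) =
  4^-1 * ((cexp (t%:C%C * zz b) * ((zz b)^-1 * (zz b)^-1) +
    cexp (t%:C%C * zz b) * ((ww b)^-1 * (ww b)^-1)) +
    2 * (cexp (t%:C%C * zz b) * ((zz b)^-1 * (ww b)^-1))).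
  rewrite {1 2}invM; set E := cexp _; set u := (zz b)^-1; set v := (ww b)^-1.
  by field.
rewrite /Q (eq_Cint (fun b _ => e b)).
have i4 := cintegrableDT i3 i2.
rewrite (CintMT _ (cintegrableDT i4 (cintegrableMT 2 i1))) (CintDT i4 (cintegrableMT 2 i1)).
by rewrite (CintMT _ i1) (CintDT i3 i2) -/(Aw t) (Aw0 t0) addr0.
Qed.

Let P0 : P 0 = pi%:C%C.
Proof.
have e b : cexp (0%:C%C * zz b) * ((zz b)^-1 * (ww b)^-1) = ((oneDsqr b)^-1)%:C%C.
  have d : oneDsqr b != 0 by rewrite lt0r_neq0// (lt_le_trans ltr01)// oneDsqr_ge1.
  rewrite mul0r cexp0 mul1r -invfM.
  have -> : zz b * ww b = (oneDsqr b)%:C%C by apply: complex_eq; rewrite /= /oneDsqr; ring.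
  by rewrite fmorphV.
rewrite /P (eq_Cint (fun b _ => e b)) CintE; apply: complex_eq => /=.
- by rewrite /Defs.Rint /Rintegral integral_oneDsqrV.
- by rewrite /Defs.Rint /Rintegral integral0.
Qed.

Let cexp_sub1 (w : R[i]) : cabs (cexp w - 1) <= cabs w + 10 * expR `|complex.Re w| * cabs w ^+ 2.
Proof.
have -> : cexp w - 1 = w + (cexp w - 1 - w) by ring.
exact: cabsD_le (lexx _) (cexp_quadratic w).
Qed.

Let Q_lip t : 0 < t -> t <= 1 -> cabs (Q t - Q 0) <= 2 * ((1 + 10 * expR 1) * t * pi / 1).
Proof.
move=> t0 t1.
have iQ s : cintegrable setT (fun b => cexp (s%:C%C * zz b) *
    (((zz b)^-1 * (ww b)^-1) * ((zz b)^-1 * (ww b)^-1))).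
  apply: (@cintegrable_line _ _ 1 (expR s)) => //.
    exact: cmeasurableM (me1 s) (cmeasurableM (cmeasurableM mz mw) (cmeasurableM mz mw)).
  move=> b; rewrite cabsM cabs_cexp !cabsM cz cw ReCM /= mulr1 cq expr1n.
  rewrite ler_wpM2l ?expR_ge0//; have := sqr_ge0 b => b0.
  rewrite ler_piMr ?invr_ge0 ?addr_ge0// invf_le1; lra.
rewrite /Q -CintBT//; apply: Cint_line_le => // b.
rewrite -mulrBl cabsM !(cabsM (_ * _)) cabsM cz cw cq expr1n mul0r cexp0.
set d := (1 + b ^+ 2)^-1; have b0 := sqr_ge0 b.
have q : 0 < 1 + b ^+ 2 by lra.
have d0 : 0 <= d by rewrite invr_ge0 ltW.
(* This growth uses up one of the two factors [1/(1 + b^2)]; the other one is integrated. *)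
have h : cabs (cexp (t%:C%C * zz b) - 1) <= (1 + 10 * expR 1) * t * (1 + b ^+ 2).
  apply: le_trans (cexp_sub1 _) _.
  rewrite cabsM cabs_real gtr0_norm// ReCM /= mulr1 gtr0_norm// exprMn cabs_zz.
  have zb : cabs (zz b) <= 1 + b ^+ 2.
    by rewrite -cabs_zz expr2 ler_peMr ?cabs_ge0//; apply: cabs_ge_Re.
  have e1 : expR t <= expR 1 by rewrite ler_expR.
  have t2 : t ^+ 2 <= t by rewrite expr2 ler_piMr// ltW.
  have h1 : t * cabs (zz b) <= t * (1 + b ^+ 2) by rewrite ler_wpM2l// ltW.
  have h2 : 10 * expR t * (t ^+ 2 * (1 + b ^+ 2)) <= 10 * expR 1 * (t * (1 + b ^+ 2)).
    apply: ler_pM.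
    - by rewrite mulr_ge0 ?expR_ge0.
    - by apply: mulr_ge0; [exact: sqr_ge0|exact: ltW].
    - by rewrite ler_wpM2l.
    - by rewrite ler_wpM2r// ltW.
  by move: h1 h2; lra.
rewrite mulrA; apply: (@le_trans _ _ ((1 + 10 * expR 1) * t * (1 + b ^+ 2) * d * d)).
  by rewrite ler_wpM2r// ler_wpM2r.
by apply: eq_ler; rewrite -[X in X * d]mulrA /d divff ?lt0r_neq0// mulr1.
Qed.

(* The constant is found from [Q t = c (t + 1) / 4] for [t > 0] and [Q 0 = pi / 2]. *)
Let cE : c = (2 * pi)%:C%C.
Proof.
pose L := 8 * ((1 + 10 * expR 1) * pi) + cabs c.
have L0 : 0 <= L.
  by rewrite addr_ge0 ?cabs_ge0// !mulr_ge0 ?pi_ge0// addr_ge0// mulr_ge0 ?expR_ge0.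
apply/eqP; rewrite -subr_eq0; apply/eqP/cabs0_eq0/le_eps => e e0; rewrite add0r.
pose t := Num.min 1 (e / (L + 1)).
have t0 : 0 < t by rewrite lt_min ltr01 divr_gt0//; lra.
have t1 : t <= 1 by rewrite ge_min lexx.
have te : L * t <= e.
  have : t <= e / (L + 1) by rewrite ge_min lexx orbT.
  by rewrite ler_pdivlMr; lra.
apply: le_trans te; have lip := Q_lip t0 t1.
have tc0 : t%:C%C != 0 :> R[i] by rewrite eq_complex /= eqxx andbT lt0r_neq0.
have Pt : P t = 2^-1 * c.
  apply: (mulfI tc0); rewrite tP ?ltW// kernel_int_linear//; ring.
have Qt := QE (ltW t0); have Q0 := QE (lexx 0).
rewrite Qt Q0 P0 Pt kernel_int_linear// (kernel_int_le0 ltr01 (lexx 0)) in lip.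
have -> : c - (2 * pi)%:C%C = 4 * (4^-1 * (t%:C%C * c + 2 * (2^-1 * c)) -
    4^-1 * (0 + 2 * pi%:C%C)) + - (t%:C%C * c).
  rewrite rmorphM/= rmorph_nat; by field.
have h4 : cabs (4 : R[i]) <= 4 by rewrite -[4]/(4%:R) -(rmorph_nat (@real_complex R)) cabs_real ger0_norm.
have h5 : cabs (- (t%:C%C * c)) <= t * cabs c by rewrite cabsN cabsM cabs_real gtr0_norm.
apply: le_trans (cabsD_le (cabsM_le h4 lip) h5) _.
by apply: eq_ler; rewrite /L; field.
Qed.

Lemma kernel_intE t a : 0 < a -> 0 <= t -> kernel_int t a = (2 * pi * t)%:C%C.
Proof.
move=> a0; rewrite le_eqVlt => /predU1P[<-|t0]; first by rewrite kernel_int_le0// mulr0.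
by rewrite kernel_int_linear// cE -rmorphM/= mulrC.
Qed.

(** The derivative [t exp(tz)/z^2 - 2 exp(tz)/z^3] of the kernel integrates to 0. *)
Lemma kernel_int3 t : 0 <= t ->
  Cint setT (fun b => cexp (t%:C%C * (1 +i* b)%C) * (1 +i* b)%C^-1 ^+ 3) = (pi * t ^+ 2)%:C%C.
Proof.
move=> t0; have [C q] := qdiff_kernel t 1 (@ltr01 R).
have H := Cint_deriv_eq0 ltr01 q _ (a := 1).
have {}H := H (fun a ha => cmeasurable_kernel' t (lt_le_trans ltr01 (proj1 (andP ha))))
  ltac:(by rewrite lexx).
have ik := cintegrable_kernel t (@ltr01 R).
have i3 : cintegrable setT (fun b => cexp (t%:C%C * (1 +i* b)%C) * (1 +i* b)%C^-1 ^+ 3).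
  apply: (@cintegrable_line _ _ 1 (expR t)) => //.
    have mzz := cmeasurableM mz (cmeasurableM mz mz).
    exact: cmeasurableM (me1 t) mzz.
  move=> b; rewrite cabsM cabs_cexp cabsX cz ReCM /= mulr1 exprS expr2 cq expr1n.
  rewrite ler_wpM2l ?expR_ge0// ler_piMl ?invr_ge0 ?addr_ge0 ?sqr_ge0// invf_le1.
    by apply: cabs_ge_Re.
  by rewrite (lt_le_trans ltr01)//; apply: cabs_ge_Re.
have e b : kernel' t (1 +i* b)%C = t%:C%C * (cexp (t%:C%C * (1 +i* b)%C) *
    ((1 +i* b)%C^-1 * (1 +i* b)%C^-1)) -
    2 * (cexp (t%:C%C * (1 +i* b)%C) * (1 +i* b)%C^-1 ^+ 3).
  by rewrite /kernel'; ring.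
rewrite (eq_Cint (fun b _ => e b)) in H.
rewrite (CintBT (cintegrableMT _ ik) (cintegrableMT _ i3)) (CintMT _ ik) (CintMT _ i3) in H.
move: H => /eqP; rewrite subr_eq0 -/(kernel_int t 1) kernel_intE// => /eqP H.
apply: (mulfI (x := 2)); first by rewrite pnatr_eq0.
by rewrite -H; apply: complex_eq => /=; ring.
Qed.

End scalar_kernel.

(** * The integral of [a exp(-sa)] over the half-line *)

Section gamma_integral.
Variables (R : realType) (s : R).
Hypothesis s0 : 0 < s.
Local Notation mu := (@lebesgue_measure R).
Local Notation halfline := (`]0%R, +oo[%classic : set R).

Let F (x : R) := - ((x / s + (s ^+ 2)^-1) * expR (- s * x)).

(** Half of the exponential rate absorbs the linear factor, so [F] tends to 0 at infinity. *)
Let F_bound x : 0 <= x ->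
  (x / s + (s ^+ 2)^-1) * expR (- s * x) <= 2 / s ^+ 2 * expR (- (s / 2 * x)).
Proof.
move=> x0; have -> : - (s / 2 * x) = s / 2 * x + - s * x by field.
rewrite expRD mulrA ler_wpM2r ?expR_ge0//.
have s2 : 0 < s ^+ 2 by rewrite exprn_gt0.
apply: le_trans (ler_wpM2l _ (expR_ge1Dx (s / 2 * x))); last by rewrite divr_ge0// ltW.
have -> : 2 / s ^+ 2 * (1 + s / 2 * x) = x / s + 2 / s ^+ 2 by field; rewrite lt0r_neq0.
by rewrite lerD2l ler_peMl ?invr_ge0 ?(ltW s2)//; lra.
Qed.

Let expc : continuous (fun x : R => expR (- s * x)).
Proof.
move=> z; apply: continuous_comp; last exact: continuous_expR.
by apply: continuousM => //; exact: cst_continuous.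
Qed.

Let dF (x : R) : is_derive x 1 F (x * expR (- s * x)).
Proof.
have lin (p q : R) : is_derive x 1 (fun y : R => p * y + q) p.
  apply: (@quadratic_is_derive R _ x p 0 1) => // h _.
  by rewrite mul0r (_ : _ - _ - _ = 0) ?normr0//; ring.
have de : is_derive x 1 (fun y : R => expR (- s * y)) (expR (- s * x) * - s).
  have l0 : is_derive x 1 (fun y : R => - s * y) (- s).
    by have := lin (- s) 0; rewrite (_ : (fun y => _) = (fun y : R => - s * y))//;
      apply/funext => y; rewrite addr0.
  exact: (is_derive1_comp (is_derive_expR (- s * x)) l0).
have dl : is_derive x 1 (fun x : R => x / s + (s ^+ 2)^-1) s^-1.
  by have := lin s^-1 (s ^+ 2)^-1; rewrite (_ : (fun y => _) = (fun x : R => x / s + (s ^+ 2)^-1))//;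
    apply/funext => y; rewrite mulrC.
have h := is_deriveN (is_deriveM dl de).
have -> : x * expR (- s * x) = - ((x / s + (s ^+ 2)^-1) *: (expR (- s * x) * - s) +
    expR (- s * x) *: s^-1).
  by rewrite /GRing.scale/=; field; rewrite lt0r_neq0.
exact: h.
Qed.

Lemma integral_gamma2 :
  (\int[mu]_(a in halfline) (a * expR (- s * a))%:E = ((s ^+ 2)^-1)%:E)%E.
Proof.
have cf : continuous (fun a : R => a * expR (- s * a)).
  by move=> a; apply: cvgM; [exact: cvg_id|exact: expc].
rewrite integral_itv_obnd_cbnd; last first.
  by apply/measurable_EFinP/measurable_funTS; exact: continuous_measurable_fun.
rewrite (@ge0_continuous_FTC2y _ _ F 0 0).
- by rewrite -EFinB sub0r /F opprK mul0r add0r mulr0 expR0 mulr1.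
- by move=> x x0; rewrite mulr_ge0// expR_ge0.
- exact: continuous_subspaceT.
- apply: (@squeeze_cvgr _ _ _ _ (fun x => - (2 / s ^+ 2 * expR (- (s / 2 * x)))) (cst 0)).
  + near=> x; have x0 : 0 <= x by near: x; exact: nbhs_pinfty_ge.
    rewrite lerN2 F_bound//= oppr_le0 mulr_ge0 ?expR_ge0// addr_ge0 ?divr_ge0 ?(ltW s0)//.
    by rewrite invr_ge0 sqr_ge0.
  + rewrite -oppr0 -(mulr0 (2 / s ^+ 2)); apply: cvgN; apply: cvgM; first exact: cvg_cst.
    apply: (@cvg_comp _ _ _ (fun x : R => s / 2 * x) (fun x => expR (- x)) _ (pinfty_nbhs R));
      last exact: cvgr_expR.
    by apply: gt0_cvgMry; [rewrite divr_gt0|exact: cvg_id].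
  + exact: cvg_cst.
- by move=> x _; have [] := dF x.
- apply: cvg_at_right_filter; have [d _] := dF 0.
  exact/differentiable_continuous/derivable1_diffP.
- by move=> x _; rewrite derive1E; have [_ ->] := dF x.
Unshelve. all: by end_near. Qed.

Lemma cintegrable_gamma2 : cintegrable halfline (fun a => (a * expR (- s * a))%:C%C).
Proof.
have cf : continuous (fun a : R => a * expR (- s * a)).
  by move=> a; apply: cvgM; [exact: cvg_id|exact: expc].
split; last exact: integrable0.
apply/integrableP; split.
  by apply/measurable_EFinP/measurable_funTS; exact: continuous_measurable_fun.
rewrite (_ : (\int[mu]_(x in _) _)%E = (\int[mu]_(a in halfline) (a * expR (- s * a))%:E)%E).
  by rewrite integral_gamma2 ltry.
apply: eq_integral => a /set_mem; rewrite /= in_itv/= andbT => a0.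
by rewrite ger0_norm// mulr_ge0 ?expR_ge0// ltW.
Qed.

Lemma Cint_gamma2 : Cint halfline (fun a => (a * expR (- s * a))%:C%C) = ((s ^+ 2)^-1)%:C%C.
Proof.
rewrite CintE; apply: complex_eq => /=.
- by rewrite /Defs.Rint /Rintegral integral_gamma2.
- by rewrite /Defs.Rint /Rintegral integral0.
Qed.

End gamma_integral.

(** * The semigroup as an inverse Laplace integral, and its decay *)

Section inverse_laplace.
Variables (R : realType) (X : completeNormedModType R[i]).
Variables (D : set X) (A : X -> X) (Res : R[i] -> X -> X).
Hypothesis domA : dd_linear_op D A.
Hypothesis resA : resolvent_right D A Res.
Local Notation mu := (@lebesgue_measure R).
Variable K : R.
Hypothesis K0 : 0 < K.
Hypothesis HK : forall (a : R) phi c x, 0 < a -> dual_bound phi c ->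
  (\int[mu]_b (cabs (phi (Res (a +i* b)%C (Res (a +i* b)%C x))))%:E
    <= (K / (a + 1) * c * rnorm x)%:E)%E.
Implicit Types (z : R[i]) (u v w x y : X) (a b t : R).
Local Notation N := (Res 1).

Let M := 2 * K.

Let M0 : 0 < M. Proof. by rewrite mulr_gt0. Qed.

Let one0 : 0 < complex.Re (1 : R[i]). Proof. exact: ltr01. Qed.

Let resM z x : 0 < complex.Re z -> rnorm (Res z x) <= M * rnorm x.
Proof. by move=> z0; exact: (res_le domA resA K0 HK). Qed.

Let NM x : rnorm (N x) <= M * rnorm x.
Proof. exact: resM. Qed.

Let compl_le v : rnorm (v - N v) <= (1 + M) * rnorm v.
Proof.
apply: le_trans (rnormD _ _) _; rewrite rnormN mulrDl mul1r lerD2l; exact: NM.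
Qed.

(** An element [y] of the domain near [x] equals [N(y + Ay)]; approximating [y + Ay] by the range of
    [N^k] and applying the bounded [N] gains one power. *)
Lemma dense_iter_res1 k x (e : R) : 0 < e -> exists u, rnorm (x - iter k N u) < e.
Proof.
elim: k x e => [|k ih] x e e0; first by exists x; rewrite /= subrr rnorm0.
have e2 : 0 < e / 2 by rewrite divr_gt0.
have [y Dy xy] := dense_domain domA x e2.
have q : 0 < M + 1 by have := M0; lra.
have [u hu] := ih (1 *: y + A y) (e / 2 / (M + 1)) (divr_gt0 e2 q).
exists u; rewrite iterS.
have [_ [_ inj]] := resA one0.
have -> : x - N (iter k N u) = (x - y) + N (1 *: y + A y - iter k N u).
  by rewrite (resB resA)// inj// addrA subrK.
apply: le_lt_trans (rnormD _ _) _.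
have : rnorm (N (1 *: y + A y - iter k N u)) <= e / 2.
  apply: le_trans (NM _) _; move: hu; rewrite ltr_pdivlMr//.
  have := rnorm_ge0 (1 *: y + A y - iter k N u); lra.
lra.
Qed.

Lemma dense_res1_eq k (V : normedModType R[i]) (F G : X -> V) (C : R) :
  (forall x y, rnorm (F x - F y) <= C * rnorm (x - y)) ->
  (forall x y, rnorm (G x - G y) <= C * rnorm (x - y)) ->
  (forall u, F (iter k N u) = G (iter k N u)) -> forall x, F x = G x.
Proof.
move=> lF lG FG x; apply/eqP; rewrite -subr_eq0; apply/eqP/rnorm0_eq0/le_eps => e e0.
have q : 0 < 2 * `|C| + 1 by have := normr_ge0 C; lra.
have [u hu] := dense_iter_res1 k x (divr_gt0 e0 q).
set y := iter k N u in hu.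
have -> : F x - G x = (F x - F y) + (G y - G x) by rewrite /y -FG addrA subrK.
apply: le_trans (rnormD _ _) _; rewrite add0r (rnormB (G y)).
have h1 := lF x y; have h2 := lG x y.
have h3 : C * rnorm (x - y) <= `|C| * rnorm (x - y).
  by rewrite ler_wpM2r ?rnorm_ge0// ler_norm.
by move: hu; rewrite ltr_pdivlMr//; have := rnorm_ge0 (x - y); lra.
Qed.

(** Since [A(Nv) = v - Nv], this is [R(z)y = y/z - R(z)Ay/z] for [y = Nv]. Throughout, [v - Nv]
    plays the part of [A(Nv)], which keeps the unbounded operator out of the formulas. *)
Lemma res_res1 z v : 0 < complex.Re z -> Res z (N v) = z^-1 *: (N v - Res z (v - N v)).
Proof.
move=> z0; have nz := Re_gt0_neq0 z0.
have := res_identity resA v one0 z0; rewrite (res_comm resA _ one0 z0).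
rewrite scalerBl scale1r => /eqP; rewrite eq_sym subr_eq => /eqP e.
apply: (scalerI nz); rewrite e scalerA divff// scale1r (resB resA)// opprB.
by rewrite addrA [RHS]addrAC.
Qed.

Let B := M + M * (1 + M).

Let B0 : 0 <= B.
Proof. by have := M0; rewrite /B => h; rewrite addr_ge0 ?mulr_ge0 ?addr_ge0// ltW. Qed.

Lemma res_res1_le z v : 0 < complex.Re z ->
  rnorm (Res z (N v)) <= (cabs z)^-1 * (B * rnorm v).
Proof.
move=> z0; rewrite res_res1// rnormZ cabsV ler_wpM2l ?invr_ge0 ?cabs_ge0//.
apply: le_trans (rnormD _ _) _; rewrite rnormN /B mulrDl; apply: lerD; first exact: NM.
apply: le_trans (resM _ z0) _; rewrite -mulrA ler_wpM2l ?(ltW M0)//; exact: compl_le.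
Qed.

(** Two uses of the resolvent identity give the remainder [h^2 phi(R(z + h) R(z)^2 Nv)]; the
    innermost resolvent supplies the weight [1/|z|] and the outer two are bounded by [M]. *)
Lemma qdiff_res phi (c a0 a1 : R) v : dual_bound phi c -> 0 < a0 ->
  qdiff a0 a1 (fun z => (cabs z)^-1) (c * ((1 + M) ^+ 2 * (B * rnorm v)))
    (fun z => phi (Res z (N v))) (fun z => - phi (Res z (Res z (N v)))).
Proof.
move=> dc a00 z /andP[az _]; have dphi := dual_bound_elt dc.
have [c0 _ phic] := dc; have z0 : 0 < complex.Re z by exact: lt_le_trans az.
set r := (cabs z)^-1; set s := B * rnorm v.
have h0 : rnorm (Res z (N v)) <= r * s by exact: res_res1_le.
have rs0 : 0 <= r * s by apply: le_trans h0; exact: rnorm_ge0.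
have m0 := M0.
have up x k : 0 <= k -> k <= (1 + M) ^+ 2 -> rnorm x <= k * (r * s) ->
    cabs (phi x) <= c * ((1 + M) ^+ 2 * s) * r.
  move=> k0 k1 hx; apply: le_trans (phic _) _.
  rewrite (_ : c * ((1 + M) ^+ 2 * s) * r = c * ((1 + M) ^+ 2 * (r * s))); last by ring.
  by rewrite ler_wpM2l//; apply: le_trans hx _; rewrite ler_wpM2r.
have MM : M * M <= (1 + M) ^+ 2 by nra.
split.
- by apply: (up _ 1) => //; [nra|rewrite mul1r].
- rewrite cabsN; apply: (up _ M); [exact: ltW|nra|].
  by apply: le_trans (resM _ z0) _; rewrite ler_wpM2l// ltW.
move=> h h1 /andP[azh _]; have zh0 : 0 < complex.Re (z + h) by exact: lt_le_trans azh.
have e1 : Res (z + h) (N v) - Res z (N v) = - h *: Res (z + h) (Res z (N v)).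
  by rewrite (res_identity resA)//; congr (_ *: _); ring.
have e2 : Res (z + h) (Res z (N v)) - Res z (Res z (N v)) =
    - h *: Res (z + h) (Res z (Res z (N v))).
  by rewrite (res_identity resA)//; congr (_ *: _); ring.
have -> : phi (Res (z + h) (N v)) - phi (Res z (N v)) - h * - phi (Res z (Res z (N v))) =
    h * h * phi (Res (z + h) (Res z (Res z (N v)))).
  have := dualB (Res (z + h) (N v)) (Res z (N v)) dphi.
  have := dualB (Res (z + h) (Res z (N v))) (Res z (Res z (N v))) dphi.
  rewrite e1 e2 !(dualZ _ _ dphi) => e3 e4; rewrite -e4.
  have -> : phi (Res (z + h) (Res z (N v))) =
    - h * phi (Res (z + h) (Res z (Res z (N v)))) + phi (Res z (Res z (N v))) by rewrite e3 subrK.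
  by ring.
have := up (Res (z + h) (Res z (Res z (N v)))) (M * M) (mulr_ge0 (ltW m0) (ltW m0)) MM.
have -> : rnorm (Res (z + h) (Res z (Res z (N v)))) <= M * M * (r * s).
  apply: le_trans (resM _ zh0) _; rewrite -mulrA ler_wpM2l ?(ltW m0)//.
  by apply: le_trans (resM _ z0) _; rewrite ler_wpM2l// ltW.
move=> /(_ isT) hh; rewrite 2!cabsM -expr2 mulrC ler_wpM2r ?sqr_ge0//.
Qed.

Let cmeasurable_res phi a x : dual_elt phi -> 0 < a ->
  cmeasurable (fun b => phi (Res (a +i* b)%C x)).
Proof. exact: (cmeasurable_iter_res resA 1). Qed.

Let cmeasurable_res2 phi a x : dual_elt phi -> 0 < a ->
  cmeasurable (fun b => phi (Res (a +i* b)%C (Res (a +i* b)%C x))).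
Proof. exact: (cmeasurable_iter_res resA 2). Qed.

(** This integral converges absolutely for every [x] by [HK], whereas [laplace1 k] below is
    controlled for [k >= 1] and [x] in the range of [N]. *)
Definition laplace2 t a (phi : X -> R[i]) x : R[i] := Cint setT (fun b =>
  cexp (t%:C%C * (a +i* b)%C) * phi (Res (a +i* b)%C (Res (a +i* b)%C x))).

Definition laplace1 k t a (phi : X -> R[i]) x : R[i] := Cint setT (fun b =>
  cexp (t%:C%C * (a +i* b)%C) * ((a +i* b)%C^-1 ^+ k * phi (Res (a +i* b)%C x))).

(** One factor [1/|z|] of the power and the one from [res_res1_le] form the weight [1/(a^2 + b^2)];
    the other [k] factors are at most [1/a]. *)
Lemma laplace1_bound k t a b phi c v : 0 < a -> dual_bound phi c ->
  cabs (cexp (t%:C%C * (a +i* b)%C) * ((a +i* b)%C^-1 ^+ k.+1 * phi (Res (a +i* b)%C (N v)))) <=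
  expR (t * a) * (a^-1 ^+ k * (c * (B * rnorm v))) * (a ^+ 2 + b ^+ 2)^-1.
Proof.
move=> a0 dc; have [c0 _ phic] := dc.
rewrite cabsM cabs_cexp ReCM/= -mulrA ler_wpM2l ?expR_ge0//.
have h := le_trans (phic _) (ler_wpM2l c0 (@res_res1_le (a +i* b)%C v a0)).
have ca : a <= cabs (a +i* b)%C by exact: cabs_ge_Re.
have ca0 : 0 < cabs (a +i* b)%C by exact: lt_le_trans ca.
have -> : (a ^+ 2 + b ^+ 2)^-1 = (cabs (a +i* b)%C)^-1 * (cabs (a +i* b)%C)^-1.
  by rewrite -invfM -expr2 cabs_sqr.
rewrite cabsM cabsX cabsV exprSr.
set r := (cabs _)^-1 in h *; have r0 : 0 <= r by rewrite invr_ge0 ltW.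
have ra : r <= a^-1 by rewrite lef_pV2.
apply: (@le_trans _ _ (r ^+ k * r * (c * (r * (B * rnorm v))))).
  by rewrite ler_wpM2l// mulr_ge0// exprn_ge0.
rewrite (_ : r ^+ k * r * (c * (r * (B * rnorm v))) =
  r ^+ k * (c * (B * rnorm v) * (r * r))); last by ring.
rewrite -[leRHS]mulrA; apply: ler_wpM2r; first by rewrite !mulr_ge0 ?rnorm_ge0.
by apply: lerXn2r; rewrite ?nnegrE // invr_ge0 ltW.
Qed.

Lemma cmeasurable_laplace1 k t a phi x : 0 < a -> dual_elt phi -> cmeasurable (fun b =>
  cexp (t%:C%C * (a +i* b)%C) * ((a +i* b)%C^-1 ^+ k * phi (Res (a +i* b)%C x))).
Proof.
move=> a0 dphi; apply: cmeasurableM; first exact/cmeasurable_cexp/ltW.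
apply: cmeasurableM; last exact: cmeasurable_res.
by apply: cmeasurableX; exact: cmeasurable_inv.
Qed.

Lemma cintegrable_laplace1 k t a phi v : 0 < a -> dual_elt phi -> cintegrable setT (fun b =>
  cexp (t%:C%C * (a +i* b)%C) * ((a +i* b)%C^-1 ^+ k.+1 * phi (Res (a +i* b)%C (N v)))).
Proof.
move=> a0 dphi; have [c c0 dc] := dual_elt_bound dphi.
apply: (cintegrable_line a0); first exact: cmeasurable_laplace1.
by move=> b; exact: laplace1_bound dc.
Qed.

Lemma laplace1_le k t a phi c v : 0 < a -> dual_bound phi c ->
  cabs (laplace1 k.+1 t a phi (N v)) <=
  2 * (expR (t * a) * (a^-1 ^+ k * (c * (B * rnorm v))) * pi / a).
Proof. by move=> a0 dc; apply: Cint_line_le => // b; exact: laplace1_bound. Qed.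

Let integrand t phi v z := cexp (t%:C%C * z) * (z^-1 * phi (Res z (N v))).
Let integrand' t phi v z := t%:C%C * cexp (t%:C%C * z) * (z^-1 * phi (Res z (N v))) +
  cexp (t%:C%C * z) * (- (z^-1 * z^-1) * phi (Res z (N v)) +
    z^-1 * - phi (Res z (Res z (N v)))).

Let qdiff_integrand t phi v (a0 a1 : R) : dual_elt phi -> 0 < a0 -> exists C,
  qdiff a0 a1 (fun z => (cabs z ^+ 2)^-1) C (integrand t phi v) (integrand' t phi v).
Proof.
move=> dphi a00; have [c c0 dc] := dual_elt_bound dphi.
have q := qdiffM (qdiff_cexp (a1 := a1) t (ltW a00)) (qdiffM (qdiff_inv a00) (qdiff_res v dc a00)).
eexists; apply: qdiff_weight q.
by move=> z _; rewrite /= mul1r -invfM expr2.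
Qed.

Let cmeasurable_integrand' t phi v a : dual_elt phi -> 0 < a ->
  cmeasurable (fun b => integrand' t phi v (a +i* b)%C).
Proof.
move=> dphi a0; have mi := cmeasurable_inv a0; have me := cmeasurable_cexp t (ltW a0).
have m1 := cmeasurable_res (N v) dphi a0; have m2 := cmeasurable_res2 (N v) dphi a0.
apply: cmeasurableD; apply: cmeasurableM.
- exact: cmeasurableM (cmeasurable_cst _) me.
- exact: cmeasurableM mi m1.
- exact: me.
- apply: cmeasurableD; apply: cmeasurableM => //.
  + by apply: cmeasurableN; exact: (cmeasurableM mi mi).
  + exact: cmeasurableN.
Qed.

Lemma laplace1_shift t a a' phi v : 0 < a -> 0 < a' -> dual_elt phi ->
  laplace1 1 t a phi (N v) = laplace1 1 t a' phi (N v).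
Proof.
move=> a0 a'0 dphi.
have m0 : 0 < Num.min a a' by rewrite lt_min a0.
have [C q] := qdiff_integrand t v (Num.max a a') dphi m0.
apply: (Cint_contour_shift m0 q).
- move=> r /andP[hr _]; apply: cmeasurable_integrand' => //; exact: lt_le_trans hr.
- by rewrite ge_min le_max !lexx.
- by rewrite ge_min le_max !lexx !orbT.
Qed.

Let compl_res1 u : N u - N (N u) = N (u - N u).
Proof. by rewrite (resB resA). Qed.

(* Integration by parts, after inserting [zR(z)y = y - R(z)Ay] twice. *)
Lemma laplace2_nice t a phi u : 0 < a -> 0 <= t -> dual_elt phi ->
  laplace2 t a phi (N (N u)) =
    t%:C%C * ((2 * pi)%:C%C * phi (N (N u)) - laplace1 1 t a phi (N (u - N u))).
Proof.
move=> a0 t0 dphi; set y := N (N u); set v := u - N u.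
have aa : a <= a <= a by apply/andP; split; exact: lexx.
have [C q] := qdiff_integrand t v a dphi a0.
have mI' : cmeasurable (fun b => integrand' t phi v (a +i* b)%C) by exact: cmeasurable_integrand'.
have iI : cintegrable setT (fun b => integrand t phi v (a +i* b)%C).
  exact: (cintegrable_laplace1 0).
have iI' : cintegrable setT (fun b => integrand' t phi v (a +i* b)%C).
  apply: (@cintegrable_line _ _ a C) => // b.
  by have [_ + _] := q (a +i* b)%C aa; rewrite cabs_sqr.
have I'0 : Cint setT (fun b => integrand' t phi v (a +i* b)%C) = 0.
  apply: (Cint_deriv_eq0 a0 q) => // r /andP[r1 r2].
  by have <- : a = r by apply/eqP; rewrite eq_le r1.
have ik := cintegrable_kernel t a0.
have e b : cexp (t%:C%C * (a +i* b)%C) * phi (Res (a +i* b)%C (Res (a +i* b)%C y)) =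
    phi y * (cexp (t%:C%C * (a +i* b)%C) * ((a +i* b)%C^-1 * (a +i* b)%C^-1)) +
    (integrand' t phi v (a +i* b)%C - t%:C%C * integrand t phi v (a +i* b)%C).
  have z0 : 0 < complex.Re (a +i* b)%C by [].
  set z := (a +i* b)%C in z0 *.
  have -> : Res z (Res z y) = z^-1 *: (z^-1 *: (y - Res z (N v)) - Res z (Res z (N v))).
    rewrite {1}/y (res_res1 _ z0) (resZ resA)// (resB resA)// compl_res1 -/v.
    by rewrite -/y {1}/y (res_res1 _ z0) compl_res1.
  rewrite !(dualZ _ _ dphi, dualB _ _ dphi) /integrand' /integrand; ring.
rewrite /laplace2 (eq_Cint (fun b _ => e b)).
have iB := cintegrableBT iI' (cintegrableMT t%:C%C iI).
rewrite (CintDT (cintegrableMT _ ik) iB) (CintMT _ ik) (CintBT iI' (cintegrableMT _ iI)).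
rewrite I'0 (CintMT _ iI) -/(kernel_int t a) kernel_intE//.
rewrite -/(laplace1 1 t a phi (N v)) rmorphM/=; ring.
Qed.

Lemma integral_laplace2_le t a phi c x : 0 < a -> dual_bound phi c ->
  (\int[mu]_b (cabs (cexp (t%:C%C * (a +i* b)%C) *
    phi (Res (a +i* b)%C (Res (a +i* b)%C x))))%:E
    <= (expR (t * a) * (K / (a + 1) * c * rnorm x))%:E)%E.
Proof.
move=> a0 dc; have dphi := dual_bound_elt dc.
under eq_integral => b _ do rewrite cabsM cabs_cexp ReCM /= EFinM.
rewrite ge0_integralZl_EFin ?expR_ge0//.
- by rewrite [leRHS]EFinM lee_wpmul2l ?lee_fin ?expR_ge0//; exact: HK.
- by move=> b _; rewrite lee_fin cabs_ge0.
- by apply/measurable_EFinP; exact: (measurable_cabs (cmeasurable_res2 x dphi a0)).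
Qed.

Lemma cintegrable_laplace2 t a phi x : 0 < a -> dual_elt phi -> cintegrable setT (fun b =>
  cexp (t%:C%C * (a +i* b)%C) * phi (Res (a +i* b)%C (Res (a +i* b)%C x))).
Proof.
move=> a0 dphi; have [c c0 dc] := dual_elt_bound dphi.
apply: (cintegrable_cabs _ (integral_laplace2_le t x a0 dc)).
by apply: cmeasurableM; [exact/cmeasurable_cexp/ltW|exact: cmeasurable_res2].
Qed.

Lemma laplace2_le t a phi c x : 0 < a -> dual_bound phi c ->
  cabs (laplace2 t a phi x) <= 2 * (expR (t * a) * (K / (a + 1) * c * rnorm x)).
Proof.
by move=> a0 dc; apply: Cint_le (integral_laplace2_le t x a0 dc) => b _.
Qed.

Lemma laplace2_linear t a phi (r : R[i]) x y : 0 < a -> dual_elt phi ->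
  laplace2 t a phi (r *: x + y) = r * laplace2 t a phi x + laplace2 t a phi y.
Proof.
move=> a0 dphi.
have ix := cintegrable_laplace2 t x a0 dphi; have iy := cintegrable_laplace2 t y a0 dphi.
rewrite /laplace2 -(CintMT _ ix) -(CintDT (cintegrableMT _ ix) iy).
apply: eq_Cint => b _; rewrite !(res_linear resA)//.
by have [-> _] := dphi; ring.
Qed.

(** On the range of [N^2] the formula [laplace2_nice] reduces to [laplace1], whose line can be
    moved. Both sides are Lipschitz in [x], so density suffices. *)
Lemma laplace2_shift t a a' phi x : 0 < a -> 0 < a' -> 0 <= t -> dual_elt phi ->
  laplace2 t a phi x = laplace2 t a' phi x.
Proof.
move=> a0 a'0 t0 dphi; have [c c0 dc] := dual_elt_bound dphi.
pose L r := 2 * (expR (t * r) * (K / (r + 1) * c)).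
have L_ge0 r : 0 < r -> 0 <= L r.
  move=> r0; rewrite /L; apply: mulr_ge0 => //; apply: mulr_ge0; first exact: expR_ge0.
  by apply: mulr_ge0 => //; rewrite divr_ge0 ?(ltW K0)// addr_ge0// ltW.
have lip r y y' : 0 < r -> r = a \/ r = a' ->
    rnorm ((laplace2 t r phi y : R[i]^o) - laplace2 t r phi y') <= (L a + L a') * rnorm (y - y').
  move=> r0 ra; have := laplace2_linear t (-1) y' y r0 dphi.
  rewrite scaleN1r mulN1r addrC [in RHS]addrC => e.
  have <- : laplace2 t r phi (y - y') = laplace2 t r phi y - laplace2 t r phi y' by [].
  rewrite rnorm_cabs; apply: le_trans (laplace2_le t _ r0 dc) _.
  rewrite (_ : 2 * _ = L r * rnorm (y - y')); last by rewrite /L; ring.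
  rewrite ler_wpM2r ?rnorm_ge0//.
  by have := L_ge0 _ a0; have := L_ge0 _ a'0; case: ra => ->; lra.
apply: (dense_res1_eq (k := 2) (V := R[i]^o) (F := fun x => laplace2 t a phi x)
  (G := fun x => laplace2 t a' phi x) (C := L a + L a')).
- by move=> y y'; apply: lip => //; left.
- by move=> y y'; apply: lip => //; right.
- move=> u; rewrite /= (laplace2_nice _ a0 t0 dphi) (laplace2_nice _ a'0 t0 dphi).
  by rewrite (laplace1_shift t _ a0 a'0 dphi).
Qed.

(** For [e_t] one has [f'(a + ib) = -t e^{-2ta} e^{t(a - ib)}]: the inner integral is [-t e^{-2ta}]
    times an inverse Laplace integral independent of [a]. The outer integral is then that of
    [a e^{-2ta}], equal to [1/(2t)^2], and [(2/pi) t / (2t)^2 = 1/(2 pi t)]. *)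
Lemma Bcalc_cexp_neg t (T : X -> X) phi x : 0 < t -> Bcalc_rep Res (cexp_neg t) T ->
  dual_elt phi -> (2 * pi * t)%:C%C * phi (T x) = laplace2 t 1 phi x.
Proof.
move=> t0 [L [hL rep]] dphi; have L0 := lim_Re_infty_unique hL (lim_cexp_neg t0).
rewrite rep// L0 mul0r sub0r; set J := laplace2 t 1 phi x.
have inner a : 0 < a -> Cint setT (fun b => phi (Res (a -i* b)%C (Res (a -i* b)%C x)) *
    cderiv (cexp_neg t) (a +i* b)%C) = (- t * expR (- (2 * t) * a))%:C%C * J.
  move=> a0; rewrite /J -(laplace2_shift x a0 ltr01 (ltW t0) dphi).
  pose g b := cexp (t%:C%C * (a +i* b)%C) * phi (Res (a +i* b)%C (Res (a +i* b)%C x)).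
  have ig : cintegrable setT g by exact: cintegrable_laplace2.
  have mg : cmeasurable g.
    by apply: cmeasurableM; [exact/cmeasurable_cexp/ltW|exact: cmeasurable_res2].
  have e b : phi (Res (a -i* b)%C (Res (a -i* b)%C x)) * cderiv (cexp_neg t) (a +i* b)%C =
      (- t * expR (- (2 * t) * a))%:C%C * g (- b).
    have [_ ->] := cdiff_derivable (cdiff_cexp_neg t (a +i* b)%C).
    rewrite /g cexp_negE.
    have -> : cexp (- t%:C%C * (a +i* b)%C) =
        (expR (- (2 * t) * a))%:C%C * cexp (t%:C%C * (a -i* b)%C).
      rewrite -cexp_real -cexpD; congr cexp.
      by apply: complex_eq; rewrite mulNr ?ReD ?ImD ?ReN ?ImN ?ReCM ?ImCM /=; ring.
    by rewrite rmorphM rmorphN/=; ring.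
  by rewrite (eq_Cint (fun b _ => e b)) (CintMT _ (cintegrable_opp mg ig)) (Cint_opp mg).
have t2 : 0 < 2 * t by rewrite mulr_gt0.
rewrite (eq_Cint (h := fun a => (- t%:C%C * J) * (a * expR (- (2 * t) * a))%:C%C)); last first.
  move=> a; rewrite /= in_itv/= andbT => a0.
  by rewrite inner// !rmorphM rmorphN/=; ring.
rewrite CintM//; last exact: cintegrable_gamma2.
rewrite Cint_gamma2//.
have -> : (2 * pi * t)%:C%C * - ((2 / pi)%:C%C * (- t%:C%C * J * ((2 * t) ^+ 2)^-1%:C%C)) =
    (2 * pi * t * (2 / pi) * t * ((2 * t) ^+ 2)^-1)%:C%C * J by rewrite !rmorphM/=; ring.
have pi0 : pi != 0 :> R by rewrite lt0r_neq0// pi_gt0.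
rewrite (_ : 2 * pi * t * (2 / pi) * t * ((2 * t) ^+ 2)^-1 = 1) ?mul1r//.
have -> : 2 * pi * t * (2 / pi) * t = (2 * t) ^+ 2 * (pi / pi) by ring.
by rewrite divff// mulr1 divff// expf_neq0// lt0r_neq0.
Qed.

Lemma Bcalc_cexp_neg0 (T : X -> X) x : Bcalc_rep Res (cexp_neg 0) T -> T x = x.
Proof.
move=> [L [hL rep]]; have e0 z : cexp_neg 0 z = 1 :> R[i].
  by rewrite cexp_negE oppr0 mul0r cexp0.
have L1 : L = 1.
  apply: lim_Re_infty_unique hL _ => e ee; exists 0 => z _.
  by rewrite e0 subrr cabs0.
apply: dual_eq => phi dphi; rewrite rep// L1 mul1r.
rewrite (eq_Cint (h := fun=> 0)) ?Cint0 ?mulr0 ?subr0// => a _.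
rewrite (eq_Cint (h := fun=> 0)) ?Cint0 ?mulr0// => b _.
have [_ ->] := cdiff_derivable (cdiff_cexp_neg 0 (a +i* b)%C).
by rewrite oppr0 mul0r mulr0.
Qed.

Lemma cintegrable_kernelX k t : cintegrable setT (fun b =>
  cexp (t%:C%C * (1 +i* b)%C) * (1 +i* b)%C^-1 ^+ k.+2).
Proof.
apply: (@cintegrable_line _ _ 1 (expR t)) => //.
  apply: cmeasurableM; first exact: cmeasurable_cexp.
  by apply: cmeasurableX; exact: cmeasurable_inv.
move=> b; rewrite cabsM cabs_cexp cabsX cabsV ReCM /= mulr1 ler_wpM2l ?expR_ge0//.
have c1 : 1 <= cabs (1 +i* b)%C by exact: cabs_ge_Re.
have c0 : 0 < cabs (1 +i* b)%C by exact: lt_le_trans c1.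
have -> : 1 ^+ 2 + b ^+ 2 = cabs (1 +i* b)%C ^+ 2 by rewrite cabs_sqr.
rewrite -addn2 exprD -exprVn ler_piMl ?exprn_ge0 ?invr_ge0 ?(ltW c0)//.
by rewrite exprn_ile1 ?invr_ge0 ?(ltW c0)// invf_le1.
Qed.

(** One more expansion of [R(z)] trades a factor [N] for a scalar integral plus a transform with one
    more power of [1/z]. *)
Lemma laplace1_step k t phi v : dual_elt phi ->
  laplace1 k.+1 t 1 phi (N (N v)) =
  phi (N (N v)) * Cint setT (fun b => cexp (t%:C%C * (1 +i* b)%C) * (1 +i* b)%C^-1 ^+ k.+2) -
  laplace1 k.+2 t 1 phi (N (v - N v)).
Proof.
move=> dphi; have ik := cintegrable_kernelX k t.
have i1 := cintegrable_laplace1 k.+1 t (v - N v) ltr01 dphi.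
rewrite /laplace1 -(CintMT _ ik) -(CintBT (cintegrableMT _ ik) i1).
apply: eq_Cint => b _; rewrite res_res1// compl_res1 (dualZ _ _ dphi) (dualB _ _ dphi).
by rewrite [_ ^+ k.+2]exprS; ring.
Qed.

(** Differentiating in [t] multiplies by [z], hence lowers the index by one. The remainder costs
    [|z|^2]; the power [z^-3] and the decay of [R(z)Nv] leave [|z|^-2]. *)
Lemma laplace1_taylor t h phi c v : 0 <= t -> 0 <= h -> dual_bound phi c ->
  cabs (laplace1 3 (t + h) 1 phi (N v) - laplace1 3 t 1 phi (N v) -
    h%:C%C * laplace1 2 t 1 phi (N v)) <=
  2 * (10 * expR (t + h) * (c * (B * rnorm v)) * h ^+ 2 * pi / 1).
Proof.
move=> t0 h0 dc; have dphi := dual_bound_elt dc; have [c0 _ phic] := dc.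
have i1 := cintegrable_laplace1 2 (t + h) v ltr01 dphi.
have i2 := cintegrable_laplace1 2 t v ltr01 dphi.
have i3 := cintegrable_laplace1 1 t v ltr01 dphi.
rewrite /laplace1 -(CintMT _ i3) -(CintBT i1 i2) -(CintBT (cintegrableBT i1 i2) (cintegrableMT _ i3)).
apply: Cint_line_le => // b; set z := (1 +i* b)%C.
have z0 : 0 < complex.Re z by exact: ltr01.
have zi : z * z^-1 = 1 by rewrite divff// Re_gt0_neq0.
have -> : cexp ((t + h)%:C%C * z) * (z^-1 ^+ 3 * phi (Res z (N v))) -
    cexp (t%:C%C * z) * (z^-1 ^+ 3 * phi (Res z (N v))) -
    h%:C%C * (cexp (t%:C%C * z) * (z^-1 ^+ 2 * phi (Res z (N v)))) =
  cexp (t%:C%C * z) * (cexp (h%:C%C * z) - 1 - h%:C%C * z) * (z^-1 ^+ 3 * phi (Res z (N v))).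
  have -> : z^-1 ^+ 2 = z * z^-1 ^+ 3 by rewrite [z^-1 ^+ 3]exprS mulrA zi mul1r.
  have -> : (t + h)%:C%C * z = t%:C%C * z + h%:C%C * z by rewrite rmorphD mulrDl.
  by rewrite cexpD; ring.
have c1 : 0 < cabs z by apply: lt_le_trans ltr01 _; exact: cabs_ge_Re.
have -> : (1 ^+ 2 + b ^+ 2)^-1 = (cabs z)^-1 ^+ 2 by rewrite exprVn cabs_sqr.
set r := (cabs z)^-1.
have b1 : cabs (cexp (t%:C%C * z)) <= expR t by rewrite cabs_cexp ReCM/= mulr1.
have b2 : cabs (cexp (h%:C%C * z) - 1 - h%:C%C * z) <= 10 * expR h * (h ^+ 2 * cabs z ^+ 2).
  apply: le_trans (cexp_quadratic _) _.
  by rewrite ReCM/= mulr1 ger0_norm// cabsM cabs_real ger0_norm// exprMn.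
have b3 : cabs (z^-1 ^+ 3) <= r ^+ 3 by rewrite cabsX cabsV.
have b4 : cabs (phi (Res z (N v))) <= c * (r * (B * rnorm v)).
  by apply: le_trans (phic _) _; rewrite ler_wpM2l//; exact: res_res1_le.
apply: le_trans (cabsM_le (cabsM_le b1 b2) (cabsM_le b3 b4)) _.
apply: eq_ler; rewrite expRD.
have zr : cabs z * r = 1 by rewrite divff// lt0r_neq0.
have -> : expR t * (10 * expR h * (h ^+ 2 * cabs z ^+ 2)) * (r ^+ 3 * (c * (r * (B * rnorm v)))) =
  10 * (expR t * expR h) * (c * (B * rnorm v)) * h ^+ 2 * (r ^+ 2) * (cabs z * r) ^+ 2 by ring.
by rewrite zr expr1n mulr1.
Qed.

Lemma dual_elt_res1 phi : dual_elt phi -> dual_elt (fun x => phi (N x)).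
Proof.
move=> dphi; have [c c0 [_ _ phic]] := dual_elt_bound dphi; split.
  by move=> r x y; rewrite (res_linear resA)//; have [-> _] := dphi.
exists (c * M) => x; apply: le_trans (phic _) _.
by rewrite -mulrA ler_wpM2l//; exact: NM.
Qed.

Variable S : R -> X -> X.
Hypothesis HS : forall t, 0 <= t -> Bcalc_rep Res (cexp_neg t) (S t).

Let SJ t x phi : 0 < t -> dual_elt phi -> (2 * pi * t)%:C%C * phi (S t x) = laplace2 t 1 phi x.
Proof. by move=> t0 dphi; apply: Bcalc_cexp_neg => //; exact/HS/ltW. Qed.

Let S0 x : S 0 x = x.
Proof. by apply: Bcalc_cexp_neg0; exact: HS. Qed.

Let pi2_gt0 : 0 < 2 * pi :> R.
Proof. by rewrite mulr_gt0 ?pi_gt0. Qed.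

Let c2 t : 0 < t -> (2 * pi * t)%:C%C != 0 :> R[i].
Proof. by move=> t0; rewrite eq_complex/= eqxx andbT lt0r_neq0// mulr_gt0. Qed.

Lemma semigroup_linear t r x y : 0 <= t -> S t (r *: x + y) = r *: S t x + S t y.
Proof.
rewrite le_eqVlt => /predU1P[<-|t0]; first by rewrite !S0.
apply: dual_eq => phi dphi; have [-> _] := dphi; apply: (mulfI (c2 t0)).
rewrite (SJ _ t0 dphi) mulrDr mulrCA (SJ x t0 dphi) (SJ y t0 dphi).
exact: laplace2_linear.
Qed.

Let SB t x y : 0 <= t -> S t (x - y) = S t x - S t y.
Proof.
move=> t0; have := semigroup_linear (-1) y x t0; rewrite !scaleN1r => e.
by rewrite addrC e addrC.
Qed.

(** Lets the expansion at [S r u] be rewritten as [S r] applied to the expansion at [u]. *)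
Lemma semigroup_res1 t x : 0 <= t -> S t (N x) = N (S t x).
Proof.
rewrite le_eqVlt => /predU1P[<-|t0]; first by rewrite !S0.
apply: dual_eq => phi dphi; apply: (mulfI (c2 t0)); rewrite SJ//.
rewrite (SJ x t0 (dual_elt_res1 dphi)); apply: eq_Cint => b _; congr (_ * phi _).
by rewrite !(res_comm resA _ one0).
Qed.

(** [e K / pi] is the bound at positive times; the summand 1 accommodates the identity at time 0. *)
Let C1 := expR 1 * K / pi + 1.

Let C1_ge1 : 1 <= C1.
Proof. by rewrite lerDr divr_ge0 ?pi_ge0// mulr_ge0 ?expR_ge0// ltW. Qed.

Lemma semigroup_le t x : 0 <= t -> rnorm (S t x) <= C1 / (1 + t) * rnorm x.
Proof.
rewrite le_eqVlt => /predU1P[<-|t0].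
  by rewrite S0 addr0 divr1 ler_peMl ?rnorm_ge0.
have t1 : 0 < 1 + t by lra.
apply: (@le_trans _ _ (expR 1 * K / pi / (1 + t) * rnorm x)); last first.
  by rewrite ler_wpM2r ?rnorm_ge0// ler_wpM2r ?invr_ge0 ?(ltW t1)// lerDl.
apply: rnorm_le_dual => phi dphi phi1.
have dc : dual_bound phi 1 by split => //; [case: dphi|move=> u; rewrite mul1r].
have it0 : 0 < t^-1 by rewrite invr_gt0.
have := laplace2_le t x it0 dc; rewrite (laplace2_shift x it0 ltr01 (ltW t0) dphi).
have q0 : 0 < 2 * pi * t by rewrite mulr_gt0.
rewrite -SJ// cabsM cabs_real gtr0_norm// divff ?lt0r_neq0//.
have -> : t^-1 + 1 = (1 + t) / t by rewrite mulrDl divff ?lt0r_neq0// mul1r addrC.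
rewrite invf_div mulr1 => h; rewrite -(ler_pM2l q0); apply: le_trans h _; apply: eq_ler.
have pi0 : pi != 0 :> R by rewrite lt0r_neq0// pi_gt0.
rewrite (_ : 2 * pi * t * (expR 1 * K / pi / (1 + t) * rnorm x) =
  2 * (expR 1 * (K * (t / (1 + t)) * rnorm x)) * (pi / pi)); last by ring.
by rewrite divff// mulr1.
Qed.

Let S_le t x : 0 <= t -> rnorm (S t x) <= C1 * rnorm x.
Proof.
move=> t0; apply: le_trans (semigroup_le x t0) _; rewrite ler_wpM2r ?rnorm_ge0//.
by rewrite ler_piMr ?(le_trans ler01 C1_ge1)// invf_le1; lra.
Qed.

(** [laplace2_nice] divided by [2 pi t]. The formula persists at [t = 0], where the integral does
    not depend on the line and vanishes as the line moves to infinity. *)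
Lemma semigroup_nice t phi u : 0 <= t -> dual_elt phi ->
  phi (S t (N (N u))) = phi (N (N u)) -
    (2 * pi)^-1%:C%C * laplace1 1 t 1 phi (N (u - N u)).
Proof.
rewrite le_eqVlt => /predU1P[<-|t0] dphi; last first.
  apply: (mulfI (c2 t0)); rewrite SJ// laplace2_nice ?ltW//.
  have -> : (2 * pi * t)%:C%C = t%:C%C * (2 * pi)%:C%C :> R[i] by rewrite -rmorphM mulrC.
  rewrite -mulrA; congr (_ * _); rewrite [RHS]mulrBr [in RHS]mulrA -rmorphM divff ?mul1r//.
  exact: lt0r_neq0.
rewrite S0 (_ : laplace1 _ _ _ _ _ = 0) ?mulr0 ?subr0//.
have [c c0 dc] := dual_elt_bound dphi.
apply: cabs0_eq0; apply: le_eps => e e0; rewrite add0r.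
set v := u - N u; pose q := c * (B * rnorm v).
have q0 : 0 <= q by rewrite !mulr_ge0 ?rnorm_ge0.
have qp : 0 <= q * pi by rewrite mulr_ge0 ?pi_ge0.
pose a := (2 * (q * pi) + 1) / e; have a0 : 0 < a by rewrite divr_gt0//; lra.
rewrite (laplace1_shift 0 v ltr01 a0 dphi).
apply: le_trans (laplace1_le 0 0 v a0 dc) _.
have ea : e * a = 2 * (q * pi) + 1 by rewrite /a mulrC divfK ?lt0r_neq0.
by rewrite mul0r expR0 expr0 !mul1r -/q mulrA ler_pdivrMr// ea; lra.
Qed.

(** The first summand accounts for the term [h^2/2 A^2 y], the second for the remainder of
    [laplace1_taylor]. *)
Let Cd (T : R) := M ^+ 2 * (1 + M) ^+ 2 + 10 * expR T * (B * (1 + M) ^+ 3).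

Let Cd_ge0 T : 0 <= Cd T.
Proof.
have m := M0; have m1 : 0 <= 1 + M by lra.
apply: addr_ge0; first by apply: mulr_ge0; exact: sqr_ge0.
apply: mulr_ge0; first by rewrite mulr_ge0 ?expR_ge0.
by rewrite mulr_ge0 ?exprn_ge0.
Qed.

(* Taylor expansion: with [y_j = A^j y] the terms [laplace1] cancel up to second order. *)
Lemma semigroup_derivative T t h u : 0 <= t -> 0 <= h -> t + h <= T ->
  rnorm (S (t + h) (N (N (N (N u)))) - S t (N (N (N (N u)))) +
    h%:C%C *: S t (N (N (N (u - N u))))) <= Cd T * h ^+ 2 * rnorm u.
Proof.
move=> t0 h0 thT; have th0 : 0 <= t + h by lra.
(* For [y = N^4 u] these encode [Ay = N^3 u1], [A^2 y = N^2 u2] and [A^3 y = N u3]; three expansions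
   leave one factor [N] for integrability. *)
set u1 := u - N u; pose u2 := u1 - N u1; pose u3 := u2 - N u2.
apply: rnorm_le_dual => phi dphi phi1.
have dc : dual_bound phi 1 by split => //; [case: dphi|move=> ?; rewrite mul1r].
have n1 : N (N u) - N (N (N u)) = N (N u1) by rewrite !compl_res1.
have n2 : N u1 - N (N u1) = N u2 by rewrite compl_res1.
have G1 s : 0 <= s -> phi (S s (N (N (N (N u))))) = phi (N (N (N (N u)))) -
    (2 * pi)^-1%:C%C * (phi (N (N (N u1))) * (2 * pi * s)%:C%C -
      (phi (N (N u2)) * (pi * s ^+ 2)%:C%C - laplace1 3 s 1 phi (N u3))).
  move=> s0; rewrite semigroup_nice// n1 laplace1_step// n2 laplace1_step// -/u3.
  by rewrite kernel_int3// -(kernel_intE ltr01 s0).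
have G2 : phi (S t (N (N (N u1)))) = phi (N (N (N u1))) -
    (2 * pi)^-1%:C%C * (phi (N (N u2)) * (2 * pi * t)%:C%C - laplace1 2 t 1 phi (N u3)).
  by rewrite semigroup_nice// n2 laplace1_step// -/u3 -(kernel_intE ltr01 t0).
rewrite (dualD _ _ dphi) (dualB _ _ dphi) (dualZ _ _ dphi) !G1// G2.
set g3 := laplace1 3 (t + h) 1 phi _; set g3' := laplace1 3 t 1 phi _.
set g2 := laplace1 2 t 1 phi _; set a1 := phi (N (N (N u1))); set a2 := phi (N (N u2)).
have q0 : (2 * pi)%:C%C != 0 :> R[i] by rewrite eq_complex/= eqxx andbT lt0r_neq0.
have e1 s : (2 * pi * s)%:C%C = (2 * pi)%:C%C * s%:C%C :> R[i] by rewrite rmorphM.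
have e2 s : (pi * s ^+ 2)%:C%C = (2 * pi)%:C%C * s%:C%C ^+ 2 / 2 :> R[i].
  by rewrite -rmorphXn -rmorphM/=; apply: (mulIf (x := 2)); rewrite ?pnatr_eq0// divfK ?pnatr_eq0//;
    apply: complex_eq => /=; ring.
have -> : phi (N (N (N (N u)))) - (2 * pi)^-1%:C%C * (a1 * (2 * pi * (t + h))%:C%C -
      (a2 * (pi * (t + h) ^+ 2)%:C%C - g3)) -
    (phi (N (N (N (N u)))) - (2 * pi)^-1%:C%C * (a1 * (2 * pi * t)%:C%C -
      (a2 * (pi * t ^+ 2)%:C%C - g3'))) +
    h%:C%C * (a1 - (2 * pi)^-1%:C%C * (a2 * (2 * pi * t)%:C%C - g2)) =
  (h ^+ 2 / 2)%:C%C * a2 + - ((2 * pi)^-1%:C%C * (g3 - g3' - h%:C%C * g2)).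
  rewrite !e1 !e2 (_ : (h ^+ 2 / 2)%:C%C = h%:C%C ^+ 2 / 2); last first.
    by rewrite rmorphM rmorphXn fmorphV/= rmorph_nat.
  rewrite fmorphV rmorphD/=; move: ((2 * pi)%:C%C) q0 => q q0.
  by field.
have m0 := M0; have m1 : 0 <= 1 + M by lra.
have nu1 : rnorm u1 <= (1 + M) * rnorm u by exact: compl_le.
have nu2 : rnorm u2 <= (1 + M) ^+ 2 * rnorm u.
  by apply: le_trans (compl_le _) _; rewrite expr2 -mulrA ler_wpM2l.
have nu3 : rnorm u3 <= (1 + M) ^+ 3 * rnorm u.
  by apply: le_trans (compl_le _) _; rewrite exprS -mulrA ler_wpM2l.
have b1 : cabs ((h ^+ 2 / 2)%:C%C * a2) <= h ^+ 2 * (M ^+ 2 * (1 + M) ^+ 2 * rnorm u).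
  rewrite cabsM cabs_real ger0_norm ?divr_ge0 ?sqr_ge0//.
  apply: ler_pM; rewrite ?cabs_ge0 ?divr_ge0 ?sqr_ge0//.
    by rewrite ler_pdivrMr// ler_peMr ?sqr_ge0//; lra.
  have -> : M ^+ 2 * (1 + M) ^+ 2 * rnorm u = M * (M * ((1 + M) ^+ 2 * rnorm u)) by ring.
  apply: le_trans (phi1 _) _; apply: le_trans (NM _) _.
  apply: ler_wpM2l; first exact: ltW.
  by apply: le_trans (NM _) _; apply: ler_wpM2l => //; exact: ltW.
have b2 : cabs (- ((2 * pi)^-1%:C%C * (g3 - g3' - h%:C%C * g2))) <=
    10 * expR T * (B * (1 + M) ^+ 3) * h ^+ 2 * rnorm u.
  have b := laplace1_taylor u3 t0 h0 dc; rewrite -/g3 -/g3' -/g2 in b.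
  have i0 : 0 <= (2 * pi)^-1 :> R by rewrite invr_ge0 ltW.
  rewrite cabsN cabsM cabs_real ger0_norm//.
  apply: le_trans (ler_wpM2l i0 b) _; rewrite divr1 mul1r.
  rewrite (_ : (2 * pi)^-1 * (2 * (10 * expR (t + h) * (B * rnorm u3) * h ^+ 2 * pi)) =
    (2 * pi)^-1 * (2 * pi) * (10 * expR (t + h) * (B * rnorm u3) * h ^+ 2)); last by ring.
  rewrite mulVf ?mul1r ?lt0r_neq0//.
  rewrite (_ : 10 * expR T * (B * (1 + M) ^+ 3) * h ^+ 2 * rnorm u =
    10 * expR T * (B * ((1 + M) ^+ 3 * rnorm u)) * h ^+ 2); last by ring.
  rewrite ler_wpM2r ?sqr_ge0//; apply: ler_pM.
  - by rewrite mulr_ge0 ?expR_ge0.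
  - by rewrite mulr_ge0 ?rnorm_ge0.
  - by rewrite ler_wpM2l// ler_expR.
  - by rewrite ler_wpM2l.
apply: le_trans (cabsD_le b1 b2) _; apply: eq_ler; rewrite /Cd; ring.
Qed.

Let N4 u := N (N (N (N u))).

Let N3P u := N (N (N (u - N u))).

Let S_N4 t u : 0 <= t -> S t (N4 u) = N4 (S t u).
Proof. by move=> t0; rewrite /N4 !semigroup_res1. Qed.

Let S_N3P t u : 0 <= t -> S t (N3P u) = N3P (S t u).
Proof. by move=> t0; rewrite /N3P !semigroup_res1// SB// semigroup_res1. Qed.

(** On the range of [N^4] the first-order increments of the two factors cancel because [S] commutes
    with [N]. The uniform bound [C1] makes both sides Lipschitz, which extends the identity to
    [X]. *)
Lemma semigroup_law (s t : R) x : 0 <= s -> 0 <= t -> S (s + t) x = S s (S t x).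
Proof.
move=> s0 t0; set T := s + t; have T0 : 0 <= T by rewrite addr_ge0.
have C1_ge0 : 0 <= C1 by apply: le_trans C1_ge1.
apply: (dense_res1_eq (k := 4) (F := S T) (G := fun x => S s (S t x)) (C := C1 * C1)) => [y y'|y y'|u].
- rewrite -SB//; apply: le_trans (S_le _ T0) _.
  by rewrite ler_wpM2r ?rnorm_ge0// ler_peMr.
- rewrite -!SB//; apply: le_trans (S_le _ s0) _.
  by rewrite -mulrA ler_wpM2l// S_le.
rewrite -[iter 4 N u]/(N4 u); set y := N4 u.
have -> : S T y = S (T - 0) (S 0 y) by rewrite subr0 S0.
have -> : S s (S t y) = S (T - t) (S t y) by rewrite /T addrK.
apply/esym; apply: (quadratic_constant (F := fun r => S (T - r) (S r y))
  (C := 2 * (C1 * Cd T) * rnorm u)) => // r h r0 h0 h1 rht.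
have rh0 : 0 <= r + h by lra.
have rhT : r + h <= T by rewrite /T; lra.
(* With this [s'] the factors pass from [S r] to [S (r + h)] and from [S s'] to [S (s' + h)], both
   forward in time, so the one-sided expansion covers both. *)
pose s' := T - (r + h); have s'0 : 0 <= s' by rewrite /s'; lra.
have s'h : T - r = s' + h by rewrite /s'; ring.
have E1 := semigroup_derivative u r0 h0 rhT; rewrite -/(N4 u) -/y -/(N3P u) in E1.
have E2 : rnorm (S (s' + h) (S r y) - S s' (S r y) + h%:C%C *: S s' (S r (N3P u))) <=
    Cd T * h ^+ 2 * (C1 * rnorm u).
  have := semigroup_derivative (S r u) s'0 h0 (T := T) ltac:(rewrite /s'; lra).
  rewrite -/(N4 (S r u)) -/(N3P (S r u)) -S_N4// -S_N3P// -/y => /le_trans; apply.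
  by rewrite ler_wpM2l ?S_le// mulr_ge0 ?sqr_ge0.
rewrite -/s' s'h; set E := S (r + h) y - S r y + h%:C%C *: S r (N3P u) in E1.
have SE : S s' E = S s' (S (r + h) y) - S s' (S r y) + h%:C%C *: S s' (S r (N3P u)).
  by rewrite /E addrC semigroup_linear// SB// addrC.
set E' := S (s' + h) (S r y) - _ + _ in E2.
have -> : S s' (S (r + h) y) - S (s' + h) (S r y) = S s' E - E'.
  rewrite SE /E' opprD opprB addrACA subrr addr0.
  by rewrite addrA subrK.
apply: le_trans (rnormD _ _) _; rewrite rnormN.
have h3 : rnorm (S s' E) <= C1 * (Cd T * h ^+ 2 * rnorm u).
  by apply: le_trans (S_le _ s'0) _; rewrite ler_wpM2l.
apply: le_trans (lerD h3 E2) _; apply: eq_ler; ring.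
Qed.

Lemma semigroup_decay : exists M : R, exists2 w : R, 0 < w &
  forall t, 0 <= t -> forall x, rnorm (S t x) <= M * expR (- w * t) * rnorm x.
Proof.
have C10 : 0 < C1 by apply: lt_le_trans C1_ge1.
(* Chosen so that [C1 / (1 + tau) <= 1/e]. *)
pose tau := C1 * expR 1; have tau0 : 0 < tau by rewrite mulr_gt0 ?expR_gt0.
have small x : rnorm (S tau x) <= expR (- 1) * rnorm x.
  apply: le_trans (semigroup_le x (ltW tau0)) _; rewrite ler_wpM2r ?rnorm_ge0//.
  rewrite expRN ler_pdivrMr; last by lra.
  rewrite mulrC ler_pdivlMr ?expR_gt0// -/tau; lra.
have iterate n (r : R) x : 0 <= r -> rnorm (S (n%:R * tau + r) x) <= expR (- n%:R) * (C1 * rnorm x).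
  move=> r0; elim: n => [|n ih]; first by rewrite mul0r add0r oppr0 expR0 mul1r S_le.
  have n0 : 0 <= n%:R * tau + r by rewrite addr_ge0// mulr_ge0// ltW.
  have -> : n.+1%:R * tau + r = tau + (n%:R * tau + r) by rewrite -natr1; ring.
  rewrite semigroup_law ?(ltW tau0)//; apply: le_trans (small _) _.
  have -> : - n.+1%:R = -1 + - n%:R :> R by rewrite -natr1; ring.
  by rewrite expRD -mulrA ler_wpM2l ?expR_ge0.
(* The factor [e] pays for the fractional part of [t / tau]: [n > t / tau - 1]. *)
exists (C1 * expR 1); exists tau^-1; first by rewrite invr_gt0.
move=> t t0 x; pose n := Num.trunc (t / tau).
have q0 : 0 <= t / tau by rewrite divr_ge0// ltW.
have /andP[n1 n2] : n%:R <= t / tau < n.+1%:R by exact: trunc_itv.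
have r0 : 0 <= t - n%:R * tau by rewrite subr_ge0 -ler_pdivlMr.
have := iterate n _ x r0; rewrite addrC subrK => /le_trans; apply.
rewrite mulrA ler_wpM2r ?rnorm_ge0// mulrC -mulrA ler_wpM2l ?(ltW C10)//.
rewrite -expRD ler_expR mulNr [tau^-1 * t]mulrC; move: n2; rewrite -natr1; lra.
Qed.

End inverse_laplace.

Theorem mainTheorem19 (R : realType) (X : completeNormedModType R[i])
  (D : set X) (A : X -> X) (Res : R[i] -> X -> X) :
  dd_linear_op D A ->
  resolvent_right D A Res ->
  (forall (x : X) (phi : X -> R[i]), dual_elt phi ->
     exists C : R, forall a : R, 0 < a ->
       ((a + 1)%:E *
        \int[@lebesgue_measure R]_(b in [set: R])
           (cabs (phi (Res (a +i* b)%C (Res (a +i* b)%C x))))%:E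
        <= C%:E)%E) ->
  (forall f : R[i] -> R[i], classB0 f ->
     forall T : R -> X -> X,
       (forall t : R, 0 < t -> Bcalc_rep Res (dilate t f) (T t)) ->
       forall eps : R, 0 < eps -> exists t0 : R, forall t : R, t0 <= t ->
         forall x : X, rnorm (T t x) <= eps * rnorm x) /\
  (forall S : R -> X -> X,
     (forall t : R, 0 <= t -> Bcalc_rep Res (cexp_neg t) (S t)) ->
     exists M : R, exists2 w : R, 0 < w &
       forall t : R, 0 <= t -> forall x : X,
         rnorm (S t x) <= M * expR (- w * t) * rnorm x).
Proof.
move=> domA resA hyp; have [K K0 HK] := integral_res_sqr_le resA hyp.
split=> [f fB0 T repT eps eps0|S repS].
- exact: (Bcalc_vanish resA K0 HK fB0 repT eps0).
- exact: (semigroup_decay domA resA K0 HK repS).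
Qed.
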